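(* For each $n$, let $(A,B)=(A_n,B_n)\sim \mathrm{CorrER}(Q_1,Q_2,R)$ on the vertex set $[n]$ (where $Q_1,Q_2,R$ may depend on $n$), and assume that for each $i=1,2$: (i) there exists $r_i=r_i(n)\in[0,1]$ such that $Q_i\le r_i$ entry-wise; (ii) $\min_j\sum_\ell Q_i(j,\ell)=\omega(\log n)$; (iii) there exists $d_i=d_i(n)=o(n)$ such that $\sum_{j>d_i}s_j^2(Q_i)=O(n r_i d_i)$, where $s_1(Q_i)\ge s_2(Q_i)\ge\cdots\ge s_n(Q_i)$ are the singular values of $Q_i$. For $k\ge 1$ let $\Pi(n,k)=\{P\in\Pi(n):\sum_{i=1}^nP(i,i)=n-k\}$ (empty for $k>n$), and for $P\in\Pi(n)$ let $$\mathcal{X}_P=\frac12\sum_{u,v\in[n]}\Big(\mathrm{Cov}\big[A(u,v),B(u,v)\big]-\mathrm{Cov}\big[A(u,v),(PBP^T)(u,v)\big]\Big).$$ Suppose there exists $\delta=\delta(n)\ge0$ such that for all $k\in[n]$ and all $P\in\Pi(n,k)$ (uniformly in $k$ and $P$, as $n\to\infty$) $$\frac{\mathcal{X}_P}{k}=\omega\big(n^{1/2+\delta}\sqrt{\log n}\big).$$ Then there exist constants $a_1,a_2>0$ such that the following holds. Let $\widehat Q_1$ be the USVT estimate computed from $A$ with threshold $t_1=a_1\sqrt{nr_1}$, let $\widehat Q_2$ be the USVT estimate computed from $B$ with threshold $t_2=a_2\sqrt{nr_2}$, and set $\widehat A=A-\widehat Q_1$, $\widehat B=B-\widehat Q_2$.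 If $k_0=k_0(n)$ is a sequence of positive integers with $$k_0=\omega\left(\frac{n^{1-\delta}}{\sqrt{\log n}}\big(\sqrt{r_1}+\sqrt{r_2}\big)\big(\sqrt{r_1d_1}+\sqrt{r_2d_2}\big)\right),$$ then for all sufficiently large $n$ $$\mathbb{P}\left(\operatorname{argmin}_{P\in\Pi(n)}\|\widehat A-P\widehat BP^T\|_F\ \cap\ \bigcup_{i=k_0+1}^{\infty}\Pi(n,i)=\emptyset\right)\ \ge\ 1-5n^{-2}.$$
   Context: Notation: $[n]=\{1,\dots,n\}$; $\Pi(n)$ is the set of $n\times n$ permutation matrices; $\|\cdot\|_F$ is the Frobenius norm; $\operatorname{argmin}$ denotes the set of all minimizers. Graphs are identified with their symmetric, hollow (zero diagonal) $0/1$ adjacency matrices. Model: $(A,B)\sim\mathrm{CorrER}(Q_1,Q_2,R)$, for symmetric matrices $Q_1,Q_2,R\in\mathbb{R}^{n\times n}$ ($Q_1,Q_2$ being edge-probability matrices with entries in $[0,1]$), means: (1) $A$ is the adjacency matrix of a random simple graph on $[n]$ with independent edges and no self-loops, with $A(u,v)\sim\mathrm{Bernoulli}(Q_1(u,v))$ for each unordered pair $\{u,v\}$, $u\ne v$; (2) $B$ is likewise an independent-edge loop-free random graph with $B(u,v)\sim\mathrm{Bernoulli}(Q_2(u,v))$; (3) the edges across the two graphs are collectively independent except that, for each pair $\{u,v\}$, the correlation between $A(u,v)$ and $B(u,v)$ is $R(u,v)\ge 0$, i.e. $\mathrm{Cov}(A(u,v),B(u,v))=R(u,v)\sqrt{\mathrm{Var}(A(u,v))\mathrm{Var}(B(u,v))}$.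 (Thus the random pairs $(A(u,v),B(u,v))$ are independent over distinct $\{u,v\}$.) The diagonals of $Q_1,Q_2$ are not assumed to be zero, but $A,B$ have zero diagonal. USVT (Universal Singular Value Thresholding) estimate from an adjacency matrix $A$ with threshold $t>0$: let $A=\sum_{i=1}^n\sigma_iu_iv_i^T$ be a singular value decomposition with $\sigma_1\ge\cdots\ge\sigma_n$, and let $\breve A=\sum_{i:\sigma_i>t}\sigma_iu_iv_i^T$. The output is $\widehat Q\in[0,1]^{n\times n}$ with $\widehat Q(i,i)=0$ for all $i$, and for $i\ne j$, $\widehat Q(i,j)=\breve A(i,j)$ if $\breve A(i,j)\in[0,1]$, $\widehat Q(i,j)=0$ if $\breve A(i,j)<0$, and $\widehat Q(i,j)=1$ if $\breve A(i,j)>1$. Asymptotic notation, as $n\to\infty$: for nonnegative $f,g$, $f=o(g)$ means $f(n)/g(n)\to0$; $f=\omega(g)$ means $g=o(f)$; $f=O(g)$ means $f(n)<Cg(n)$ for some constant $C>0$ and all large $n$. *)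

(* Defs.v *)
From HB Require Import structures.
From mathcomp Require Export all_boot all_order all_algebra.
From mathcomp Require Export all_classical all_reals all_analysis.

Set Implicit Arguments.
Unset Strict Implicit.
Unset Printing Implicit Defensive.

Import Order.TTheory GRing.Theory Num.Theory.
Export numFieldNormedType.Exports.

Local Open Scope classical_set_scope.
Local Open Scope ring_scope.

(* [f = omega(g)] as n tends to infinity, i.e. g = o(f).  The relation =o_\oo of
   the landau library is "for all e > 0, eventually |g n| <= e |f n|": it has no
   division, hence no spurious instance where f vanishes. *)
Definition little_omega (R : realType) (f g : nat -> R) : Prop :=
  (g : nat -> R^o) =o_\oo (f : nat -> R^o).

Section LinearAlgebra.
Variables (R : realType) (n : nat).
Implicit Types (A U V P : 'M[R]_n) (s : 'rV[R]_n).

Definition frobenius A : R := Num.sqrt (\sum_i \sum_j A i j ^+ 2).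

(* A = \sum_i s_i u_i v_i^T with u_i (resp. v_i) the columns of the orthogonal
   matrix U (resp. V) and s_1 >= ... >= s_n >= 0. *)
Definition is_svd A (D : 'M[R]_n * 'rV[R]_n * 'M[R]_n) : Prop :=
  let: (U, s, V) := D in
  [/\ U^T *m U = 1%:M, V^T *m V = 1%:M,
      forall i, 0 <= s 0 i,
      forall i j : 'I_n, (i <= j)%N -> s 0 j <= s 0 i &
      A = \sum_i s 0 i *: (col i U *m (col i V)^T)].

(* A singular value decomposition of A; every real square matrix has one, so the
   default value is never used. *)
Definition svd A : 'M[R]_n * 'rV[R]_n * 'M[R]_n :=
  xget (0, 0, 0) [set D | is_svd A D].

(* [singular_value A j] is s_{j+1}(A). *)
Definition singular_value A (j : 'I_n) : R := (svd A).1.2 0 j.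

(* \sum_{j > d} s_j(A)^2, for a real cut-off d. *)
Definition sv_tail A (d : R) : R :=
  \sum_(j < n | d < j.+1%:R) singular_value A j ^+ 2.

Definition usvt_trunc (t : R) A : 'M[R]_n :=
  let: (U, s, V) := svd A in
  \sum_(i | t < s 0 i) s 0 i *: (col i U *m (col i V)^T).

Definition usvt (t : R) A : 'M[R]_n :=
  \matrix_(i, j)
    if i == j then 0
    else let x := usvt_trunc t A i j in
         if x < 0 then 0 else if 1 < x then 1 else x.

(* The infimum is over a finite set, nonempty as soon as n >= 1. *)
Definition min_row_sum A : R := inf [set \sum_l A j l | j in [set: 'I_n]].

Definition perm_matrices : set 'M[R]_n := [set P | is_perm_mx P].

(* The trace is compared in R, where n - k is not truncated: the set is empty for
   k > n. *)
Definition perm_matrices_moving (k : nat) : set 'M[R]_n :=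
  [set P | perm_matrices P /\ \tr P = n%:R - k%:R].

Definition matching_argmin A B : set 'M[R]_n :=
  [set P | perm_matrices P /\
     forall P', perm_matrices P' ->
       frobenius (A - P *m B *m P^T) <= frobenius (A - P' *m B *m P'^T)].

End LinearAlgebra.

Arguments perm_matrices : clear implicits.
Arguments perm_matrices_moving : clear implicits.

Definition mutually_independent (R : realType) d (T : measurableType d)
    (Pr : probability T R) d' (T' : measurableType d') (I : finType)
    (D : {set I}) (X : I -> T -> T') : Prop :=
  forall (J : {set I}), J \subset D ->
  forall E : I -> set T', (forall i, i \in J -> measurable (E i)) ->
    Pr (\bigcap_(i in [set` J]) (X i @^-1` E i)) =
      (\prod_(i in J) Pr (X i @^-1` E i))%E.

Section Model.
Variables (R : realType) (d : measure_display) (T : measurableType d).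
Variables (Pr : probability T R) (n : nat).
Implicit Types (Q Rho : 'M[R]_n) (A B : T -> 'M[R]_n).

(* The adjacency matrix of a random loop-free simple graph whose edge {u, v} has
   law Bernoulli(Q u v); joint laws are dealt with in corrER. *)
Definition random_graph Q A : Prop :=
  [/\ forall u v, measurable_fun [set: T] (fun w => A w u v),
      forall w, (A w)^T = A w,
      forall w u, A w u u = 0,
      forall w u v, A w u v = 0 \/ A w u v = 1 &
      forall u v, u != v -> Pr [set w | A w u v = 1] = (Q u v)%:E].

Definition edge_prob_matrix Q : Prop :=
  Q^T = Q /\ forall u v, 0 <= Q u v <= 1.

(* Independence of the pairs (A u v, B u v) over u < v contains the independence
   of the edges inside each graph. *)
Definition corrER Q1 Q2 Rho A B : Prop :=
  [/\ [/\ edge_prob_matrix Q1, edge_prob_matrix Q2 & Rho^T = Rho],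
      random_graph Q1 A,
      random_graph Q2 B,
      forall u v, u != v ->
        0 <= Rho u v /\
        covariance Pr (fun w => A w u v) (fun w => B w u v) =
          (Rho u v * Num.sqrt (fine (variance Pr (fun w => A w u v)) *
                               fine (variance Pr (fun w => B w u v))))%:E &
      mutually_independent Pr [set e : 'I_n * 'I_n | (e.1 < e.2)%N]%SET
        (fun e w => (A w e.1 e.2, B w e.1 e.2))].

(* The library's covariance is extended-real valued; it is finite for the bounded
   random variables considered here. *)
Definition calX A B (P : 'M[R]_n) : R :=
  2^-1 * \sum_u \sum_v
    (fine (covariance Pr (fun w => A w u v) (fun w => B w u v)) -
     fine (covariance Pr (fun w => A w u v)
                         (fun w => (P *m B w *m P^T) u v))).

End Model.

(* Main.v *)
(** Write A = Q1 + X and B = Q2 + Y with Q1, Q2 hollow, let E, F be the errors of the two USVT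
estimates, and let D Z = Z - P Z P^T.  A minimizer P satisfies <X + E, D (Y + F)> <= 0, whereas
<X, D Y> has expectation 2 X_P and, by McDiarmid's inequality applied to the independent pairs
(A(u,v), B(u,v)) and a union bound over all permutations, exceeds X_P for every P at once.  The
remaining terms are at most 2 (|X||F| + |E||Y| + |E||F|) in Frobenius norm, which is too small
when P moves more than k0 vertices.

Both |X| <= sqrt n ||X|| and |E| = O(sqrt (n r d)) follow from ||X|| = O(sqrt (n r)) for the
operator norm.  As in Bandeira and van Handel, E tr X^(2p) is at most a sum over the closed walks
that visit no edge exactly once, where a walk through m vertices has weight r^(m-1).  With
p close to n r, comparing numbers of walks of each shape bounds this by E tr Y^(2p) / r for a
dense matrix Y of size 2p whose entries have all moments but the first at least 1, and ||Y|| is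
controlled by a net. *)

Require Import Defs.
From mathcomp Require Import all_boot all_order all_algebra.
From mathcomp Require Import all_classical all_reals all_analysis.
From mathcomp Require Import measurable_realfun perm ring lra zify.
Set Implicit Arguments.
Unset Strict Implicit.
Unset Printing Implicit Defensive.
Import Order.TTheory GRing.Theory Num.Theory.
Local Open Scope ring_scope.

(** * Product weights on finite functions and bounded differences *)

(** The obstacle is sparsity: n r is only known to dominate log n, and the sub-Gaussian constant of
    a centered Bernoulli(r) variable is then much larger than r, so a net applied directly to X
    would miss the order sqrt (n r). A net is good enough for the dense matrix, whose entries are
    bounded by an absolute constant. Comparing walks of length 2p on n vertices with walks on N
    vertices requires n r <= N - p; the choice p = M, the first integer above n r, and N = 2M meets
    this and keeps the dense trace moment of order (n r)^M. The factor 1/r lost in the comparison is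
    at most n, and an M-th power with M >= log n absorbs it in a constant. All randomness is carried
    by a finite set of pairs of graphs, so expectations are finite weighted sums and conditional
    expectations are averages over one coordinate. The two operator norm events fail with
    probability at most n^-3 each, the union bound over permutations with at most 2 n^-4; together
    this is below 5 n^-2. *)

Lemma expR_le_add_expR_sq (R : realType) (x : R) : expR x <= x + expR (2 * x ^+ 2).
Proof.
have lb : 1 + 2 * x ^+ 2 <= expR (2 * x ^+ 2) by exact: expR_ge1Dx.
have [hx|hx] := leP 2^-1 x.
  have : expR x <= expR (2 * x ^+ 2) by rewrite ler_expR; nra.
  lra.
have [hx'|hx'] := leP (- 2^-1) x; last first.
  have e1 : expR x <= 1 by rewrite -expR0 ler_expR; lra.
  suff : 1 - x <= 1 + 2 * x ^+ 2 by lra.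
  nra.
suff : expR x <= 1 + x + 2 * x ^+ 2 by lra.
have e1 : 1 - x <= expR (- x) by exact: expR_ge1Dx.
have e2 : 0 < expR x by exact: expR_gt0.
have e3 : expR x * (1 - x) <= 1.
  by rewrite -[leRHS](expRxMexpNx_1 x) ler_pM2l.
have q0 : 0 <= 1 - 2 * x by lra.
have e4 : 1 <= (1 - x) * (1 + x + 2 * x ^+ 2).
  rewrite -subr_ge0 (_ : _ - 1 = x ^+ 2 * (1 - 2 * x)); last by ring.
  by rewrite mulr_ge0 // sqr_ge0.
have x1 : 0 < 1 - x by lra.
by rewrite -(ler_pM2r x1) (le_trans e3)// mulrC.
Qed.

Section ProductExpectation.
Context {R : realType} {E V : finType}.
Variable p : E -> V -> R.

Definition weight (o : {ffun E -> V}) : R := \prod_e p e (o e).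

Definition Ex (f : {ffun E -> V} -> R) : R := \sum_o weight o * f o.

Lemma eq_Ex f g : f =1 g -> Ex f = Ex g.
Proof. by move=> fg; apply: eq_bigr => o _; rewrite fg. Qed.

Lemma ExD f g : Ex (fun o => f o + g o) = Ex f + Ex g.
Proof. by rewrite -big_split; apply: eq_bigr => o _; rewrite mulrDr. Qed.

Lemma ExZ c f : Ex (fun o => c * f o) = c * Ex f.
Proof. by rewrite mulr_sumr; apply: eq_bigr => o _; rewrite mulrCA. Qed.

Lemma Ex_sum (I : Type) (s : seq I) (P : pred I) (f : I -> {ffun E -> V} -> R) :
  Ex (fun o => \sum_(i <- s | P i) f i o) = \sum_(i <- s | P i) Ex (f i).
Proof.
by rewrite exchange_big; apply: eq_bigr => o _; rewrite mulr_sumr.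
Qed.

Lemma Ex_prod (g : E -> V -> R) :
  Ex (fun o => \prod_e g e (o e)) = \prod_e \sum_v p e v * g e v.
Proof.
rewrite bigA_distr_bigA; apply: eq_bigr => o _.
by rewrite -big_split.
Qed.

Hypothesis p_ge0 : forall e v, 0 <= p e v.
Hypothesis p_sum1 : forall e, \sum_v p e v = 1.

Lemma weight_ge0 o : 0 <= weight o.
Proof. exact: prodr_ge0. Qed.

Lemma Ex_cst c : Ex (fun=> c) = c.
Proof.
rewrite -[RHS]mulr1 -[X in _ = _ * X](_ : Ex (fun=> 1) = 1).
  by rewrite -ExZ; apply: eq_Ex => o; rewrite mulr1.
have := Ex_prod (fun _ _ => 1); rewrite (eq_Ex (g := fun=> 1)) => [->|o].
  by rewrite big1 // => e _; rewrite -mulr_suml p_sum1 mul1r.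
by rewrite big1.
Qed.

Lemma le_Ex f g : (forall o, f o <= g o) -> Ex f <= Ex g.
Proof. by move=> fg; apply: ler_sum => o _; rewrite ler_wpM2l ?weight_ge0. Qed.

Lemma Ex_coord (g : V -> R) e : Ex (fun o => g (o e)) = \sum_v p e v * g v.
Proof.
have := Ex_prod (fun e' v => if e' == e then g v else 1 : R).
rewrite (eq_Ex (g := fun o => g (o e))) => [->|o].
  rewrite (bigD1 e)//= eqxx [X in _ * X]big1 ?mulr1// => e' /negPf ->.
  by rewrite -mulr_suml p_sum1 mul1r.
by rewrite -big_mkcond/= big_pred1_eq.
Qed.

Lemma markov_Ex (S : pred {ffun E -> V}) (f : {ffun E -> V} -> R) (c : R) :
  0 < c -> (forall o, 0 <= f o) -> (forall o, S o -> c <= f o) ->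
  \sum_(o | S o) weight o <= Ex f / c.
Proof.
move=> c0 f0 Sf; rewrite ler_pdivlMr// mulr_suml big_mkcond.
apply: ler_sum => o _; case: ifPn => [/Sf cf|_].
  by rewrite ler_wpM2l ?weight_ge0.
by rewrite mulr_ge0 ?weight_ge0.
Qed.

Definition upd (o : {ffun E -> V}) e v : {ffun E -> V} :=
  [ffun e' => if e' == e then v else o e'].

Definition avg e (f : {ffun E -> V} -> R) o := \sum_v p e v * f (upd o e v).

Lemma weight_upd o e v : weight o * p e v = weight (upd o e v) * p e (o e).
Proof.
rewrite /weight (bigD1 e)//= [in RHS](bigD1 e)//= ffunE eqxx.
rewrite mulrAC [RHS]mulrAC [in LHS](mulrC (p e (o e))); congr (_ * _ * _).
by apply: eq_bigr => e' /negPf e'e; rewrite ffunE e'e.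
Qed.

(** Resampling coordinate [e] preserves the law: exchanging the old and the new value at [e] is an
    involution on pairs (configuration, fresh value) that preserves their joint weight. *)
Lemma Ex_avg e f : Ex (avg e f) = Ex f.
Proof.
under [LHS]eq_bigr do rewrite mulr_sumr.
rewrite (pair_bigA _ (fun o v => weight o * (p e v * f (upd o e v))))/=.
have inv : involutive (fun x : {ffun E -> V} * V => (upd x.1 e x.2, x.1 e)).
  move=> [x v] /=; congr (_, _); last by rewrite ffunE eqxx.
  by apply/ffunP => e'; rewrite !ffunE; case: eqP => // ->.
rewrite (reindex_inj (inv_inj inv))/=.
rewrite -(pair_bigA _ (fun o v => weight (upd o e v) *
   (p e (o e) * f (upd (upd o e v) e (o e)))))/=.
apply: eq_bigr => o _.
have -> : weight o * f o = \sum_v weight o * p e v * f o.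
  by rewrite -mulr_suml -mulr_sumr p_sum1 mulr1.
apply: eq_bigr => v _; rewrite weight_upd mulrA; congr (_ * f _).
by apply/ffunP => e'; rewrite !ffunE; case: eqP => // ->.
Qed.

Definition bounded_differences (c : E -> R) (f : {ffun E -> V} -> R) :=
  forall o e v, `|f o - f (upd o e v)| <= c e.

Lemma upd_upd o e v w : upd (upd o e v) e w = upd o e w.
Proof. by apply/ffunP => e'; rewrite !ffunE; case: eqP. Qed.

Lemma updC o e e' v w : e != e' -> upd (upd o e v) e' w = upd (upd o e' w) e v.
Proof.
move=> ee'; apply/ffunP => i; rewrite !ffunE; have [->|//] := eqVneq i e'.
by rewrite eq_sym (negPf ee').
Qed.

Lemma avg_bounded_differences c e f : (forall e, 0 <= c e) ->
  bounded_differences c f -> bounded_differences c (avg e f).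
Proof.
move=> c0 fc o e' v; rewrite /avg -sumrB.
under eq_bigr do rewrite -mulrBr.
rewrite (le_trans (ler_norm_sum _ _ _))//.
rewrite -[leRHS]mul1r -(p_sum1 e) mulr_suml; apply: ler_sum => w _.
rewrite normrM ger0_norm// ler_wpM2l//.
have [->|ne] := eqVneq e' e; first by rewrite upd_upd subrr normr0.
by rewrite updC//; exact: fc.
Qed.

(** One Hoeffding step. As [f] deviates from its average over coordinate [e] by at most [c e],
    [expR_le_add_expR_sq] applies to the centered exponent, and its linear term averages to zero. *)
Lemma avg_expR c e f l o : bounded_differences c f ->
  avg e (fun o => expR (l * f o)) o <= expR (2 * l ^+ 2 * c e ^+ 2) * expR (l * avg e f o).
Proof.
move=> fc; set m := avg e f o.
have hd v : (f (upd o e v) - m) ^+ 2 <= c e ^+ 2.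
  suff h : `|f (upd o e v) - m| <= c e.
    rewrite -(real_normK (num_real (_ - m))) ler_sqr ?nnegrE//.
    exact: le_trans (normr_ge0 _) h.
  have -> : f (upd o e v) - m = \sum_w p e w * (f (upd o e v) - f (upd o e w)).
    under eq_bigr do rewrite mulrBr.
    by rewrite sumrB -mulr_suml p_sum1 mul1r.
  rewrite (le_trans (ler_norm_sum _ _ _))//.
  rewrite -[leRHS]mul1r -(p_sum1 e) mulr_suml; apply: ler_sum => w _.
  by rewrite normrM ger0_norm// ler_wpM2l// -(upd_upd o e v w); exact: fc.
rewrite -ler_pdivrMr ?expR_gt0// /avg mulr_suml.
apply: (@le_trans _ _ (\sum_v p e v * (l * (f (upd o e v) - m) + expR (2 * l ^+ 2 * c e ^+ 2)))).
  apply: ler_sum => v _; rewrite -[leLHS]mulrA ler_wpM2l// -expRN -expRD -mulrBr.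
  rewrite (le_trans (expR_le_add_expR_sq _))// lerD2l ler_expR.
  rewrite -mulrA ler_wpM2l// exprMn.
  by rewrite ler_wpM2l ?sqr_ge0.
under eq_bigr do rewrite mulrDr mulrCA.
rewrite big_split/= -mulr_suml p_sum1 mul1r gerDr.
under eq_bigr do rewrite mulrBr.
by rewrite -mulr_sumr sumrB -mulr_suml p_sum1 mul1r /m /avg subrr mulr0.
Qed.

(** This replaces the martingale of McDiarmid's proof: coordinates are averaged out one after the
    other, and the bounded differences survive each averaging. *)
Lemma avg_seq_expR c (s : seq E) f l : (forall e, 0 <= c e) ->
  bounded_differences c f ->
  Ex (fun o => expR (l * f o)) <=
  expR (2 * l ^+ 2 * \sum_(e <- s) c e ^+ 2) * Ex (fun o => expR (l * foldl (fun g e => avg e g) f s o)).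
Proof.
move=> c0; elim: s f => [|e s IH] f fc /=.
  by rewrite big_nil mulr0 expR0 mul1r.
rewrite big_cons mulrDr expRD -mulrA.
apply: (@le_trans _ _ (expR (2 * l ^+ 2 * c e ^+ 2) * Ex (fun o => expR (l * avg e f o)))).
  rewrite -(Ex_avg e) -ExZ; apply: le_Ex => o; exact: avg_expR.
by rewrite ler_wpM2l ?expR_ge0//; apply: IH; exact: avg_bounded_differences.
Qed.

(** [S] collects the coordinates that [f] has already lost; the induction on [s] enlarges it. With
    [s] all of [E], the averaged function is constant. *)
Lemma avg_seq_local (s : seq E) (f : {ffun E -> V} -> R) (S : pred E) :
  (forall o o' : {ffun E -> V}, (forall e, ~~ S e -> o e = o' e) -> f o = f o') ->
  forall o o' : {ffun E -> V}, (forall e, ~~ S e -> e \notin s -> o e = o' e) ->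
  foldl (fun g e => avg e g) f s o = foldl (fun g e => avg e g) f s o'.
Proof.
elim: s f S => [|e s IH] f S fS o o' oo' /=; first by apply: fS => e /oo' ->.
apply: (IH _ [pred x | S x || (x == e)]) => [oa ob oab|e'].
  apply: eq_bigr => v _; congr (_ * _); apply: fS => e' Se'; rewrite !ffunE.
  by case: eqP => // /eqP ne; apply: oab; rewrite /= (negPf Se') (negPf ne).
by rewrite /= negb_or => /andP[Se' ne] es; apply: oo' => //; rewrite inE negb_or ne.
Qed.

Lemma mcdiarmid (c : E -> R) f l : (forall e, 0 <= c e) ->
  bounded_differences c f ->
  Ex (fun o => expR (l * (f o - Ex f))) <= expR (2 * l ^+ 2 * \sum_e c e ^+ 2).
Proof.
move=> c0 fc.
have cst o : foldl (fun g e => avg e g) f (enum E) o = Ex f.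
  rewrite -[LHS]Ex_cst.
  have loc o' : foldl (fun g e => avg e g) f (enum E) o = foldl (fun g e => avg e g) f (enum E) o'.
    apply: (@avg_seq_local _ _ pred0) => [oa ob h|e _]; last by rewrite mem_enum.
    by congr f; apply/ffunP => e; exact: h.
  rewrite (eq_Ex loc); elim: (enum E) f {fc loc} => //= e s IH g.
  by rewrite IH Ex_avg.
have := avg_seq_expR (enum E) l c0 fc.
have -> : Ex (fun o => expR (l * foldl (fun g e => avg e g) f (enum E) o)) = expR (l * Ex f).
  by rewrite -[RHS]Ex_cst; apply: eq_Ex => o; rewrite cst.
rewrite big_enum/= => h.
rewrite (eq_Ex (g := fun o => expR (- (l * Ex f)) * expR (l * f o))) => [|o].
  by rewrite ExZ mulrC expRN ler_pdivrMr ?expR_gt0.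
by rewrite -expRD mulrBr addrC.
Qed.

End ProductExpectation.

(** * Frobenius products and singular values *)

Section FrobeniusProduct.
Context {R : realType}.

Definition fdot {m n} (A B : 'M[R]_(m, n)) : R := \tr (A^T *m B).
Definition fsq {m n} (A : 'M[R]_(m, n)) : R := fdot A A.

Lemma fdotE m n (A B : 'M[R]_(m, n)) : fdot A B = \sum_i \sum_j A i j * B i j.
Proof.
rewrite /fdot /mxtrace exchange_big; apply: eq_bigr => j _.
by rewrite mxE; apply: eq_bigr => i _; rewrite mxE.
Qed.

Lemma fsqE m n (A : 'M[R]_(m, n)) : fsq A = \sum_i \sum_j A i j ^+ 2.
Proof. by rewrite /fsq fdotE; apply: eq_bigr => i _; apply: eq_bigr => j _; rewrite expr2. Qed.

Lemma fdotC m n (A B : 'M[R]_(m, n)) : fdot A B = fdot B A.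
Proof. by rewrite !fdotE; apply: eq_bigr => i _; apply: eq_bigr => j _; rewrite mulrC. Qed.

Lemma fdotDr m n (A B C : 'M[R]_(m, n)) : fdot A (B + C) = fdot A B + fdot A C.
Proof. by rewrite /fdot mulmxDr mxtraceD. Qed.

Lemma fdotNr m n (A B : 'M[R]_(m, n)) : fdot A (- B) = - fdot A B.
Proof. by rewrite /fdot mulmxN raddfN. Qed.

Lemma fdotZr m n c (A B : 'M[R]_(m, n)) : fdot A (c *: B) = c * fdot A B.
Proof. by rewrite /fdot -scalemxAr mxtraceZ. Qed.

Lemma fdotBr m n (A B C : 'M[R]_(m, n)) : fdot A (B - C) = fdot A B - fdot A C.
Proof. by rewrite fdotDr fdotNr. Qed.

Lemma fdotDl m n (A B C : 'M[R]_(m, n)) : fdot (A + B) C = fdot A C + fdot B C.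
Proof. by rewrite fdotC fdotDr !(fdotC C). Qed.

Lemma fdotNl m n (A B : 'M[R]_(m, n)) : fdot (- A) B = - fdot A B.
Proof. by rewrite fdotC fdotNr fdotC. Qed.

Lemma fdotBl m n (A B C : 'M[R]_(m, n)) : fdot (A - B) C = fdot A C - fdot B C.
Proof. by rewrite fdotDl fdotNl. Qed.

Lemma fdotZl m n c (A B : 'M[R]_(m, n)) : fdot (c *: A) B = c * fdot A B.
Proof. by rewrite fdotC fdotZr fdotC. Qed.

Lemma fdot0l m n (B : 'M[R]_(m, n)) : fdot 0 B = 0.
Proof. by rewrite /fdot trmx0 mul0mx mxtrace0. Qed.

Lemma fdot_mull m n k (M : 'M[R]_(m, n)) (A : 'M[R]_(n, k)) B :
  fdot (M *m A) B = fdot A (M^T *m B).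
Proof. by rewrite /fdot trmx_mul mulmxA. Qed.

Lemma fdot_mulr m n k (M : 'M[R]_(n, k)) (A : 'M[R]_(m, n)) B :
  fdot (A *m M) B = fdot A (B *m M^T).
Proof. by rewrite /fdot trmx_mul -mulmxA mxtrace_mulC mulmxA. Qed.

Lemma fdot_tr m n (A B : 'M[R]_(m, n)) : fdot A^T B^T = fdot A B.
Proof. by rewrite /fdot trmxK mxtrace_mulC -mxtrace_tr trmx_mul trmxK. Qed.

Lemma fsq_tr m n (A : 'M[R]_(m, n)) : fsq A^T = fsq A.
Proof. exact: fdot_tr. Qed.

Lemma fsq_ge0 m n (A : 'M[R]_(m, n)) : 0 <= fsq A.
Proof. by rewrite fsqE; do 2![apply: sumr_ge0 => ? _]; rewrite sqr_ge0. Qed.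

Lemma fsq_eq0 m n (A : 'M[R]_(m, n)) : fsq A = 0 -> A = 0.
Proof.
rewrite fsqE => /eqP; rewrite psumr_eq0 => [/allP h|i _]; last first.
  by apply: sumr_ge0 => j _; rewrite sqr_ge0.
apply/matrixP => i j; rewrite mxE; have /implyP/(_ isT) := h i (mem_index_enum _).
rewrite psumr_eq0 => [/allP/(_ j (mem_index_enum _))/implyP/(_ isT)|? _]; last by rewrite sqr_ge0.
by rewrite sqrf_eq0 => /eqP.
Qed.

Lemma fsqZ m n c (A : 'M[R]_(m, n)) : fsq (c *: A) = c ^+ 2 * fsq A.
Proof. by rewrite /fsq fdotZl fdotZr mulrA. Qed.

Lemma fsqN m n (A : 'M[R]_(m, n)) : fsq (- A) = fsq A.
Proof. by rewrite /fsq fdotNl fdotNr opprK. Qed.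

Lemma fsqD m n (A B : 'M[R]_(m, n)) : fsq (A + B) = fsq A + 2 * fdot A B + fsq B.
Proof. rewrite /fsq fdotDl !fdotDr (fdotC B A); ring. Qed.

Lemma fsqB m n (A B : 'M[R]_(m, n)) : fsq (A - B) = fsq A - 2 * fdot A B + fsq B.
Proof. by rewrite fsqD fsqN fdotNr mulrN. Qed.

Lemma fsqD_le m n (A B : 'M[R]_(m, n)) : fsq (A + B) <= 2 * fsq A + 2 * fsq B.
Proof. have := fsq_ge0 (A - B); rewrite fsqB fsqD; lra. Qed.

Lemma cauchy_schwarz m n (A B : 'M[R]_(m, n)) : fdot A B ^+ 2 <= fsq A * fsq B.
Proof.
have [/eqP b0|b0] := boolP (fsq B == 0).
  by rewrite b0 (fsq_eq0 b0) fdotC fdot0l expr0n mulr0.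
have bp : 0 < fsq B by rewrite lt_neqAle eq_sym b0 fsq_ge0.
have := fsq_ge0 (fsq B *: A - fdot A B *: B).
rewrite fsqB !fsqZ fdotZl fdotZr => h.
rewrite -subr_ge0 -(pmulr_rge0 _ bp); apply: le_trans h _.
rewrite le_eqVlt; apply/orP; left; apply/eqP; ring.
Qed.

Definition fnorm {m n} (A : 'M[R]_(m, n)) : R := Num.sqrt (fsq A).

Lemma fnorm_ge0 m n (A : 'M[R]_(m, n)) : 0 <= fnorm A.
Proof. exact: sqrtr_ge0. Qed.

Lemma sqr_fnorm m n (A : 'M[R]_(m, n)) : fnorm A ^+ 2 = fsq A.
Proof. by rewrite sqr_sqrtr ?fsq_ge0. Qed.

Lemma fdot_le m n (A B : 'M[R]_(m, n)) : `|fdot A B| <= fnorm A * fnorm B.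
Proof.
rewrite -ler_sqr ?nnegrE ?mulr_ge0 ?fnorm_ge0// exprMn !sqr_fnorm.
by rewrite real_normK ?num_real// cauchy_schwarz.
Qed.

Lemma fnormD m n (A B : 'M[R]_(m, n)) : fnorm (A + B) <= fnorm A + fnorm B.
Proof.
rewrite -ler_sqr ?nnegrE ?addr_ge0 ?fnorm_ge0// sqr_fnorm fsqD sqrrD !sqr_fnorm.
have := le_trans (ler_norm _) (fdot_le A B); lra.
Qed.

Lemma fnormN m n (A : 'M[R]_(m, n)) : fnorm (- A) = fnorm A.
Proof. by rewrite /fnorm fsqN. Qed.

Lemma fnormB m n (A B : 'M[R]_(m, n)) : fnorm (A - B) <= fnorm A + fnorm B.
Proof. by rewrite -(fnormN B) fnormD. Qed.

Lemma fsq_orth m n k (U : 'M[R]_(m, n)) (A : 'M[R]_(n, k)) :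
  U^T *m U = 1%:M -> fsq (U *m A) = fsq A.
Proof. by move=> UU; rewrite /fsq fdot_mull mulmxA UU mul1mx. Qed.

Lemma fsq_orthr m n k (U : 'M[R]_(n, k)) (A : 'M[R]_(m, n)) :
  U *m U^T = 1%:M -> fsq (A *m U) = fsq A.
Proof. by move=> UU; rewrite /fsq fdot_mulr -mulmxA UU mulmx1. Qed.

End FrobeniusProduct.

(** * Existence of singular value decompositions *)

Section SVDExistence.
Local Open Scope classical_set_scope.
Context {R : realType}.

Lemma continuous_sum (T : topologicalType) (I : Type) (s : seq I) (f : I -> T -> R) :
  (forall i, continuous (f i)) -> continuous (fun x => \sum_(i <- s) f i x).
Proof. by move=> fc; apply: continuous_big => [|i _]; [exact: add_continuous|exact: fc]. Qed.

Lemma continuous_fsq_mul k n (A : 'M[R]_(k, n)) :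
  continuous (fun x : 'rV[R]_n => fsq (A *m x^T)).
Proof.
move=> x; under eq_fun do rewrite fsqE.
apply: continuous_sum => i {}x; apply: continuous_sum => j {}x.
under eq_fun do rewrite mxE expr2.
have c : continuous (fun x : 'rV[R]_n => \sum_k A i k * x^T k j).
  apply: continuous_sum => l {}x; apply: (@continuousM _ _ (fun=> A i l) (fun x : 'rV[R]_n => x^T l j)).
    exact: cst_continuous.
  have -> : (fun x : 'rV[R]_n => x^T l j) = (fun x => x j l).
    by apply/funext => y; rewrite mxE.
  exact: coord_continuous.
apply: (@continuousM _ _ (fun x : 'rV[R]_n => \sum_k A i k * x^T k j)); exact: c.
Qed.

Lemma constrained_sphere_max k l n (A : 'M[R]_(l, n)) (W : 'M[R]_(k, n)) (x0 : 'cV[R]_n) :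
  x0 != 0 -> W *m x0 = 0 ->
  exists v : 'cV[R]_n, [/\ fsq v = 1, W *m v = 0 &
    forall x : 'cV[R]_n, W *m x = 0 -> fsq (A *m x) <= fsq (A *m v) * fsq x].
Proof.
move=> x0N Wx0.
have pos (x : 'cV[R]_n) : x != 0 -> 0 < fsq x.
  by move=> xN; rewrite lt_neqAle fsq_ge0 andbT eq_sym; apply: contraNneq xN => /fsq_eq0 ->.
have normalize (x : 'cV[R]_n) : x != 0 -> fsq ((fnorm x)^-1 *: x) = 1.
  move=> /pos xp; rewrite fsqZ exprVn sqr_fnorm mulVf// gt_eqF//.
(* The factor [1%:M] lets [continuous_fsq_mul] handle both constraints; [S] is a closed part of the
   cube [-1, 1]^n. *)
pose S := [set x : 'rV[R]_n | fsq (1%:M *m x^T) = 1 /\ fsq (W *m x^T) = 0].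
have S0 : S !=set0.
  exists ((fnorm x0)^-1 *: x0)^T; split; rewrite trmxK.
    by rewrite mul1mx normalize.
  by rewrite -scalemxAr Wx0 scaler0 /fsq fdot0l.
have Scompact : compact S.
  apply: (@subclosed_compact _ _ [set x : 'rV[R]_n | forall i, x ord0 i \in `[-1, 1]%R]).
  - apply: closedI.
      apply: (@closed_comp _ _ (fun x : 'rV[R]_n => fsq (1%:M *m x^T)) [set x | x = 1]) => //.
      by move=> ? _; exact: continuous_fsq_mul.
    apply: (@closed_comp _ _ (fun x : 'rV[R]_n => fsq (W *m x^T)) [set x | x = 0]) => //.
    by move=> ? _; exact: continuous_fsq_mul.
  - apply: (@rV_compact _ _ (fun=> `[(-1 : R), 1]%classic)) => _; exact: segment_compact.
  move=> x [x1 _] i; rewrite in_itv/= -ler_norml -ler_sqr ?nnegrE// expr1n -x1 mul1mx fsq_tr fsqE.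
  rewrite big_ord1 real_normK ?num_real// (bigD1 i)//= lerDl.
  by apply: sumr_ge0 => j _; rewrite sqr_ge0.
have [v /set_mem[v1 Wv] vmax] := compact_EVT_max S0 Scompact
  (continuous_subspaceT (@continuous_fsq_mul l n A)).
rewrite mul1mx in v1; exists v^T; split => //; first exact: fsq_eq0.
move=> x Wx; have [->|xN] := eqVneq x 0.
  by rewrite mulmx0 /fsq !fdot0l mulr0.
have : fsq (A *m ((fnorm x)^-1 *: x)) <= fsq (A *m v^T).
  rewrite -[X in _ *m X]trmxK; apply: vmax; apply/mem_set; split; rewrite trmxK.
    by rewrite mul1mx normalize.
  by rewrite -scalemxAr Wx scaler0 /fsq fdot0l.
by rewrite -scalemxAr fsqZ exprVn sqr_fnorm mulrC ler_pdivrMr ?pos.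
Qed.

End SVDExistence.

Section PartialSVD.
Local Open Scope classical_set_scope.
Context {R : realType}.

Definition rows_mx {n} k (v : nat -> 'cV[R]_n) : 'M[R]_(k, n) := \matrix_(i, j) v i j 0.

Lemma rows_mx_mulP n k (v : nat -> 'cV[R]_n) (x : 'cV[R]_n) :
  rows_mx k v *m x = 0 <-> (forall i, (i < k)%N -> fdot (v i) x = 0).
Proof.
have e (i : 'I_k) : (rows_mx k v *m x) i 0 = fdot (v i) x.
  rewrite mxE fdotE; apply: eq_bigr => j _.
  by rewrite big_ord1 mxE.
split=> [h i ik|h].
  by rewrite -(e (Ordinal ik)) h mxE.
by apply/matrixP => i j; rewrite (ord1 j) e h// mxE.
Qed.

Lemma rows_mx_kernel n k (v : nat -> 'cV[R]_n) : (k < n)%N ->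
  exists2 x : 'cV[R]_n, x != 0 & rows_mx k v *m x = 0.
Proof.
move=> kn; pose K := kermx (rows_mx k v)^T.
have : K != 0.
  by rewrite -mxrank_eq0 mxrank_ker -lt0n subn_gt0 (leq_ltn_trans (rank_leq_col _)).
case/rowV0Pn => y /sub_kermxP yK yN; exists y^T; first by rewrite trmx_eq0.
by apply: (can_inj (@trmxK _ _ _)); rewrite trmx_mul trmxK yK trmx0.
Qed.

Lemma quadratic_ge0_slope (b c : R) : 0 <= c -> (forall e, 0 <= e * b + e ^+ 2 * c) -> b = 0.
Proof.
move=> c0 h; have c1 : 0 < c + 1 by lra.
have := h (- b / (c + 1)); rewrite -(pmulr_rge0 _ (exprn_gt0 2 c1)).
have -> : (c + 1) ^+ 2 * (- b / (c + 1) * b + (- b / (c + 1)) ^+ 2 * c) = - b ^+ 2.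
  by field; rewrite gt_eqF.
by rewrite oppr_ge0 => h'; apply/eqP; rewrite -sqrf_eq0 eq_le h' sqr_ge0.
Qed.

(** Greedy construction: the next right singular vector maximizes |A x| on the unit sphere
    orthogonal to the previous ones. The last clause is the induction invariant that makes the new
    singular value at most the old ones. *)
Lemma partial_svd n (A : 'M[R]_n) k : (k <= n)%N ->
  exists (u v : nat -> 'cV[R]_n) (s : nat -> R),
  [/\ forall i j, (i < k)%N -> (j < k)%N -> fdot (u i) (u j) = (i == j)%:R,
      forall i j, (i < k)%N -> (j < k)%N -> fdot (v i) (v j) = (i == j)%:R,
      forall i, (i < k)%N -> [/\ 0 <= s i, A *m v i = s i *: u i & A^T *m u i = s i *: v i],
      forall i j, (i <= j < k)%N -> s j <= s i &
      forall i (x : 'cV[R]_n), (i < k)%N -> (forall j, (j < k)%N -> fdot (v j) x = 0) ->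
        fsq (A *m x) <= s i ^+ 2 * fsq x].
Proof.
elim: k => [_|k IH kn]; first by exists (fun=> 0), (fun=> 0), (fun=> 0); split => // i j; rewrite ltn0 andbF.
have [u [v [s [uu vv As sd sm]]]] := IH (ltnW kn).
have [x0 x0N Wx0] := rows_mx_kernel v kn.
have [v' [v'1 /rows_mx_mulP Wv' vmax]] := constrained_sphere_max A x0N Wx0.
pose s' := fnorm (A *m v').
have s'2 : fsq (A *m v') = s' ^+ 2 by rewrite sqr_fnorm.
(* First-order optimality of [v'] along [v' + e *: x]: a quadratic in [e] that vanishes at 0 and
   stays nonnegative has zero slope. *)
have kerP x : rows_mx k v *m x = 0 -> fdot (A^T *m (A *m v') - s' ^+ 2 *: v') x = 0.
  move=> Wx; apply/eqP; rewrite -oppr_eq0; apply/eqP.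
  have c0 : 0 <= s' ^+ 2 * fsq x - fsq (A *m x) by rewrite subr_ge0 -s'2 vmax.
  suff : 2 * - fdot (A^T *m (A *m v') - s' ^+ 2 *: v') x = 0 by lra.
  apply: (quadratic_ge0_slope c0) => e.
  have : fsq (A *m (v' + e *: x)) <= fsq (A *m v') * fsq (v' + e *: x).
    by apply: vmax; rewrite mulmxDr -scalemxAr Wx scaler0 addr0; apply/rows_mx_mulP.
  rewrite mulmxDr -scalemxAr !fsqD !fsqZ !fdotZr v'1 s'2 fdotBl fdotZl.
  have -> : fdot (A^T *m (A *m v')) x = fdot (A *m v') (A *m x) by rewrite fdot_mull trmxK.
  lra.
(* The difference is itself orthogonal to the previous [v i], hence orthogonal to itself. *)
have AA : A^T *m (A *m v') = s' ^+ 2 *: v'.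
  apply/eqP; rewrite -subr_eq0; apply/eqP; apply: fsq_eq0; apply: kerP.
  apply/rows_mx_mulP => i ik; have [si Av Au] := As _ ik.
  rewrite fdotBr fdotZr Wv'// mulr0 subr0 -fdot_mull Av fdotZl.
  by rewrite -[A]trmxK -fdot_mull Au fdotZl Wv'// !mulr0.
have [u' [u'1 u'u Av' Au']] : exists u', [/\ fsq u' = 1, forall i, (i < k)%N -> fdot (u i) u' = 0,
   A *m v' = s' *: u' & A^T *m u' = s' *: v'].
  have [s'0|s'N] := eqVneq s' 0; last first.
    exists (s'^-1 *: (A *m v')); split.
    - by rewrite fsqZ s'2 -exprMn mulVf// expr1n.
    - move=> i ik; have [si Av Au] := As _ ik.
      by rewrite fdotZr -[A]trmxK -fdot_mull Au fdotZl Wv'// !mulr0.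
    - by rewrite scalerA divff// scale1r.
    - by rewrite -scalemxAr AA scalerA expr2 mulKf.
  (* When [s'] is 0, any unit vector orthogonal to the previous [u i] can serve as [u']: by
     maximality [A] vanishes on the orthogonal complement of the [v i], which contains [A^T *m u'],
     and this forces [A^T *m u' = 0]. *)
  have [y0 y0N Wy0] := rows_mx_kernel u kn.
  have [u' [u'1 /rows_mx_mulP Wu' _]] := constrained_sphere_max (0 : 'M[R]_n) y0N Wy0.
  have Av0 : A *m v' = 0 by apply: fsq_eq0; rewrite s'2 s'0 expr0n.
  exists u'; split=> //; first by rewrite s'0 scale0r.
  rewrite s'0 scale0r; apply: fsq_eq0.
  have Wy : rows_mx k v *m (A^T *m u') = 0.
    apply/rows_mx_mulP => i ik; have [si Av Au] := As _ ik.
    by rewrite -fdot_mull Av fdotZl Wu'// mulr0.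
  have := vmax _ Wy; rewrite Av0 [fsq 0]/fsq fdot0l mul0r => h.
  have /fsq_eq0 : fsq (A *m (A^T *m u')) = 0 by apply/eqP; rewrite eq_le h fsq_ge0.
  by rewrite {1}/fsq fdot_mull trmxK => ->; rewrite fdotC fdot0l.
exists (fun i => if i == k then u' else u i), (fun i => if i == k then v' else v i),
  (fun i => if i == k then s' else s i).
have lt i : (i < k.+1)%N -> i != k -> (i < k)%N by rewrite ltnS leq_eqVlt => /orP[->|].
split.
- move=> i j ik jk; have [ei|ni] := eqVneq i k; have [ej|nj] := eqVneq j k.
  + by rewrite ei ej eqxx.
  + by rewrite ei eq_sym (negPf nj) fdotC u'u// lt.
  + by rewrite ej (negPf ni) u'u// lt.
  + by rewrite uu// lt.
- move=> i j ik jk; have [ei|ni] := eqVneq i k; have [ej|nj] := eqVneq j k.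
  + by rewrite ei ej eqxx.
  + by rewrite ei eq_sym (negPf nj) fdotC Wv'// lt.
  + by rewrite ej (negPf ni) Wv'// lt.
  + by rewrite vv// lt.
- move=> i ik; have [ei|ni] := eqVneq i k; first by split; rewrite ?fnorm_ge0.
  exact: As (lt _ _ _).
- move=> i j /andP[ij jk]; have [ei|ni] := eqVneq i k; have [ej|nj] := eqVneq j k => //.
  + by move: ij nj; rewrite ei => kj; rewrite (@anti_leq j k) ?eqxx// kj -ltnS jk.
  + rewrite ej in ij; have ik : (i < k)%N by rewrite lt.
    have [si _ _] := As _ ik.
    rewrite -ler_sqr ?nnegrE ?fnorm_ge0// -s'2 -[leRHS]mulr1 -v'1.
    exact: sm.
  + by apply: sd; rewrite ij lt.
- move=> i x ik h.
  have hx j : (j < k)%N -> fdot (v j) x = 0.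
    by move=> jk; have := h j (ltnW jk); rewrite ltn_eqF.
  have [ei|ni] := eqVneq i k; last by apply: sm => //; exact: lt.
  by rewrite -s'2; apply: vmax; apply/rows_mx_mulP.
Qed.

Lemma sum_outer n (P : pred 'I_n) (U V : 'M[R]_n) (s : 'I_n -> R) :
  \sum_(i | P i) s i *: (col i U *m (col i V)^T) =
  U *m diag_mx (\row_i (if P i then s i else 0)) *m V^T.
Proof.
apply/matrixP => a b; rewrite summxE mxE big_mkcond; apply: eq_bigr => i _.
rewrite mul_mx_diag !mxE; case: ifP => _; last by rewrite mulr0 mul0r.
by rewrite big_ord1 !mxE mulrA (mulrC (s i)).
Qed.

Lemma svd_exists n (A : 'M[R]_n) : exists D, is_svd A D.
Proof.
have [u [v [s [uu vv As sd _]]]] := partial_svd A (leqnn n).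
pose U := \matrix_(i, j < n) u j i 0; pose V := \matrix_(i, j < n) v j i 0.
have orth (w : nat -> 'cV[R]_n) : (forall i j, (i < n)%N -> (j < n)%N -> fdot (w i) (w j) = (i == j)%:R) ->
    (\matrix_(i, j < n) w j i 0)^T *m (\matrix_(i, j < n) w j i 0) = 1%:M.
  move=> ww; apply/matrixP => i j; rewrite !mxE -[RHS](ww i j)// fdotE.
  by apply: eq_bigr => l _; rewrite big_ord1 !mxE.
have VV := orth v vv.
exists (U, \row_i s i, V); split=> //; first exact: orth.
- by move=> i; rewrite mxE; have [] := As i (ltn_ord i).
- by move=> i j ij; rewrite !mxE; apply: sd; rewrite ij /=.
rewrite (sum_outer predT U V (fun i => (\row_i s i) 0 i)).
have -> : A = A *m V *m V^T by rewrite -mulmxA (mulmx1C VV) mulmx1.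
congr (_ *m _); apply/matrixP => i j; rewrite mul_mx_diag !mxE.
have [_ /matrixP/(_ i 0) e _] := As j (ltn_ord j).
rewrite !mxE in e; rewrite mulrC -e.
by apply: eq_bigr => l _; rewrite mxE.
Qed.

Lemma svdP n (A : 'M[R]_n) : is_svd A (svd A).
Proof. by have := svd_exists A; exact: (@xgetPex _ (0, 0, 0) [set D | is_svd A D]). Qed.

End PartialSVD.

(** * Operator norm bounds and projections onto singular subspaces *)

Section OperatorBound.
Context {R : realType}.

Definition opbound {m n} (c : R) (Z : 'M[R]_(m, n)) :=
  forall x : 'cV[R]_n, fsq (Z *m x) <= c ^+ 2 * fsq x.

Lemma fsq_cols m k (x : 'M[R]_(m, k)) : fsq x = \sum_j fsq (col j x).
Proof.
rewrite fsqE exchange_big; apply: eq_bigr => j _; rewrite fsqE.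
by apply: eq_bigr => i _; rewrite big_ord1 mxE.
Qed.

Lemma opbound_mx m n k c (Z : 'M[R]_(m, n)) (x : 'M[R]_(n, k)) :
  opbound c Z -> fsq (Z *m x) <= c ^+ 2 * fsq x.
Proof.
move=> Zc; rewrite !fsq_cols mulr_sumr; apply: ler_sum => j _.
by rewrite !colE -mulmxA; exact: Zc.
Qed.

Lemma opbound_fnorm m n k c (Z : 'M[R]_(m, n)) (x : 'M[R]_(n, k)) :
  0 <= c -> opbound c Z -> fnorm (Z *m x) <= c * fnorm x.
Proof.
move=> c0 Zc; rewrite -ler_sqr ?nnegrE ?mulr_ge0 ?fnorm_ge0// exprMn !sqr_fnorm.
exact: opbound_mx.
Qed.

(** Cauchy-Schwarz on |Z^T x|^2 = <x, Z Z^T x>, after which one factor |Z^T x|^2 cancels. *)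
Lemma opbound_tr m n c (Z : 'M[R]_(m, n)) : 0 <= c -> opbound c Z -> opbound c Z^T.
Proof.
move=> c0 Zc x; have [/eqP x0|x0] := boolP (fsq (Z^T *m x) == 0).
  by rewrite x0 mulr_ge0 ?sqr_ge0 ?fsq_ge0.
have h : fsq (Z^T *m x) ^+ 2 <= c ^+ 2 * fsq x * fsq (Z^T *m x).
  rewrite {1}/fsq fdot_mull trmxK (le_trans (cauchy_schwarz _ _))//.
  rewrite mulrAC mulrC ler_wpM2r ?fsq_ge0//; exact: Zc.
by move: h; rewrite expr2 ler_pM2r// lt_neqAle eq_sym x0 fsq_ge0.
Qed.

Lemma opboundD m n c d (Z W : 'M[R]_(m, n)) : 0 <= c -> 0 <= d ->
  opbound c Z -> opbound d W -> opbound (c + d) (Z + W).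
Proof.
move=> c0 d0 Zc Wd x; rewrite mulmxDl -!sqr_fnorm -exprMn ler_sqr ?nnegrE ?mulr_ge0 ?addr_ge0 ?fnorm_ge0//.
by rewrite (le_trans (fnormD _ _))// mulrDl lerD// opbound_fnorm.
Qed.

Lemma opboundN m n c (Z : 'M[R]_(m, n)) : opbound c Z -> opbound c (- Z).
Proof. by move=> Zc x; rewrite mulNmx fsqN. Qed.

Lemma opbound_orth_diag n c (U V : 'M[R]_n) (s : 'rV[R]_n) :
  U^T *m U = 1%:M -> V^T *m V = 1%:M -> (forall i, `|s 0 i| <= c) ->
  opbound c (U *m diag_mx s *m V^T).
Proof.
move=> UU VV sc x; rewrite -!mulmxA fsq_orth//.
have -> : fsq x = fsq (V^T *m x) by rewrite fsq_orth// trmxK (mulmx1C VV).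
rewrite !fsqE mulr_sumr; apply: ler_sum => i _; rewrite mulr_sumr; apply: ler_sum => j _.
rewrite mul_diag_mx [X in X ^+ 2]mxE exprMn ler_wpM2r ?sqr_ge0//.
by rewrite -(real_normK (num_real (s 0 i))) ler_sqr ?nnegrE// (le_trans _ (sc i)).
Qed.

Definition ind_mx {n} (S : pred 'I_n) : 'M[R]_n := diag_mx (\row_i (S i)%:R).

Definition proj {n} (U : 'M[R]_n) (S : pred 'I_n) : 'M[R]_n := U *m ind_mx S *m U^T.

Lemma fsq_ind_mx n (S : pred 'I_n) : fsq (ind_mx S) = #|S|%:R.
Proof.
rewrite fsqE -sum1_card natr_sum [RHS]big_mkcond; apply: eq_bigr => i _.
rewrite (bigD1 i)//= big1 ?addr0 => [|j ji]; last by rewrite !mxE eq_sym (negPf ji) expr0n.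
by rewrite !mxE eqxx unfold_in; case: (S i); rewrite ?expr1n ?expr0n.
Qed.

Lemma ind_mx_idem n (S : pred 'I_n) : ind_mx S *m ind_mx S = ind_mx S.
Proof.
rewrite mulmx_diag; congr diag_mx; apply/rowP => i; rewrite !mxE.
by case: (S i); rewrite ?mulr1 ?mulr0.
Qed.

Lemma ind_mx_tr n (S : pred 'I_n) : (ind_mx S)^T = ind_mx S.
Proof. exact: tr_diag_mx. Qed.

Lemma fsq_mul_ind_le m n (M : 'M[R]_(m, n)) (S : pred 'I_n) : fsq (M *m ind_mx S) <= fsq M.
Proof.
rewrite !fsqE; apply: ler_sum => i _; apply: ler_sum => j _.
by rewrite mul_mx_diag !mxE; case: (S j); rewrite /= ?mulr1 ?mulr0 ?expr0n ?sqr_ge0.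
Qed.

Section Orthogonal.
Context {n : nat} (U : 'M[R]_n).
Hypothesis UU : U^T *m U = 1%:M.
Implicit Types S : pred 'I_n.

Let UUT : U *m U^T = 1%:M. Proof. exact: mulmx1C. Qed.

Lemma proj_tr S : (proj U S)^T = proj U S.
Proof. by rewrite /proj !trmx_mul trmxK ind_mx_tr mulmxA. Qed.

Lemma proj_idem S : proj U S *m proj U S = proj U S.
Proof.
rewrite /proj -!mulmxA (mulmxA U^T U) UU mul1mx (mulmxA (ind_mx S) (ind_mx S)).
by rewrite ind_mx_idem.
Qed.

Lemma proj_mul_idem m S (A : 'M[R]_(n, m)) : proj U S *m (proj U S *m A) = proj U S *m A.
Proof. by rewrite mulmxA proj_idem. Qed.

Lemma proj_compl S : proj U S + proj U (predC S) = 1%:M.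
Proof.
rewrite /proj -mulmxDl -mulmxDr -[RHS]UUT; congr (_ *m _).
rewrite -[RHS]mulmx1; congr (_ *m _); apply/matrixP => i j; rewrite !mxE.
by case: (i == j); rewrite ?mulr1n ?mulr0n /=; case: (S i); rewrite ?addr0 ?add0r.
Qed.

Lemma fdot_proj m S (A B : 'M[R]_(n, m)) : fdot (proj U S *m A) B = fdot A (proj U S *m B).
Proof. by rewrite fdot_mull proj_tr. Qed.

Lemma fsq_proj_split m S (A : 'M[R]_(n, m)) :
  fsq A = fsq (proj U S *m A) + fsq (proj U (predC S) *m A).
Proof.
rewrite /fsq !fdot_proj !proj_mul_idem -fdotDr -mulmxDl proj_compl.
by rewrite mul1mx.
Qed.

Lemma fsq_proj_le m S (A : 'M[R]_(n, m)) : fsq (proj U S *m A) <= fsq A.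
Proof. by rewrite (fsq_proj_split S A) lerDl fsq_ge0. Qed.

(** The passage from operator to Frobenius norm: a projection of rank m costs only a factor sqrt m
    instead of sqrt n. *)
Lemma fsq_proj_opbound S c (Z : 'M[R]_n) : 0 <= c -> opbound c Z ->
  fsq (proj U S *m Z) <= c ^+ 2 * #|S|%:R.
Proof.
move=> c0 Zc; rewrite /proj -!mulmxA fsq_orth// mulmxA -fsq_tr !trmx_mul trmxK ind_mx_tr.
rewrite (le_trans (opbound_mx _ (opbound_tr c0 Zc)))//.
by rewrite fsq_orth// fsq_ind_mx.
Qed.

Lemma fsq_proj S : fsq (proj U S) = #|S|%:R.
Proof. by rewrite /proj fsq_orthr ?trmxK// fsq_orth// fsq_ind_mx. Qed.

End Orthogonal.

End OperatorBound.

(** * Frobenius error of singular value thresholding *)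

Section SingularValueThresholding.
Context {R : realType} {n : nat}.
Variables (A Q : 'M[R]_n) (t d K : R).
Hypothesis t_gt0 : 0 < t.
Hypothesis d_ge0 : 0 <= d.
Hypothesis AQ : opbound (t / 2) (A - Q).
Hypothesis tailK : sv_tail Q d <= K * t ^+ 2 * d.

Lemma card_cutoff : #|[pred j : 'I_n | j.+1%:R <= d]|%:R <= d.
Proof.
have dt : (Num.truncn d)%:R <= d by have /truncn_itv/andP[] := d_ge0.
rewrite (le_trans _ dt)// ler_nat.
rewrite (@leq_trans #|[pred j : 'I_n | (j < Num.truncn d)%N]|)//.
  apply/subset_leq_card/fintype.subsetP => j; rewrite !inE => jd.
  by have := le_truncn jd; rewrite natrK.
case: (leqP (Num.truncn d) n) => [dn|nd]; last first.
  by rewrite (leq_trans (max_card _))// card_ord ltnW.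
have winj : injective (widen_ord dn) by move=> i j /(congr1 val)/= ij; exact: val_inj.
rewrite -[leqRHS]card_ord -(fintype.card_image winj).
apply/subset_leq_card/fintype.subsetP => j; rewrite inE => jd.
by apply/fintype.imageP; exists (Ordinal jd) => //; exact: val_inj.
Qed.

(** [Q] splits into a part [Qd] of rank at most d and a tail [Qt] that is small in Frobenius norm,
    so it is enough to bound [M = Abr - Qd], a difference of two matrices of low rank. *)
Lemma usvt_trunc_error :
  fnorm (usvt_trunc t A - Q) <=
  t * Num.sqrt d * (3 / 2 * (Num.sqrt (2 + 4 * K) + 1) + 2 * Num.sqrt K).
Proof.
have := svdP A; rewrite /usvt_trunc; case: (svd A) => [[U s] V] [UU VV s0 _ EA].
have := svdP Q; case EQ : (svd Q) => [[U' s'] V'] [UU' VV' s'0 _ EQ'].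
pose S := [pred i : 'I_n | t < s 0 i].
pose D := [pred j : 'I_n | j.+1%:R <= d].
have {}EA : A = U *m diag_mx s *m V^T.
  rewrite [LHS]EA (sum_outer predT _ _ (fun i => s 0 i)); congr (_ *m diag_mx _ *m _).
  by apply/rowP => i; rewrite mxE.
have {}EQ' : Q = U' *m diag_mx s' *m V'^T.
  rewrite [LHS]EQ' (sum_outer predT _ _ (fun i => s' 0 i)); congr (_ *m diag_mx _ *m _).
  by apply/rowP => i; rewrite mxE.
rewrite (sum_outer S _ _ (fun i => s 0 i)); set Abr := U *m _ *m V^T.
pose L := proj U' D; pose L' := proj U' (predC D); pose LS := proj U S.
pose X := A - Q; pose Qd := L *m Q; pose Qt := L' *m Q.
have Qsplit : Q = Qd + Qt by rewrite /Qd /Qt -mulmxDl proj_compl// mul1mx.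
pose m : R := #|S|%:R; pose d' : R := #|D|%:R.
have d'd : d' <= d by exact: card_cutoff.
have ind_diag (P : pred 'I_n) (z : 'rV[R]_n) : ind_mx P *m diag_mx z = diag_mx (\row_i (if P i then z 0 i else 0)).
  rewrite mulmx_diag; congr diag_mx; apply/rowP => i; rewrite !mxE.
  by case: (P i); rewrite ?mul1r ?mul0r.
have tailE : fsq Qt = sv_tail Q d.
  rewrite /Qt /L' /proj [in LHS]EQ' -!mulmxA (mulmxA U'^T) UU' mul1mx fsq_orth// mulmxA ind_diag.
  rewrite fsq_orthr ?trmxK// fsqE /sv_tail [RHS]big_mkcond/=; apply: eq_bigr => j _.
  rewrite (bigD1 j)//= big1 ?addr0 => [|l lj]; last by rewrite !mxE eq_sym (negPf lj) expr0n.
  rewrite !mxE eqxx /= mulr1n /singular_value EQ /= ltNge.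
  by case: (_ <= d); rewrite //= expr0n.
have AbrE : Abr = LS *m A.
  by rewrite /LS /proj EA -!mulmxA (mulmxA U^T) UU mul1mx (mulmxA (ind_mx S)) ind_diag !mulmxA.
have t0 : 0 <= t by exact: ltW.
have t20 : 0 <= t / 2 by rewrite divr_ge0.
(* Every singular vector u of A above the threshold satisfies (1 - L) (s u) = Qt v + (1 - L) X v,
   hence |(1 - L) u| is small unless Qt v is large; this bounds the rank m of Abr without any
   perturbation inequality for singular values. *)
have m_le : t ^+ 2 * m <= 2 * t ^+ 2 * d' + 4 * sv_tail Q d.
  pose W := V *m ind_mx S.
  have fsqW : fsq W = m by rewrite fsq_orth// fsq_ind_mx.
  have AW : A *m W = U *m ind_mx S *m diag_mx s.
    rewrite EA /W -!mulmxA (mulmxA V^T) VV mul1mx; congr (_ *m _).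
    by rewrite !mulmx_diag; congr diag_mx; apply/rowP => i; rewrite !mxE mulrC.
  have e1 : L' *m (A *m W) = Qt *m W + L' *m (X *m W).
    by rewrite /Qt -mulmxA -mulmxDr -mulmxDl /X addrC subrK.
  have u1 : fsq (Qt *m W) <= sv_tail Q d.
    rewrite -tailE /W mulmxA (le_trans (fsq_mul_ind_le _ _))// fsq_orthr//; exact: mulmx1C.
  have u2 : fsq (L' *m (X *m W)) <= (t / 2) ^+ 2 * m.
    by rewrite (le_trans (fsq_proj_le UU' _ _))// -fsqW opbound_mx.
  have u3 : t ^+ 2 * fsq (L' *m (U *m ind_mx S)) <= fsq (L' *m (A *m W)).
    have -> : L' *m (A *m W) = L' *m U *m ind_mx S *m diag_mx s.
      by rewrite AW -!(mulmxA L').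
    rewrite (mulmxA L'); move: (L' *m U) => G.
    rewrite !fsqE mulr_sumr; apply: ler_sum => i _; rewrite mulr_sumr; apply: ler_sum => j _.
    rewrite !mul_mx_diag !mxE; have [Sj|_] := boolP (S j); last by rewrite mulr0 mul0r expr0n mulr0.
    by rewrite mulr1 mulrC exprMn ler_wpM2l ?sqr_ge0// ler_sqr ?nnegrE// ltW.
  have u4 : m - d' <= fsq (L' *m (U *m ind_mx S)).
    have := fsq_proj_split UU' D (U *m ind_mx S); rewrite -/L -/L'.
    rewrite {1}fsq_orth// fsq_ind_mx -/m.
    have : fsq (L *m (U *m ind_mx S)) <= d'.
      rewrite mulmxA (le_trans (fsq_mul_ind_le _ _))// fsq_orthr ?fsq_proj//; exact: mulmx1C.
    lra.
  have := fsqD_le (Qt *m W) (L' *m (X *m W)); rewrite -e1.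
  have := ler_wpM2l (sqr_ge0 t) u4.
  rewrite expr_div_n in u2; lra.
pose M := Abr - Qd; pose Z := X - (A - Abr).
have ME : M = Z + Qt by rewrite /M /Z /X [in A - Q]Qsplit; apply/matrixP => i j; rewrite !mxE; ring.
(* The noise [X] contributes t / 2, and the discarded part [A - Abr] has singular values at most
   t. *)
have Zop : opbound (3 / 2 * t) Z.
  have -> : 3 / 2 * t = t / 2 + t by field.
  apply: opboundD => //; apply: opboundN.
  have -> : A - Abr = proj U (predC S) *m A.
    by rewrite AbrE -[X in X - _](mul1mx A) -mulmxBl -(proj_compl UU S) addrAC subrr add0r.
  rewrite /proj EA -!mulmxA (mulmxA U^T) UU mul1mx (mulmxA (ind_mx _)) ind_diag mulmxA.
  apply: opbound_orth_diag => // i; rewrite mxE /= -leNgt.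
  by case: ifP => [|_]; rewrite ?normr0// ger0_norm.
have t32 : 0 <= 3 / 2 * t by rewrite mulr_ge0// divr_ge0.
pose Pi := proj V' D.
have QdPi : Qd *m Pi = Qd.
  have -> : Qd = U' *m (ind_mx D *m diag_mx s') *m V'^T.
    by rewrite /Qd /L /proj EQ' -!mulmxA (mulmxA U'^T) UU' mul1mx.
  rewrite /Pi /proj -!mulmxA (mulmxA V'^T) VV' mul1mx; congr (_ *m _).
  rewrite !mulmxA; congr (_ *m _); rewrite ind_diag mulmx_diag; congr diag_mx.
  by apply/rowP => i; rewrite !mxE; case: ifP => Di; rewrite ?mulr1 ?mulr0 ?mul0r.
(* [1 - LS] kills [Abr], so only [Qd] remains, and [Pi] projects onto a space containing its
   rows. *)
have LSM : (1%:M - LS) *m M = ((1%:M - LS) *m M) *m Pi.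
  have -> : (1%:M - LS) *m M = - ((1%:M - LS) *m Qd).
    by rewrite /M mulmxBr AbrE mulmxBl mul1mx mulmxA proj_idem// subrr sub0r.
  by rewrite mulNmx -mulmxA QdPi.
have LSC : 1%:M - LS = proj U (predC S) by rewrite -(proj_compl UU S) addrAC subrr add0r.
have fn1 : fnorm (LS *m Z) <= 3 / 2 * t * Num.sqrt m.
  rewrite -ler_sqr ?nnegrE ?mulr_ge0 ?fnorm_ge0 ?sqrtr_ge0// sqr_fnorm exprMn sqr_sqrtr ?ler0n//.
  exact: fsq_proj_opbound.
have fn2 : fnorm (Z *m Pi) <= 3 / 2 * t * Num.sqrt d'.
  rewrite -ler_sqr ?nnegrE ?mulr_ge0 ?fnorm_ge0 ?sqrtr_ge0// sqr_fnorm exprMn sqr_sqrtr ?ler0n//.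
  rewrite -fsq_tr trmx_mul proj_tr; apply: fsq_proj_opbound => //; exact: opbound_tr.
have fn3 : fnorm ((1%:M - LS) *m M) <= fnorm M.
  by rewrite LSC ler_sqrt ?fsq_ge0// fsq_proj_le.
(* M = Z + Qt, and M is supported on the range of LS up to a part supported on the cutoff
   space of Q; both spaces have small dimension, which turns ||Z|| into a Frobenius bound. *)
have fMQ : fsq M <= fnorm M * (3 / 2 * t * (Num.sqrt m + Num.sqrt d') + Num.sqrt (sv_tail Q d)).
  have -> : fsq M = fdot M (LS *m Z) + fdot ((1%:M - LS) *m M) (Z *m Pi) + fdot M Qt.
    have -> : fdot ((1%:M - LS) *m M) (Z *m Pi) = fdot ((1%:M - LS) *m M) Z.
      by rewrite [in RHS]LSM [RHS]fdot_mulr proj_tr.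
    by rewrite LSC fdot_proj// -fdotDr -mulmxDl proj_compl// mul1mx -fdotDr -ME.
  have := le_trans (ler_norm _) (fdot_le M (LS *m Z)).
  have := le_trans (ler_norm _) (fdot_le ((1%:M - LS) *m M) (Z *m Pi)).
  have := le_trans (ler_norm _) (fdot_le M Qt).
  have : fnorm Qt = Num.sqrt (sv_tail Q d) by rewrite /fnorm tailE.
  move=> -> h1 h2 h3.
  have h4 : fnorm ((1%:M - LS) *m M) * fnorm (Z *m Pi) <= fnorm M * (3 / 2 * t * Num.sqrt d').
    by apply: ler_pM => //; exact: fnorm_ge0.
  have h5 : fnorm M * fnorm (LS *m Z) <= fnorm M * (3 / 2 * t * Num.sqrt m).
    by apply: ler_wpM2l => //; exact: fnorm_ge0.
  rewrite mulrDr; lra.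
have Mle : fnorm M <= 3 / 2 * t * (Num.sqrt m + Num.sqrt d') + Num.sqrt (sv_tail Q d).
  have [/eqP M0|M0] := boolP (fnorm M == 0).
    by rewrite M0 addr_ge0 ?mulr_ge0 ?addr_ge0 ?sqrtr_ge0// divr_ge0.
  rewrite -(ler_pM2l (_ : 0 < fnorm M)); first by rewrite -expr2 sqr_fnorm.
  by rewrite lt_neqAle eq_sym M0 fnorm_ge0.
have tle : Num.sqrt (sv_tail Q d) <= t * Num.sqrt d * Num.sqrt K.
  (* The sign of [K] is left open: a negative [K] forces the tail, a sum of squares, to be 0. *)
  have [K0|K0] := leP 0 K.
    rewrite -ler_sqr ?nnegrE ?mulr_ge0 ?sqrtr_ge0// sqr_sqrtr -?tailE ?fsq_ge0// tailE.
    rewrite !exprMn !sqr_sqrtr// (le_trans tailK)// mulrC mulrCA mulrA mulrC.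
    by rewrite le_eqVlt; apply/orP; left; apply/eqP; ring.
  suff -> : sv_tail Q d = 0 by rewrite sqrtr0 ?mulr_ge0 ?sqrtr_ge0.
  apply/eqP; rewrite eq_le -{2}tailE fsq_ge0 andbT (le_trans tailK)//.
  by rewrite mulr_le0_ge0// mulr_le0_ge0 ?sqr_ge0// ltW.
have sm : Num.sqrt m <= Num.sqrt (2 + 4 * K) * Num.sqrt d.
  have h : m <= (2 + 4 * K) * d.
    have t2 : 0 < t ^+ 2 by rewrite exprn_gt0.
    rewrite -(ler_pM2l t2).
    have := ler_wpM2l (ltW t2) d'd.
    move: m_le tailK; move: (t ^+ 2) (sv_tail Q d) => T tl.
    lra.
  have [d0|dN] := eqVneq d 0.
    rewrite d0 mulr0 in h; rewrite (_ : m = 0) ?sqrtr0 ?mulr_ge0 ?sqrtr_ge0//.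
    by apply/eqP; rewrite eq_le h /m ler0n.
  have K0 : 0 <= 2 + 4 * K.
    have dp : 0 < d by rewrite lt_neqAle eq_sym dN.
    by rewrite -(pmulr_lge0 _ dp) (le_trans _ h)// ler0n.
  by rewrite -sqrtrM// ler_wsqrtr.
have sd : Num.sqrt d' <= Num.sqrt d by rewrite ler_wsqrtr.
have -> : Abr - Q = M - Qt by rewrite /M [in LHS]Qsplit opprD addrA.
rewrite (le_trans (fnormB _ _))// {2}/fnorm tailE.
have : 3 / 2 * t * (Num.sqrt m + Num.sqrt d') <= 3 / 2 * t * (Num.sqrt (2 + 4 * K) * Num.sqrt d + Num.sqrt d).
  by rewrite ler_wpM2l// lerD.
lra.
Qed.

End SingularValueThresholding.

(** * Closed walks and the operator norm of a sparse centered matrix *)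

Section Kernel.
Context {I : finType}.

(** The partition of [I] into level sets of [w], encoded independently of [T] so that walks on
    different vertex sets can be compared. *)
Definition fker {T : finType} (w : {ffun I -> T}) : {ffun I * I -> bool} :=
  [ffun ij => w ij.1 == w ij.2].

Lemma fkerP (T T' : finType) (w : {ffun I -> T}) (w' : {ffun I -> T'}) :
  reflect (forall i j, (w i == w j) = (w' i == w' j)) (fker w == fker w').
Proof.
apply: (iffP eqP) => [/ffunP h i j|h]; first by have := h (i, j); rewrite !ffunE.
by apply/ffunP => -[i j]; rewrite !ffunE h.
Qed.

Context {T0 T : finType} (w0 : {ffun I -> T0}).

(** [D] is the set of classes of the partition of [w0], [cls] the class of an index and [rep] a
    chosen index in each class. *)
Let D := {x : T0 | x \in [set w0 i | i in I]}.
Let cls (i : I) : D := exist _ (w0 i) (imset_f w0 (erefl true : i \in I)).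
Let rep_ex (x : D) : exists i, cls i == x.
Proof. by case: x => x xw; have /imsetP[i _ ei] := xw; exists i; apply/eqP/val_inj. Qed.
Let rep (x : D) : I := xchoose (rep_ex x).
Let repK x : cls (rep x) = x. Proof. exact/eqP/(xchooseP (rep_ex x)). Qed.
Let clsE i j : (cls i == cls j) = (w0 i == w0 j). Proof. by rewrite -val_eqE. Qed.
Let cardD : #|{: D}| = #|[set w0 i | i in I]|. Proof. by rewrite card_sig; apply: eq_card => x; rewrite inE. Qed.

(** A function with the partition of [w0] is determined by its values at the class
    representatives. *)
Lemma card_fker_le :
  (#|[set w : {ffun I -> T} | fker w == fker w0]| <= #|T| ^ #|[set w0 i | i in I]|)%N.
Proof.
rewrite -cardD -card_ffun -(@card_in_imset _ _ (fun w : {ffun I -> T} => [ffun x : D => w (rep x)])).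
  exact: max_card.
move=> w w'; rewrite !inE => /fkerP ww0 /fkerP w'w0 /ffunP h.
apply/ffunP => i; have := h (cls i); rewrite !ffunE.
have /eqP e : w0 i == w0 (rep (cls i)) by rewrite -clsE repK.
have /eqP -> : w (rep (cls i)) == w i by rewrite ww0 e.
by have /eqP -> : w' (rep (cls i)) == w' i by rewrite w'w0 e.
Qed.

(** Every injection of the classes into [T] gives a function with this partition, hence the falling
    factorial. *)
Lemma card_fker_ge_ffact :
  (#|T| ^_ #|[set w0 i | i in I]| <= #|[set w : {ffun I -> T} | fker w == fker w0]|)%N.
Proof.
rewrite -cardD -card_inj_ffuns.
rewrite -(@card_in_imset _ _ (fun g : {ffun D -> T} => [ffun i : I => g (cls i)])).
  apply/subset_leq_card/fintype.subsetP => w /imsetP[g]; rewrite inE => /injectiveP ginj ->.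
  by rewrite inE; apply/fkerP => i j; rewrite !ffunE -clsE; apply: inj_eq.
move=> g g' _ _ /ffunP h; apply/ffunP => x.
by have := h (rep x); rewrite !ffunE repK.
Qed.

Lemma card_image_fker_le (w : {ffun I -> T}) :
  fker w == fker w0 -> (#|[set w i | i in I]| <= #|[set w0 i | i in I]|)%N.
Proof.
move=> /fkerP ww0; rewrite -cardD.
have -> : [set w i | i in I] = [set w (rep x) | x in {: D}].
  apply/setP => y; apply/imsetP/imsetP => -[x _ ->]; last by exists (rep x).
  by exists (cls x) => //; apply/eqP; rewrite ww0 -clsE repK.
exact: leq_imset_card.
Qed.

End Kernel.

(** * Closed walks and their shapes *)

Section Walks.
Context {q : nat}.

Definition src (t : 'I_q) : 'I_q.+1 := widen_ord (leqnSn q) t.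
Definition tgt (t : 'I_q) : 'I_q.+1 := lift ord0 t.

Section OneGraph.
Context {T : finType}.
Implicit Types w : {ffun 'I_q.+1 -> T}.

(** Two steps use the same undirected edge. It is phrased through equalities of visited vertices
    only, so that [good_walk] depends on nothing but the partition [fker w]. *)
Definition same_edge w (t t' : 'I_q) : bool :=
  (w (src t) == w (src t')) && (w (tgt t) == w (tgt t')) ||
  (w (src t) == w (tgt t')) && (w (tgt t) == w (src t')).

Definition good_walk w : bool :=
  (w ord0 == w ord_max) && [forall t, exists t', (t' != t) && same_edge w t t'].

Context {E : finType} (ed : T -> T -> E).
Hypothesis edC : forall x y, ed x y = ed y x.
Hypothesis ed_inj : forall x y z t, ed x y = ed z t -> (x = z /\ y = t) \/ (x = t /\ y = z).

Definition edge_at w (t : 'I_q) : E := ed (w (src t)) (w (tgt t)).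

Lemma same_edgeE w t t' : same_edge w t t' = (edge_at w t == edge_at w t').
Proof.
apply/idP/eqP; first by rewrite /edge_at => /orP[] /andP[/eqP -> /eqP ->].
by case/ed_inj => -[e1 e2]; rewrite /same_edge e1 e2 !eqxx ?orbT.
Qed.

Lemma good_walk_edges w : good_walk w -> (2 * #|[set edge_at w t | t in 'I_q]| <= q)%N.
Proof.
case/andP => _ /forallP h; rewrite -[leqRHS]card_ord -[leqRHS]sum1_card.
rewrite (partition_big (edge_at w) (mem ([set edge_at w t | t in 'I_q])))/=; last by move=> t _; apply: imset_f.
rewrite mulnC -sum_nat_const; apply: leq_sum => e /imsetP[t _ ->].
have /existsP[t' /andP[t't]] := h t; rewrite same_edgeE => /eqP e'.
by rewrite (bigD1 t)//= (bigD1 t') ?e' ?eqxx ?t't.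
Qed.

(** A connected graph has at most one more vertex than edges: along the walk, a step that reaches a
    new vertex uses a new edge, since both ends of an old edge have been visited. *)
Lemma walk_vertices_edges w : (#|[set w t | t in 'I_q.+1]| <= #|[set edge_at w t | t in 'I_q]|.+1)%N.
Proof.
pose Vk k := [set w t | t : 'I_q.+1 & (t <= k)%N].
pose Ek k := [set edge_at w t | t : 'I_q & (t < k)%N].
have H k : (k <= q)%N -> (#|Vk k| <= #|Ek k|.+1)%N.
  elim: k => [_|k IH kq].
    rewrite (@leq_trans 1)// -(cards1 (w ord0)); apply/subset_leq_card/fintype.subsetP => x /imsetP[t].
    by rewrite inE leqn0 => /eqP t0 ->; rewrite inE; apply/eqP; congr (w _); apply: val_inj.
  pose t : 'I_q := Ordinal kq.
  have Vs : Vk k.+1 \subset w (tgt t) |: Vk k.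
    apply/fintype.subsetP => x /imsetP[u]; rewrite inE leq_eqVlt => /orP[/eqP uk|uk] ->.
      by rewrite !inE; apply/orP; left; apply/eqP; congr (w _); apply: val_inj; rewrite /= uk.
    by rewrite !inE; apply/orP; right; apply: imset_f; rewrite inE.
  rewrite (leq_trans (subset_leq_card Vs))// cardsU1.
  have EkS : edge_at w t |: Ek k \subset Ek k.+1.
    apply/fintype.subsetP => x; rewrite !inE => /orP[/eqP ->|/imsetP[u]].
      by apply: imset_f; rewrite inE.
    by rewrite inE => uk ->; apply: imset_f; rewrite inE ltnS ltnW.
  rewrite (leq_trans _ (subset_leq_card EkS : (_.+1 <= _.+1)%N))// cardsU1.
  have [wV|wV] := boolP (w (tgt t) \in Vk k); first by rewrite add0n (leq_trans (IH (ltnW kq)))// ltnS leq_addl.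
  suff -> : edge_at w t \notin Ek k by rewrite /= !add1n ltnS IH// ltnW.
  apply/negP => /imsetP[u]; rewrite inE => uk.
  case/ed_inj => -[e1 e2]; case/negP: wV; rewrite e2; apply: imset_f; rewrite inE //=.
  by rewrite ltnW.
have -> : [set w t | t in 'I_q.+1] = Vk q.
  by apply/setP => x; apply/imsetP/imsetP => -[t tq ->]; exists t; rewrite // inE -ltnS.
have -> : [set edge_at w t | t in 'I_q] = Ek q by apply/setP => x; apply/imsetP/imsetP => -[t tq ->]; exists t; rewrite ?inE.
exact: H.
Qed.

End OneGraph.

Lemma good_walk_fker (T T' : finType) (w : {ffun 'I_q.+1 -> T}) (w' : {ffun 'I_q.+1 -> T'}) :
  fker w == fker w' -> good_walk w = good_walk w'.
Proof.
move=> /fkerP ww'; rewrite /good_walk ww'; congr andb.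
by apply: eq_forallb => t; apply: eq_existsb => t'; rewrite /same_edge !ww'.
Qed.

End Walks.

Lemma leq_exp_ffact N p m : (m <= p.+1)%N -> ((N - p) ^ m <= N ^_ m)%N.
Proof.
move=> mp; rewrite ffact_prod -[X in (_ ^ X)%N]card_ord -prod_nat_const.
apply: leq_prod => i _; rewrite leq_sub2l// -ltnS (leq_trans (ltn_ord i))//.
Qed.

Section WalkComparison.
Context {R : realType} {p : nat} {T T' E : finType} (ed : T -> T -> E) (r : R).
Let q := p.*2.
Hypothesis edC : forall x y, ed x y = ed y x.
Hypothesis ed_inj : forall x y z t, ed x y = ed z t -> (x = z /\ y = t) \/ (x = t /\ y = z).
Hypothesis r01 : 0 < r <= 1.
Hypothesis cardTT' : #|T|%:R * r <= (#|T'| - p)%:R.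

(* Walks are grouped by the partition of time by visited vertex: a class with m
   vertices has at most |T|^m members over T and at least (|T'| - p)^m over T'. *)
Lemma good_walk_sum_le :
  \sum_(w : {ffun 'I_q.+1 -> T} | good_walk w) r ^+ #|[set edge_at ed w t | t in 'I_q]| <=
  r^-1 * #|[set w : {ffun 'I_q.+1 -> T'} | good_walk w]|%:R.
Proof.
have /andP[r0 r1] := r01.
rewrite -sum1_card natr_sum mulr_sumr (partition_big (fun w => fker w) predT)//=.
rewrite [leRHS](partition_big (fun w => fker w) predT)//=; apply: ler_sum => k _.
rewrite -mulr_sumr.
have [w0 /andP[gw0 /eqP kw0]|none] := pickP (fun w : {ffun 'I_q.+1 -> T} => good_walk w && (fker w == k)); last first.
  by rewrite big_pred0// mulr_ge0 ?invr_ge0 ?sumr_ge0// ltW.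
pose m := #|[set w0 t | t in 'I_q.+1]|.
(* Each edge is used at least twice among 2p steps, so there are at most p edges and p + 1 vertices;
   this is the range in which the falling factorial dominates [(#|T'| - p) ^ m]. *)
have mp : (m <= p.+1)%N.
  rewrite (leq_trans (walk_vertices_edges ed_inj w0))// ltnS.
  by have := good_walk_edges edC ed_inj gw0; move: #|_| => c; rewrite /q; lia.
apply: (@le_trans _ _ (\sum_(w : {ffun 'I_q.+1 -> T} | fker w == k) r^-1 * r ^+ m)).
  rewrite big_mkcond [leRHS]big_mkcond; apply: ler_sum => w _.
  case: ifP => [/andP[gw kw]|_]; last by case: ifP => _ //; rewrite mulr_ge0 ?invr_ge0 ?exprn_ge0 ?ltW.
  rewrite kw ler_pdivlMl// -exprS.
  have mw : (m <= #|[set w t | t in 'I_q.+1]|)%N.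
    by apply: card_image_fker_le; rewrite kw0 eq_sym.
  apply: ler_wiXn2l => //; first exact: ltW.
  by rewrite (leq_trans mw)// (walk_vertices_edges ed_inj).
rewrite sumr_const -[leLHS]mulr_natl.
rewrite [X in _ <= _ * X](_ : _ = #|[set w : {ffun 'I_q.+1 -> T'} | fker w == fker w0]|%:R); last first.
  rewrite -sum1_card natr_sum; apply: eq_bigl => w.
  rewrite !inE kw0; case: eqP => [kw|]; rewrite ?andbF// andbT.
  by rewrite -gw0; apply: good_walk_fker; rewrite kw kw0.
rewrite mulrCA ler_pM2l ?invr_gt0//.
apply: (@le_trans _ _ ((#|T| ^ m)%:R * r ^+ m)).
  apply: ler_wpM2r; first by rewrite exprn_ge0// ltW.
  rewrite ler_nat -kw0.
  rewrite -[leqLHS](_ : #|[set w : {ffun 'I_q.+1 -> T} | fker w == fker w0]| = _); first exact: card_fker_le.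
  by apply: eq_card => w; rewrite !inE.
rewrite natrX -exprMn; apply: (@le_trans _ _ ((#|T'| - p)%:R ^+ m)).
  by apply: lerXn2r; rewrite ?nnegrE// mulr_ge0// ltW.
rewrite -natrX ler_nat (leq_trans _ (card_fker_ge_ffact w0))// leq_exp_ffact//.
Qed.

End WalkComparison.

(** * Trace moments as sums over closed walks *)

Section TraceWalks.
Context {R : realType} {n : nat}.
Implicit Types X : 'M[R]_n.

Definition cons_ffun {q} (x : 'I_n) (g : {ffun 'I_q -> 'I_n}) : {ffun 'I_q.+1 -> 'I_n} :=
  [ffun i => oapp g x (unlift ord0 i)].

Lemma cons_ffun0 q x (g : {ffun 'I_q -> 'I_n}) : cons_ffun x g ord0 = x.
Proof. by rewrite ffunE unlift_none. Qed.

Lemma cons_ffunS q x (g : {ffun 'I_q -> 'I_n}) i : cons_ffun x g (lift ord0 i) = g i.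
Proof. by rewrite ffunE liftK. Qed.

Lemma big_cons_ffun q (P : pred {ffun 'I_q.+1 -> 'I_n}) (F : {ffun 'I_q.+1 -> 'I_n} -> R) :
  \sum_(w | P w) F w = \sum_x \sum_(g | P (cons_ffun x g)) F (cons_ffun x g).
Proof.
rewrite pair_big_dep/= (reindex (fun xg : 'I_n * {ffun 'I_q -> 'I_n} => cons_ffun xg.1 xg.2))//=.
exists (fun w => (w ord0, [ffun i => w (lift ord0 i)])) => [[x g]|w] _ /=.
  by rewrite cons_ffun0; congr pair; apply/ffunP => i; rewrite ffunE cons_ffunS.
apply/ffunP => i; case: (unliftP ord0 i) => [j|] ->; last by rewrite cons_ffun0.
by rewrite cons_ffunS ffunE.
Qed.

Lemma mx_exp_walks X q i j :
  (X ^+ q) i j = \sum_(w : {ffun 'I_q.+1 -> 'I_n} | (w ord0 == i) && (w ord_max == j))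
     \prod_(t < q) X (w (src t)) (w (tgt t)).
Proof.
elim: q i => [|q IH] i.
  rewrite expr0 mxE big_cons_ffun (bigD1 i)//= [X in _ + X]big1 ?addr0 => [|x xi]; last first.
    by rewrite big_pred0// => g; rewrite cons_ffun0 (negPf xi).
  have e (g : {ffun 'I_0 -> 'I_n}) : cons_ffun i g ord_max = i.
    by rewrite -[RHS](cons_ffun0 i g); congr (cons_ffun _ _ _); apply: val_inj.
  case: eqP => ij.
    rewrite (bigD1 [ffun x : 'I_0 => i])/=; last by rewrite cons_ffun0 e ij !eqxx.
    rewrite big_ord0 big1 ?addr0// => g /andP[_ /eqP[]]; apply/ffunP; case=> //.
  by rewrite big_pred0// => g; rewrite e; move/eqP/negPf: ij => ->; rewrite andbF.
rewrite exprS mxE [RHS]big_cons_ffun [RHS](bigD1 i)//= [X in _ = _ + X]big1 ?addr0 => [|x xi]; last first.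
  by rewrite big_pred0// => g; rewrite cons_ffun0 (negPf xi).
rewrite (partition_big (fun g : {ffun 'I_q.+1 -> 'I_n} => g ord0) predT)//=.
apply: eq_bigr => k _; rewrite IH mulr_sumr; apply: eq_big => g.
  rewrite cons_ffun0 eqxx /= andbC; congr ((_ == _) && _).
  by rewrite -(cons_ffunS i g); congr (cons_ffun _ _ _); apply: val_inj.
case/andP => /eqP gk _; rewrite [RHS]big_ord_recl; congr (X _ _ * _).
- by rewrite -[LHS](cons_ffun0 i g); congr (cons_ffun _ _ _); apply: val_inj.
- by rewrite -gk -(cons_ffunS i g).
apply: eq_bigr => t _; congr (X _ _); rewrite -(cons_ffunS i g)//.
by congr (cons_ffun _ _ _); apply: val_inj.
Qed.

Lemma mxtrace_exp_walks X q :
  \tr (X ^+ q) = \sum_(w : {ffun 'I_q.+1 -> 'I_n} | w ord0 == w ord_max)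
     \prod_(t < q) X (w (src t)) (w (tgt t)).
Proof.
rewrite /mxtrace (partition_big (fun w : {ffun 'I_q.+1 -> 'I_n} => w ord0) predT)//=.
apply: eq_bigr => i _; rewrite mx_exp_walks; apply: eq_bigl => w.
by rewrite andbC; case: (w ord0 =P i) => [->|]; rewrite ?andbF// !andbT eq_sym.
Qed.

End TraceWalks.

Lemma card_edge_fiber (T E : finType) (ed : T -> T -> E) (e : E) :
  (forall i j k l, ed i j = ed k l -> (i = k /\ j = l) \/ (i = l /\ j = k)) ->
  (#|[pred ij : T * T | ed ij.1 ij.2 == e]| <= 2)%N.
Proof.
move=> ed_inj; case: (pickP [pred ij : T * T | ed ij.1 ij.2 == e]) => [ij /= /eqP <-|h]; last by rewrite eq_card0.
rewrite (@leq_trans #|[set ij; (ij.2, ij.1)]|)//; last by rewrite cards2; case: (_ == _).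
apply/subset_leq_card/fintype.subsetP => -[k l]; rewrite !inE /=.
by case/eqP/ed_inj => /= -[-> ->]; rewrite -?surjective_pairing eqxx ?orbT.
Qed.

Section TraceMoments.
Context {R : realType} {E V : finType} {n : nat}.
Variables (p : E -> V -> R) (x : E -> V -> R) (ed : 'I_n -> 'I_n -> E).
Hypothesis edC : forall i j, ed i j = ed j i.
Hypothesis ed_inj : forall i j k l, ed i j = ed k l -> (i = k /\ j = l) \/ (i = l /\ j = k).

Definition edge_matrix (o : {ffun E -> V}) : 'M[R]_n :=
  \matrix_(i, j) x (ed i j) (o (ed i j)).

Definition moment (e : E) (m : nat) : R := \sum_v p e v * x e v ^+ m.

(** Independence: the factors are grouped by coordinate, and each coordinate contributes the moment
    of its multiplicity. *)
Lemma Ex_prod_coords (I : finType) (f : I -> E) :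
  Ex p (fun o => \prod_t x (f t) (o (f t))) = \prod_e moment e #|[pred t | f t == e]|.
Proof.
rewrite -(Ex_prod p (fun e v => x e v ^+ #|[pred t | f t == e]|)); apply: eq_Ex => o.
rewrite (partition_big f predT)//=; apply: eq_bigr => e _.
rewrite -prodr_const; apply: eq_big => t; first by rewrite inE.
by move=> /eqP ->.
Qed.

Lemma Ex_trace_exp q :
  Ex p (fun o => \tr (edge_matrix o ^+ q)) =
  \sum_(w : {ffun 'I_q.+1 -> 'I_n} | w ord0 == w ord_max)
     \prod_e moment e #|[pred t | edge_at ed w t == e]|.
Proof.
rewrite (eq_Ex p (g := fun o => \sum_(w : {ffun 'I_q.+1 -> 'I_n} | w ord0 == w ord_max)
     \prod_(t < q) x (edge_at ed w t) (o (edge_at ed w t)))) => [|o].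
  by rewrite Ex_sum; apply: eq_bigr => w _; rewrite Ex_prod_coords.
rewrite mxtrace_exp_walks; apply: eq_bigr => w _; apply: eq_bigr => t _.
by rewrite mxE.
Qed.

Lemma not_good_walk_edge1 q (w : {ffun 'I_q.+1 -> 'I_n}) : w ord0 == w ord_max -> ~~ good_walk w ->
  exists e, #|[pred t | edge_at ed w t == e]| = 1%N.
Proof.
rewrite /good_walk => -> /= /forallPn[t /existsPn h]; exists (edge_at ed w t).
rewrite -(card1 t); apply: eq_card => t'; rewrite !inE.
have := h t'; rewrite (same_edgeE edC ed_inj) negb_and negbK.
by case: (eqVneq t' t) => [->|_]; rewrite ?eqxx//= eq_sym => /negPf.
Qed.

Lemma good_walk_edge_neq1 q (w : {ffun 'I_q.+1 -> 'I_n}) e : good_walk w ->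
  #|[pred t | edge_at ed w t == e]| != 1%N.
Proof.
case/andP => _ /forallP h; apply/negP => /eqP/mem_card1[t ht].
have /existsP[t' /andP[t't]] := h t.
have := ht t; rewrite !inE eqxx => /eqP et.
rewrite (same_edgeE edC ed_inj) et eq_sym => e'.
by have := ht t'; rewrite !inE e' (negPf t't).
Qed.

Lemma edge_at_count q (w : {ffun 'I_q.+1 -> 'I_n}) e :
  (#|[pred t | edge_at ed w t == e]| == 0%N) = (e \notin [set edge_at ed w t | t in 'I_q]).
Proof.
apply/eqP/idP => [/card0_eq h|h].
  by apply/imsetP => -[t _ et]; have := h t; rewrite !inE et eqxx.
apply: eq_card0 => t; rewrite !inE; apply: contraNF h => /eqP <-.
exact: imset_f.
Qed.

Hypothesis p_ge0 : forall e v, 0 <= p e v.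
Hypothesis p_sum1 : forall e, \sum_v p e v = 1.

(** An edge visited exactly once contributes a zero mean and kills its walk; on the other walks each
    visited edge contributes at most r, because entries bounded by 1 have higher moments below the
    second one. *)
Lemma Ex_trace_exp_le q r : (forall e, moment e 1 = 0) -> (forall e v, `|x e v| <= 1) ->
  (forall e, moment e 2 <= r) ->
  Ex p (fun o => \tr (edge_matrix o ^+ q)) <=
  \sum_(w : {ffun 'I_q.+1 -> 'I_n} | good_walk w) r ^+ #|[set edge_at ed w t | t in 'I_q]|.
Proof.
move=> m1 x1 m2.
have mr e m : (2 <= m)%N -> `|moment e m| <= r.
  move=> hm; rewrite (le_trans _ (m2 e))// (le_trans (ler_norm_sum _ _ _))//.
  apply: ler_sum => v _; rewrite normrM (ger0_norm (p_ge0 _ _)) ler_wpM2l//.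
  rewrite normrX -(real_normK (num_real (x e v))); exact: ler_wiXn2l.
rewrite Ex_trace_exp big_mkcond [leRHS]big_mkcond; apply: ler_sum => w _.
case: (boolP (good_walk w)) => gw.
  have /andP[-> _] := gw.
  rewrite (le_trans (ler_norm _))// normr_prod.
  rewrite -prodr_const [leRHS]big_mkcond/=; apply: ler_prod => e _; rewrite normr_ge0 /=.
  case: ifPn => [|]; rewrite -?edge_at_count.
    move=> h; apply: mr; move: h (good_walk_edge_neq1 e gw); rewrite -[_ \in _]negbK -edge_at_count.
    by case: #|_| => [|[|k]].
  by move=> /eqP ->; rewrite /moment; under eq_bigr do rewrite expr0 mulr1; rewrite p_sum1 normr1.
case: ifP => // cw; have [e e1] := not_good_walk_edge1 cw gw.
by rewrite (bigD1 e)//= e1 m1 mul0r.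
Qed.

(** The converse direction, meant for the dense matrix: each good walk contributes at least 1 and
    the others nothing, so the trace moment bounds the number of good walks. *)
Lemma good_walk_count_le q : (forall e, moment e 1 = 0) -> (forall e m, m != 1%N -> 1 <= moment e m) ->
  #|[set w : {ffun 'I_q.+1 -> 'I_n} | good_walk w]|%:R <= Ex p (fun o => \tr (edge_matrix o ^+ q)).
Proof.
move=> m1 mge; rewrite Ex_trace_exp -sum1_card natr_sum big_mkcond [leRHS]big_mkcond.
apply: ler_sum => w _; rewrite inE; case: (boolP (good_walk w)) => gw.
  have /andP[-> _] := gw; apply: (big_ind (fun y => 1 <= y)) => [//|a b a1 b1|e _].
    by rewrite mulr_ege1.
  by rewrite mge// good_walk_edge_neq1.
case: ifP => // cw; have [e e1] := not_good_walk_edge1 cw gw.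
by rewrite (bigD1 e)//= e1 m1 mul0r.
Qed.

End TraceMoments.

Lemma exp_orth_diag (R : realType) n (V : 'M[R]_n) (d : 'rV[R]_n) M : V^T *m V = 1%:M ->
  (V *m diag_mx d *m V^T) ^+ M = V *m diag_mx (\row_i d 0 i ^+ M) *m V^T.
Proof.
move=> VV; elim: M => [|M IH].
  have -> : \row_i d 0 i ^+ 0 = const_mx 1 :> 'rV[R]_n by apply/matrixP => i j; rewrite !mxE expr0.
  by rewrite diag_const_mx mulmx1 expr0 (mulmx1C VV).
rewrite exprS IH -[LHS]/(_ *m _) -!mulmxA (mulmxA V^T V) VV mul1mx (mulmxA (diag_mx _)) mulmx_diag.
by congr (_ *m (diag_mx _ *m _)); apply/rowP => i; rewrite !mxE exprS.
Qed.

Section SymmetricTrace.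
Context {R : realType} {n : nat}.
Variables (X U V : 'M[R]_n) (s : 'rV[R]_n).
Hypothesis Xsym : X^T = X.
Hypothesis Xsvd : is_svd X (U, s, V).

Lemma is_svd_mulmx : X = U *m diag_mx s *m V^T.
Proof.
have [_ _ _ _ EX] := Xsvd; rewrite [LHS]EX (sum_outer predT _ _ (fun i => s 0 i)).
by congr (_ *m diag_mx _ *m _); apply/rowP => i; rewrite mxE.
Qed.

(** By symmetry X^2 = X^T X, which the right singular vectors diagonalize; even powers therefore do
    not see the signs of the eigenvalues. *)
Lemma mxtrace_exp_svd M : \tr (X ^+ M.*2) = \sum_i s 0 i ^+ M.*2.
Proof.
have [UU VV _ _ _] := Xsvd.
have X2 : X ^+ 2 = V *m diag_mx (\row_i s 0 i ^+ 2) *m V^T.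
  rewrite expr2 -{1}Xsym is_svd_mulmx !trmx_mul trmxK tr_diag_mx.
  rewrite -[LHS]/(_ *m _) -!mulmxA (mulmxA U^T) UU mul1mx.
  rewrite (mulmxA (diag_mx s)) mulmx_diag; congr (_ *m (diag_mx _ *m _)).
rewrite -mul2n exprM X2 exp_orth_diag// -mulmxA mxtrace_mulC -mulmxA VV mulmx1 mxtrace_diag.
by apply: eq_bigr => i _; rewrite !mxE exprM.
Qed.

Lemma svd_coef i : s 0 i = fdot (col i U) (X *m col i V).
Proof.
have [UU VV _ _ _] := Xsvd.
have e : diag_mx s = U^T *m (X *m V).
  by rewrite is_svd_mulmx -!mulmxA VV mulmx1 mulmxA UU mul1mx.
have -> : s 0 i = (diag_mx s) i i by rewrite mxE eqxx mulr1n.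
rewrite e mxE fdotE; apply: eq_bigr => k _; rewrite big_ord1 !mxE; congr (_ * _).
by apply: eq_bigr => l _; rewrite mxE.
Qed.

Lemma fsq_svd_col (W : 'M[R]_n) i : W^T *m W = 1%:M -> fsq (col i W) = 1.
Proof.
move=> WW; rewrite colE fsq_orth// fsqE (bigD1 i)//= big_ord1 mxE !eqxx expr1n big1 ?addr0//.
by move=> j ji; rewrite big_ord1 mxE (negPf ji) expr0n.
Qed.

Lemma opbound_svd c : (forall i, s 0 i <= c) -> opbound c X.
Proof.
have [UU VV s0 _ _] := Xsvd => sc; rewrite is_svd_mulmx.
by apply: opbound_orth_diag => // i; rewrite ger0_norm.
Qed.

End SymmetricTrace.

Lemma opbound_trace_exp (R : realType) n (X : 'M[R]_n) M c : (0 < M)%N -> 0 <= c -> X^T = X ->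
  \tr (X ^+ M.*2) <= c ^+ M.*2 -> opbound c X.
Proof.
move=> M0 c0 Xsym; have [[[U s] V] sX] := svd_exists X; have [_ _ s0 _ _] := sX.
rewrite (mxtrace_exp_svd Xsym sX) => h.
apply: (opbound_svd sX) => i.
rewrite -(ler_pXn2r (_ : 0 < M.*2)%N) ?nnegrE ?double_gt0//.
apply: le_trans h; rewrite (bigD1 i)//= lerDl sumr_ge0// => j _; exact: exprn_ge0.
Qed.

(** * A lattice net and the dense comparison matrix *)

Section LatticeNet.
Context {R : realType} (N : nat).
Hypothesis N_gt0 : (0 < N)%N.
Let h : R := (4 * Num.sqrt N%:R)^-1.

Definition lattice_vec (k : {ffun 'I_N -> 'I_(8 * N).+1}) : 'cV[R]_N :=
  \col_i (h * ((k i)%:R - (4 * N)%:R)).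

Let sqrtN_gt0 : 0 < Num.sqrt N%:R :> R. Proof. by rewrite sqrtr_gt0 ltr0n. Qed.
Let h_gt0 : 0 < h. Proof. by rewrite invr_gt0 mulr_gt0. Qed.
Let h2 : h ^+ 2 * (16 * N%:R) = 1.
Proof.
have e : Num.sqrt N%:R ^+ 2 = N%:R :> R by rewrite sqr_sqrtr.
by rewrite /h exprVn exprMn e -natrX mulVf// mulf_neq0// pnatr_eq0 -lt0n.
Qed.

(* The mesh 1 / (4 sqrt N) makes the rounding error of a vector at most 1/4. *)
Lemma lattice_net (u : 'cV[R]_N) : fsq u = 1 -> exists k, fsq (u - lattice_vec k) <= 16^-1.
Proof.
move=> u1.
have ui i : `|u i 0| <= 1.
  rewrite -ler_sqr ?nnegrE// expr1n -u1 fsqE (bigD1 i)//= big_ord1 real_normK ?num_real// lerDl.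
  by apply: sumr_ge0 => j _; rewrite big_ord1 sqr_ge0.
have hN : h^-1 <= (4 * N)%:R.
  rewrite invrK natrM ler_wpM2l// -[leRHS]sqr_sqrtr// expr2 ler_peMl ?sqrtr_ge0//.
  by rewrite -[leLHS]sqrtr1 ler_wsqrtr// ler1n.
have bd i : `|u i 0 / h| <= (4 * N)%:R.
  by rewrite normrM (le_trans _ hN)// normfV (gtr0_norm h_gt0) ler_piMl// invr_ge0 ltW.
pose z i := u i 0 / h + (4 * N)%:R.
have z0 i : 0 <= z i by have := bd i; rewrite ler_norml => /andP[]; rewrite /z; lra.
have zlt i : (Num.truncn (z i) < (8 * N).+1)%N.
  have /truncn_itv/andP[t1 _] := z0 i.
  rewrite -(ltr_nat R) (le_lt_trans t1)//.
  have := bd i; rewrite ler_norml => /andP[_]; rewrite /z.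
  have -> : (8 * N).+1%:R = 2 * (4 * N)%:R + 1 :> R by rewrite -natrM mulnA -addn1 natrD.
  lra.
exists [ffun i => Ordinal (zlt i)].
rewrite fsqE (@le_trans _ _ (\sum_(i < N) h ^+ 2))//; last first.
  rewrite sumr_const card_ord -mulr_natr; have := h2; lra.
apply: ler_sum => i _; rewrite big_ord1 !mxE ffunE /=.
have /truncn_itv/andP[t1 t2] := z0 i.
have -> : u i 0 - h * ((Num.truncn (z i))%:R - (4 * N)%:R) = h * (z i - (Num.truncn (z i))%:R).
  by rewrite /z; field; rewrite gt_eqF.
rewrite exprMn -[leRHS]mulr1 ler_wpM2l ?sqr_ge0//.
rewrite expr_le1 ?subr_ge0//; move: t2; rewrite -natr1; lra.
Qed.

Lemma geometric_half_le (m : nat) : \sum_(j < m) (2^-1 : R) ^+ j <= 2 - 2 * 2^-1 ^+ m.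
Proof.
elim: m => [|m IH]; first by rewrite big_ord0 expr0; lra.
by rewrite big_ord_recr /= exprS; lra.
Qed.

(** Gaussian weights will count the lattice points of a ball. The sum is split at the center 4N, and
    exp(-m^2) <= 2^-m gives 1 on the left and 2 on the right. *)
Lemma sum_gaussian_le : \sum_(j < (8 * N).+1) expR (- (j%:R - (4 * N)%:R) ^+ 2) <= 3 :> R.
Proof.
have e m : expR (- (m%:R) ^+ 2) <= 2^-1 ^+ m :> R.
  have h1 : 2 <= expR 1 :> R by have := expR_ge1Dx (1 : R); lra.
  rewrite (@le_trans _ _ (expR (- m%:R)))//.
    by rewrite ler_expR lerN2 -natrX ler_nat; case: (m) => // k; rewrite leq_pmull.
  rewrite -mulN1r expRM_natr lerXn2r ?nnegrE ?expR_ge0// expRN lef_pV2 ?posrE ?expR_gt0//.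
have -> : (8 * N).+1 = (4 * N + (4 * N).+1)%N by lia.
rewrite big_split_ord /=.
have a1 : \sum_(j < 4 * N) expR (- (j%:R - (4 * N)%:R) ^+ 2) <= 1 :> R.
  rewrite (reindex_inj rev_ord_inj)/= (@le_trans _ _ (\sum_(j < 4 * N) 2^-1 ^+ j.+1))//.
    apply: ler_sum => j _; rewrite natrB ?ltn_ord// addrAC subrr add0r sqrrN// (le_trans _ (e _))//.
  under eq_bigr do rewrite exprS; rewrite -mulr_sumr.
  by have := geometric_half_le (4 * N); have := exprn_ge0 (4 * N) (_ : 0 <= 2^-1 :> R); lra.
have a2 : \sum_(j < (4 * N).+1) expR (- ((4 * N + j)%:R - (4 * N)%:R) ^+ 2) <= 2 :> R.
  rewrite (@le_trans _ _ (\sum_(j < (4 * N).+1) 2^-1 ^+ j))//.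
    by apply: ler_sum => j _; rewrite natrD addrAC subrr add0r.
  rewrite (le_trans (geometric_half_le _))// gerBl mulr_ge0 ?exprn_ge0//.
by have := lerD a1 a2; lra.
Qed.


End LatticeNet.

(** This is y <= exp y at y = |z| / (2M), raised to the power 2M. *)
Lemma exprn_even_le_expR (R : realType) (z : R) M : (0 < M)%N ->
  z ^+ M.*2 <= (M.*2)%:R ^+ M.*2 * (expR z + expR (- z)).
Proof.
move=> M0; have M2 : 0 < (M.*2)%:R :> R by rewrite ltr0n double_gt0.
have h1 : `|z| / (M.*2)%:R <= expR (`|z| / (M.*2)%:R).
  by have := expR_ge1Dx (`|z| / (M.*2)%:R); lra.
have h2 : z ^+ M.*2 = `|z| ^+ M.*2.
  by rewrite -mul2n !exprM real_normK ?num_real.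
have h3 : expR `|z| <= expR z + expR (- z).
  by case: (ger0P z) => _; rewrite ?lerDl ?lerDr expR_ge0.
rewrite h2 (@le_trans _ _ ((M.*2)%:R ^+ M.*2 * expR `|z|))//; last by rewrite ler_wpM2l ?exprn_ge0.
rewrite -ler_pdivrMl ?exprn_gt0// mulrC -expr_div_n.
by rewrite -[X in expR X](divfK (lt0r_neq0 M2)) expRM_natr lerXn2r ?nnegrE ?expR_ge0//.
Qed.

Section BilinearMGF.
Context {R : realType} {E V : finType} {n : nat}.
Variables (p : E -> V -> R) (x : E -> V -> R) (ed : 'I_n -> 'I_n -> E) (K : R).
Hypothesis ed_inj : forall i j k l, ed i j = ed k l -> (i = k /\ j = l) \/ (i = l /\ j = k).
Hypothesis p_ge0 : forall e v, 0 <= p e v.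
Hypothesis K_ge0 : 0 <= K.
Hypothesis mgf : forall e s, \sum_v p e v * expR (s * x e v) <= expR (K * s ^+ 2).

(** The bilinear form is linear in the independent entries. The coefficient [c e] collects the at
    most two ordered pairs lying over [e], which explains the factor 2. *)
Lemma Ex_expR_bilinear (a b : 'cV[R]_n) l :
  Ex p (fun o => expR (l * fdot a (edge_matrix x ed o *m b))) <=
  expR (2 * K * l ^+ 2 * (fsq a * fsq b)).
Proof.
pose c e := \sum_(ij : 'I_n * 'I_n | ed ij.1 ij.2 == e) a ij.1 0 * b ij.2 0.
have bil o : fdot a (edge_matrix x ed o *m b) = \sum_e c e * x e (o e).
  rewrite fdotE.
  transitivity (\sum_(ij : 'I_n * 'I_n) a ij.1 0 * b ij.2 0 * x (ed ij.1 ij.2) (o (ed ij.1 ij.2))).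
    rewrite -(pair_bigA _ (fun i j => a i 0 * b j 0 * x (ed i j) (o (ed i j))))/=.
    apply: eq_bigr => i _; rewrite big_ord1 mxE mulr_sumr; apply: eq_bigr => j _.
    by rewrite mxE; ring.
  rewrite (partition_big (fun ij => ed ij.1 ij.2) predT)//=; apply: eq_bigr => e _.
  by rewrite mulr_suml; apply: eq_bigr => ij /eqP ->.
have c2 : \sum_e c e ^+ 2 <= 2 * (fsq a * fsq b).
  have -> : \sum_e c e ^+ 2 = \sum_(ij : 'I_n * 'I_n) \sum_(kl : 'I_n * 'I_n | ed kl.1 kl.2 == ed ij.1 ij.2)
      (a ij.1 0 * b ij.2 0) * (a kl.1 0 * b kl.2 0).
    rewrite [RHS](partition_big (fun ij => ed ij.1 ij.2) predT)//=; apply: eq_bigr => e _.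
    rewrite expr2 {1}/c mulr_suml; apply: eq_bigr => ij /eqP eij.
    by rewrite mulr_sumr; apply: eq_bigl => kl; rewrite eij.
  pose f (ij : 'I_n * 'I_n) := (a ij.1 0 * b ij.2 0) ^+ 2.
  apply: (@le_trans _ _ (\sum_(ij : 'I_n * 'I_n) \sum_(kl : 'I_n * 'I_n | ed kl.1 kl.2 == ed ij.1 ij.2)
      (f ij + f kl) / 2)).
    apply: ler_sum => ij _; apply: ler_sum => kl _; rewrite /f.
    have := sqr_ge0 (a ij.1 0 * b ij.2 0 - a kl.1 0 * b kl.2 0); nra.
  have -> : \sum_(ij : 'I_n * 'I_n) \sum_(kl : 'I_n * 'I_n | ed kl.1 kl.2 == ed ij.1 ij.2) (f ij + f kl) / 2
     = \sum_(ij : 'I_n * 'I_n) \sum_(kl : 'I_n * 'I_n | ed kl.1 kl.2 == ed ij.1 ij.2) f ij.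
    under eq_bigr do under eq_bigr do rewrite mulrDl.
    under eq_bigr do rewrite big_split.
    rewrite big_split /= [X in _ + X](exchange_big_dep predT)//=.
    under [X in _ + X]eq_bigr => i _ do under eq_bigl => j do rewrite eq_sym.
    rewrite -big_split; apply: eq_bigr => ij _; rewrite -big_split; apply: eq_bigr => kl _.
    by rewrite /=; field.
  have -> : 2 * (fsq a * fsq b) = \sum_ij 2 * f ij.
    rewrite -mulr_sumr -(pair_bigA _ (fun i j => f (i, j)))/= !fsqE; congr (_ * _).
    rewrite mulr_suml; apply: eq_bigr => i _; rewrite big_ord1 mulr_sumr; apply: eq_bigr => j _.
    by rewrite big_ord1 /f exprMn.
  apply: ler_sum => ij _; rewrite sumr_const -[leLHS]mulr_natl ler_wpM2r ?sqr_ge0// ler_nat.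
  exact: card_edge_fiber.
rewrite (eq_Ex p (g := fun o => \prod_e expR (l * c e * x e (o e)))) => [|o]; last first.
  by rewrite bil mulr_sumr expR_sum; apply: eq_bigr => e _; rewrite mulrA.
rewrite (Ex_prod p (fun e v => expR (l * c e * x e v))).
apply: (@le_trans _ _ (\prod_e expR (K * (l * c e) ^+ 2))).
  apply: ler_prod => e _; rewrite mgf andbT sumr_ge0// => v _.
  by rewrite mulr_ge0 ?expR_ge0.
rewrite -expR_sum ler_expR.
under eq_bigr do rewrite exprMn mulrA.
rewrite -mulr_sumr; apply: le_trans (ler_wpM2l _ c2) _; first by rewrite mulr_ge0 ?sqr_ge0.
by rewrite le_eqVlt; apply/orP; left; apply/eqP; ring.
Qed.

End BilinearMGF.

Section DenseMatrix.
Context {R : realType} {M : nat}.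
Hypothesis M_gt0 : (0 < M)%N.
Let N := M.*2.
Let N_gt0 : (0 < N)%N. Proof. by rewrite /N double_gt0. Qed.

(* The entries are 2 with probability 1/3 and -1 with probability 2/3: their mean is 0 and all
   their other moments are at least 1. *)
Definition dense_weight (e : {set 'I_N}) (v : bool) : R := if v then 3^-1 else 2 / 3.
Definition dense_value (e : {set 'I_N}) (v : bool) : R := if v then 2 else -1.
Definition set_edge {n} (i j : 'I_n) : {set 'I_n} := [set i; j].

Lemma set_edgeC n (i j : 'I_n) : set_edge i j = set_edge j i.
Proof. exact: finset.setUC. Qed.

Lemma set_edge_inj n (i j k l : 'I_n) :
  set_edge i j = set_edge k l -> (i = k /\ j = l) \/ (i = l /\ j = k).
Proof.
move=> /setP h.
have hi : (i == k) || (i == l) by have := h i; rewrite !inE eqxx => <-.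
have hj : (j == k) || (j == l) by have := h j; rewrite !inE eqxx orbT => <-.
have hk : (k == i) || (k == j) by have := h k; rewrite !inE eqxx => ->.
have hl : (l == i) || (l == j) by have := h l; rewrite !inE eqxx orbT => ->.
case/orP: hi => /eqP ei; case/orP: hj => /eqP ej; subst i j; auto.
  by left; case/orP: hl => /eqP ->.
by right; case/orP: hk => /eqP ->.
Qed.

Lemma dense_weight_ge0 e v : 0 <= dense_weight e v.
Proof. by case: v; rewrite /dense_weight ?divr_ge0 ?invr_ge0. Qed.

Lemma dense_weight_sum1 e : \sum_v dense_weight e v = 1.
Proof. by rewrite big_bool /dense_weight /=; lra. Qed.

Lemma dense_moment1 e : moment dense_weight dense_value e 1 = 0.
Proof. by rewrite /moment big_bool /= !expr1; lra. Qed.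

Lemma dense_moment_ge1 e m : m != 1%N -> 1 <= moment dense_weight dense_value e m.
Proof.
rewrite /moment big_bool /dense_weight /dense_value /=.
case: m => [|[|[|m]]] // _; rewrite ?expr0; first by lra.
  by rewrite !expr2; lra.
have h1 : 8 <= 2 ^+ m.+3 :> R.
  by rewrite !exprS !mulrA; have := exprn_ege1 m (_ : 1 <= 2 :> R); lra.
have h2 : -1 <= (-1) ^+ m.+3 :> R by rewrite -signr_odd; case: (odd _); rewrite ?expr1 ?expr0; lra.
lra.
Qed.

(** In [expR_le_add_expR_sq] the linear terms cancel since the mean is 0, and the larger value 2
    gives 2 (2 s)^2 = 8 s^2. *)
Lemma dense_mgf e s : \sum_v dense_weight e v * expR (s * dense_value e v) <= expR (8 * s ^+ 2).
Proof.
rewrite big_bool /dense_weight /dense_value /=.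
have h1 := expR_le_add_expR_sq (s * 2).
have h2 := expR_le_add_expR_sq (s * -1).
have h3 : expR (2 * (s * -1) ^+ 2) <= expR (8 * s ^+ 2).
  by rewrite ler_expR; have := sqr_ge0 s; nra.
have e4 : 2 * (s * 2) ^+ 2 = 8 * s ^+ 2 by ring.
rewrite e4 in h1; lra.
Qed.

End DenseMatrix.

Section NetTrace.
Context {R : realType} {M : nat}.
Hypothesis M_gt0 : (0 < M)%N.
Let N := M.*2.
Let N_gt0 : (0 < N)%N. Proof. by rewrite /N double_gt0. Qed.

Definition lattice_ball (k : {ffun 'I_N -> 'I_(8 * N).+1}) : bool :=
  fsq (lattice_vec k : 'cV[R]_N) <= 25 / 16.

(** In the ball of radius 5/4 the integer coordinates, centered at 4N, have square sum at most 16 N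
    * 25/16 = 25 N. The indicator is thus at most exp(25 N) times a product of Gaussian weights,
    whose sum is at most 3^N <= exp(2 N). *)
Lemma card_lattice_ball : #|[pred k | lattice_ball k]|%:R <= expR 27 ^+ N :> R.
Proof.
have Np : 0 < N%:R :> R by rewrite ltr0n.
rewrite -sum1_card natr_sum big_mkcond.
apply: (@le_trans _ _ (\sum_(k : {ffun 'I_N -> 'I_(8 * N).+1}) expR 25 ^+ N * \prod_i expR (- ((k i)%:R - (4 * N)%:R) ^+ 2))).
  apply: ler_sum => k _; rewrite inE -expRM_natr -expR_sum -expRD.
  case: ifP => [kb|_]; last exact: expR_ge0.
  rewrite -[leLHS]expR0 ler_expR sumrN subr_ge0.
  have <- : (16 * N%:R) * fsq (lattice_vec k : 'cV[R]_N) = \sum_i ((k i)%:R - (4 * N)%:R) ^+ 2.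
    rewrite fsqE mulr_sumr; apply: eq_bigr => i _; rewrite big_ord1 mxE exprMn mulrA.
    have e : Num.sqrt N%:R ^+ 2 = N%:R :> R by rewrite sqr_sqrtr.
    rewrite exprVn exprMn e -natrX mulfV ?mul1r// mulf_neq0// ?pnatr_eq0 -?lt0n//.
  have := ler_wpM2l (ltW Np) kb; lra.
rewrite -mulr_sumr.
have := bigA_distr_bigA (fun (i : 'I_N) (j : 'I_(8 * N).+1) => expR (- (j%:R - (4 * N)%:R) ^+ 2) : R).
move=> <-; rewrite prodr_const card_ord -exprMn; apply: lerXn2r; rewrite ?nnegrE ?expR_ge0//.
  by rewrite mulr_ge0 ?expR_ge0// sumr_ge0// => j _; exact: expR_ge0.
have -> : 27 = 25 + 1 + 1 :> R by lra.
rewrite !expRD -mulrA ler_pM2l ?expR_gt0// (le_trans (sum_gaussian_le _))//.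
have := expR_ge1Dx (1 : R); nra.
Qed.

Lemma trace_exp_net (Y : 'M[R]_N) : Y^T = Y ->
  \tr (Y ^+ N) <= N%:R * (9 * N%:R) ^+ M * \sum_(k | lattice_ball k) \sum_(l | lattice_ball l)
    (expR (Num.sqrt N%:R * fdot (lattice_vec k) (Y *m lattice_vec l)) +
     expR (- Num.sqrt N%:R * fdot (lattice_vec k) (Y *m lattice_vec l))).
Proof.
move=> Ysym; have [[[U s] V] sY] := svd_exists Y; have [UU VV s0 sdec _] := sY.
have Np : 0 < N%:R :> R by rewrite ltr0n.
pose i0 : 'I_N := Ordinal N_gt0; pose t := s 0 i0.
have st i : s 0 i <= t by apply: sdec.
have Yt : opbound t Y := opbound_svd sY st.
have t0 : 0 <= t := s0 i0.
have [k kE] := lattice_net N_gt0 (fsq_svd_col i0 UU).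
have [l lE] := lattice_net N_gt0 (fsq_svd_col i0 VV).
set u := col i0 U in kE; set v := col i0 V in lE.
set u' := lattice_vec k in kE; set v' := lattice_vec l in lE.
have n1 (w w' : 'cV[R]_N) : fsq (w - w') <= 16^-1 -> fnorm (w - w') <= 4^-1.
  move=> h; rewrite -ler_sqr ?nnegrE ?fnorm_ge0// sqr_fnorm (le_trans h)//; lra.
have n2 (w w' : 'cV[R]_N) : fsq w = 1 -> fsq (w - w') <= 16^-1 -> fnorm w' <= 5 / 4.
  move=> w1 /n1 h; have -> : w' = w - (w - w') by rewrite opprB addrC subrK.
  by rewrite (le_trans (fnormB _ _))// {1}/fnorm w1 sqrtr1; lra.
have u1 : fsq u = 1 := fsq_svd_col i0 UU.
have v1 : fsq v = 1 := fsq_svd_col i0 VV.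
have b5 (w w' : 'cV[R]_N) : fsq w = 1 -> fsq (w - w') <= 16^-1 -> fsq w' <= 25 / 16.
  move=> w1 h; have := n2 _ _ w1 h; rewrite -ler_sqr ?nnegrE ?fnorm_ge0// sqr_fnorm; lra.
have kb : lattice_ball k := b5 _ _ u1 kE.
have lb : lattice_ball l := b5 _ _ v1 lE.
pose z := fdot u' (Y *m v').
(* Moving both top singular vectors to the net costs t / 4 and (5/4) (t / 4), so that at least 7/16
   of t is left. *)
have tz : t <= 3 * `|z|.
  have e : t = fdot (u - u') (Y *m v) + fdot u' (Y *m (v - v')) + z.
    by rewrite /t (svd_coef sY) -/u -/v mulmxBr fdotBr fdotBl /z; ring.
  have h1 : fdot (u - u') (Y *m v) <= 4^-1 * t.
    rewrite (le_trans (ler_norm _))// (le_trans (fdot_le _ _))//.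
    apply: ler_pM; rewrite ?fnorm_ge0 ?n1//.
    by rewrite (le_trans (opbound_fnorm _ t0 Yt))// /fnorm v1 sqrtr1 mulr1.
  have h2 : fdot u' (Y *m (v - v')) <= 5 / 4 * (4^-1 * t).
    rewrite (le_trans (ler_norm _))// (le_trans (fdot_le _ _))//.
    apply: ler_pM; rewrite ?fnorm_ge0 ?(n2 u)//.
    by rewrite (le_trans (opbound_fnorm _ t0 Yt))// mulrC ler_wpM2r// n1.
  have := ler_norm z; have := normr_ge0 z; lra.
have term : t ^+ N <= (9 * N%:R) ^+ M * (expR (Num.sqrt N%:R * z) + expR (- Num.sqrt N%:R * z)).
  have sN : 0 < Num.sqrt N%:R :> R by rewrite sqrtr_gt0.
  have sNN : Num.sqrt N%:R ^+ N = N%:R ^+ M :> R by rewrite -[X in X ^+ M](sqr_sqrtr (ler0n R N)) -exprM mul2n.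
  have h := exprn_even_le_expR (Num.sqrt N%:R * z) M_gt0.
  rewrite exprMn -/N sNN in h.
  have NM : N%:R ^+ N = N%:R ^+ M * N%:R ^+ M :> R by rewrite -exprD addnn.
  rewrite NM -mulrA ler_pM2l ?exprn_gt0// in h.
  have h9 : t ^+ N <= 9 ^+ M * z ^+ N.
    have -> : 9 ^+ M * z ^+ N = (3 * `|z|) ^+ N.
      have even_exp (y : R) : y ^+ N = (y ^+ 2) ^+ M by rewrite -exprM mul2n.
      rewrite !even_exp -exprMn; congr (_ ^+ M).
      by rewrite exprMn real_normK ?num_real// expr2; lra.
    by rewrite lerXn2r ?nnegrE// mulr_ge0.
  rewrite (le_trans h9)// exprMn -mulrA ler_wpM2l ?exprn_ge0// mulNr.
  exact: h.
have -> : \tr (Y ^+ N) = \sum_i s 0 i ^+ N by rewrite (mxtrace_exp_svd Ysym sY).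
apply: (@le_trans _ _ (N%:R * t ^+ N)).
  rewrite -[N in N%:R]card_ord mulr_natl -sumr_const; apply: ler_sum => i _.
  by rewrite lerXn2r ?nnegrE.
rewrite -mulrA ler_pM2l// (le_trans term)// ler_wpM2l ?exprn_ge0 ?mulr_ge0//.
have pos a b : 0 <= expR a + expR b :> R by rewrite addr_ge0 ?expR_ge0.
rewrite (bigD1 k)//= (bigD1 l)//= -/u' -/v' -/z -addrA lerDl addr_ge0 ?sumr_ge0// => i _.
exact: sumr_ge0.
Qed.

Lemma dense_trace_le :
  Ex (@dense_weight R M) (fun o => \tr (edge_matrix dense_value set_edge o ^+ N)) <=
  (9 * expR 192 * N%:R) ^+ M.
Proof.
have Np : 0 < N%:R :> R by rewrite ltr0n.
have p0 := @dense_weight_ge0 R M; have p1 := @dense_weight_sum1 R M.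
pose z k l o := fdot (lattice_vec k) (edge_matrix (@dense_value R M) set_edge o *m lattice_vec l).
pose sN : R := Num.sqrt N%:R.
apply: (@le_trans _ _ (Ex (@dense_weight R M) (fun o => N%:R * (9 * N%:R) ^+ M *
   \sum_(k | lattice_ball k) \sum_(l | lattice_ball l) (expR (sN * z k l o) + expR (- sN * z k l o))))).
  apply: le_Ex => // o; apply: trace_exp_net.
  by apply/matrixP => i j; rewrite !mxE set_edgeC.
rewrite ExZ Ex_sum.
(* The exponent is 2 * 8 * N * (25/16)^2 <= 40 N. *)
have term k l (c : R) : lattice_ball k -> lattice_ball l -> c ^+ 2 = N%:R ->
    Ex (@dense_weight R M) (fun o => expR (c * z k l o)) <= expR 40 ^+ N.
  move=> kb lb cN.
  rewrite (le_trans (Ex_expR_bilinear (@set_edge_inj _) p0 _ (@dense_mgf R M) _ _ _))//.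
  rewrite -expRM_natr ler_expR cN.
  have : fsq (lattice_vec k : 'cV[R]_N) * fsq (lattice_vec l : 'cV[R]_N) <= 25 / 16 * (25 / 16).
    by apply: ler_pM => //; exact: fsq_ge0.
  nra.
apply: (@le_trans _ _ (N%:R * (9 * N%:R) ^+ M *
   \sum_(k | lattice_ball k) \sum_(l | lattice_ball l) 2 * expR 40 ^+ N)).
  rewrite ler_wpM2l ?mulr_ge0 ?exprn_ge0//.
  apply: ler_sum => k kb; rewrite Ex_sum; apply: ler_sum => l lb; rewrite ExD mulr2n mulrDl mul1r.
  by apply: lerD; apply: term; rewrite // ?sqrrN sqr_sqrtr.
have -> : \sum_(k | lattice_ball k) \sum_(l | lattice_ball l) 2 * expR 40 ^+ N =
    #|[pred k | lattice_ball k]|%:R * #|[pred k | lattice_ball k]|%:R * (2 * expR 40 ^+ N) :> R.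
  by move: (2 * _) => c2; rewrite !sumr_const -mulrnA -[LHS]mulr_natr natrM mulrC.
have cb := card_lattice_ball.
have NE : N%:R * 2 <= expR 2 ^+ N :> R.
  rewrite -expRM_natr mulrC; have := expR_ge1Dx (2 * N%:R : R); lra.
rewrite !exprMn -[expR 192 ^+ M]expRM_natr.
have -> : (192 * M%:R : R) = 96 * N%:R by rewrite /N -mul2n natrM; ring.
(* Two net points, one moment generating function, and the prefactor 2 N. *)
have -> : 96 * N%:R = 27 * N%:R + 27 * N%:R + 40 * N%:R + 2 * N%:R :> R by ring.
have eD (a b c d : R) : expR (a + b + c + d) = expR a * expR b * expR c * expR d by rewrite !expRD.
rewrite (eD (27 * N%:R) (27 * N%:R) (40 * N%:R) (2 * N%:R)) !expRM_natr.
set c := (#|_|%:R : R) in cb *; have c0 : 0 <= c by rewrite ler0n.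
have cc : c * c <= expR 27 ^+ N * expR 27 ^+ N by apply: ler_pM.
have e40 : 0 <= expR 40 ^+ N :> R by rewrite exprn_ge0 ?expR_ge0.
have e9 : 0 <= 9 ^+ M * N%:R ^+ M :> R by rewrite mulr_ge0 ?exprn_ge0.
have h := ler_pM (mulr_ge0 c0 c0) (mulr_ge0 (ltW Np) (ler0n R 2)) cc NE.
have := ler_wpM2l (mulr_ge0 e40 e9) h; lra.
Qed.

End NetTrace.

(** * Tail of the operator norm of the sparse matrix *)

Section OperatorNormTail.
Context {R : realType} {E V : finType} {n : nat}.
Variables (p : E -> V -> R) (x : E -> V -> R) (ed : 'I_n -> 'I_n -> E) (r : R).
Hypothesis edC : forall i j, ed i j = ed j i.
Hypothesis ed_inj : forall i j k l, ed i j = ed k l -> (i = k /\ j = l) \/ (i = l /\ j = k).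
Hypothesis p_ge0 : forall e v, 0 <= p e v.
Hypothesis p_sum1 : forall e, \sum_v p e v = 1.
Hypothesis x_mean0 : forall e, \sum_v p e v * x e v = 0.
Hypothesis x_le1 : forall e v, `|x e v| <= 1.
Hypothesis x_var : forall e, \sum_v p e v * x e v ^+ 2 <= r.
Hypothesis r01 : 0 < r <= 1.
Hypothesis nr_ge1 : 1 <= n%:R * r.
Hypothesis nr_ln : ln n%:R <= n%:R * r.

Lemma opbound_tail :
  \sum_(o | ~~ `[< opbound (6 * expR 98 * Num.sqrt (n%:R * r)) (edge_matrix x ed o) >]) weight p o
  <= (n%:R ^+ 3)^-1.
Proof.
have /andP[r0 r1] := r01; have nr0 : 0 < n%:R * r by apply: lt_le_trans nr_ge1.
have n0 : 0 < n%:R :> R by rewrite -(pmulr_lgt0 _ r0).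
pose M := (Num.truncn (n%:R * r)).+1.
have [Mgt Mle] : n%:R * r < M%:R /\ M%:R <= 2 * (n%:R * r).
  have /truncn_itv/andP[t1 t2] := ltW nr0.
  rewrite -natr1 in t2; rewrite /M -[X in _ < X /\ X <= _]natr1; split; have := nr_ge1; lra.
(* Its square is exp 4 times the base 36 exp(192) n r of the trace bound. Markov's inequality thus
   leaves exp(-4M) / r, at most n^-3 because M >= ln n and 1 / r <= n. *)
set c := 6 * expR 98 * Num.sqrt (n%:R * r).
have c0 : 0 < c by rewrite !mulr_gt0 ?expR_gt0 ?sqrtr_gt0.
have trE : Ex p (fun o => \tr (edge_matrix x ed o ^+ M.*2)) <= r^-1 * (36 * expR 192 * (n%:R * r)) ^+ M.
  have m1 e : moment p x e 1 = 0 by rewrite -[RHS](x_mean0 e); apply: eq_bigr => v _; rewrite expr1.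
  apply: le_trans (Ex_trace_exp_le edC ed_inj p_ge0 p_sum1 _ m1 x_le1 x_var) _.
  apply: le_trans (@good_walk_sum_le R M 'I_n 'I_(M.*2) E ed r edC ed_inj r01 _) _.
    by rewrite !card_ord -addnn addnK ltW.
  rewrite ler_pM2l ?invr_gt0//.
  have h := good_walk_count_le (@set_edgeC _) (@set_edge_inj _) M.*2
     (@dense_moment1 R M) (@dense_moment_ge1 R M).
  apply: (le_trans h).
  apply: le_trans (dense_trace_le (R := R) (M := M) _) _ => //.
  have e0 : 0 < expR 192 :> R by exact: expR_gt0.
  have ge0 : 0 <= 36 * expR 192 * (n%:R * r) by rewrite !mulr_ge0// ltW.
  apply: lerXn2r; rewrite ?nnegrE//.
  have -> : (M.*2)%:R = 2 * M%:R :> R by rewrite -mul2n natrM.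
  have := ler_wpM2l (ltW e0) Mle; lra.
have X2 o : 0 <= \tr (edge_matrix x ed o ^+ M.*2).
  have Xsym : (edge_matrix x ed o)^T = edge_matrix x ed o.
    by apply/matrixP => i j; rewrite !mxE edC.
  have [[[U s] V'] sX] := svd_exists (edge_matrix x ed o); have [_ _ s0 _ _] := sX.
  by rewrite (mxtrace_exp_svd Xsym sX) sumr_ge0// => i _; rewrite exprn_ge0.
apply: (@le_trans _ _ (Ex p (fun o => \tr (edge_matrix x ed o ^+ M.*2)) / c ^+ M.*2)).
  apply: markov_Ex => //; first exact: exprn_gt0.
  move=> o; apply: contraNle => h; apply/asboolP; apply: (@opbound_trace_exp _ _ _ M) => //.
  - exact: ltW.
  - by apply/matrixP => i j; rewrite !mxE edC.
  - exact: ltW.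
have cM : c ^+ M.*2 = (36 * expR 196 * (n%:R * r)) ^+ M.
  rewrite -mul2n exprM; congr (_ ^+ M); rewrite !exprMn sqr_sqrtr ?ltW//.
  rewrite -expRM_natr; congr (_ * _ * _); first by rewrite expr2; lra.
  by congr expR; lra.
rewrite cM ler_pdivrMr; last by rewrite exprn_gt0// !mulr_gt0 ?expR_gt0.
apply: (le_trans trE).
have -> : 36 * expR 196 * (n%:R * r) = expR 4 * (36 * expR 192 * (n%:R * r)) :> R.
  have -> : 196 = 4 + 192 :> R by lra.
  by rewrite (expRD 4 192); ring.
have Z0 : 0 <= 36 * expR 192 * (n%:R * r) by rewrite !mulr_ge0 ?expR_ge0// ltW.
move: (36 * expR 192 * (n%:R * r)) Z0 => Z Z0.
rewrite [in leRHS]exprMn [leRHS]mulrA ler_wpM2r ?exprn_ge0//.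
have h4 : n%:R ^+ 4 <= expR 4 ^+ M :> R.
  have nE : n%:R = expR (ln n%:R) :> R by rewrite lnK.
  rewrite [in leLHS]nE -!expRM_natr ler_expR [leLHS]mulrC ler_wpM2l//.
  by rewrite (le_trans nr_ln) ?ltW.
rewrite (@le_trans _ _ n%:R)//.
  by rewrite -[leLHS]mul1r ler_pdivrMr.
by rewrite ler_pdivlMl ?exprn_gt0// -exprSr.
Qed.

End OperatorNormTail.

(** * Correlated random graphs as product weights *)

Section FinitelyValued.
Local Open Scope classical_set_scope.
Context {R : realType} {d} {T : measurableType d} (Pr : probability T R).
Context {F : finType} (X : T -> F).
Hypothesis mX : forall v, measurable [set w | X w = v].

Definition fiber_pr (v : F) : R := fine (Pr [set w | X w = v]).

Lemma fiber_pr_ge0 v : 0 <= fiber_pr v.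
Proof. by rewrite fine_ge0// measure_ge0. Qed.

Lemma fiber_prE v : Pr [set w | X w = v] = (fiber_pr v)%:E.
Proof. by rewrite fineK// fin_num_measure. Qed.

Lemma preimage_fiber_union (S : set F) :
  [set w | S (X w)] = \bigcup_(v in [set` [seq v <- index_enum F | `[< S v >]]]) [set w | X w = v].
Proof.
apply/seteqP; split=> w /=.
  by move=> Sw; exists (X w) => //=; rewrite mem_filter mem_index_enum andbT; apply/asboolP.
by move=> [v] /=; rewrite mem_filter => /andP[/asboolP Sv _] Xv; rewrite Xv.
Qed.

Lemma trivIset_fiber (D : set F) : trivIset D (fun v => [set w | X w = v]).
Proof. by move=> i j _ _ [w [/= <- <-]]. Qed.

Lemma measurable_preimage_finite (S : set F) : measurable [set w | S (X w)].
Proof. by rewrite preimage_fiber_union bigcup_seq; apply: bigsetU_measurable. Qed.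

Lemma expectation_finite (f : F -> R) : ('E_Pr[fun w => f (X w)] = (\sum_v fiber_pr v * f v)%R%:E)%E.
Proof.
have uT : \big[setU/set0]_(v <- index_enum F) [set w | X w = v] = [set: T].
  rewrite -bigcup_seq; apply/seteqP; split=> // w _; exists (X w) => //=.
  by rewrite mem_index_enum.
rewrite unlock -uT integral_bigsetU_EFin//; last 3 first.
- exact: index_enum_uniq.
- exact: trivIset_fiber.
- apply/measurable_EFinP; rewrite uT => _ Y mY; rewrite setTI.
  exact: (measurable_preimage_finite (fun v => Y (f v))).
rewrite -sumEFin; apply: eq_bigr => v _.
rewrite (eq_integral (cst (f v)%:E)); last by move=> w /set_mem/= ->.
rewrite integral_cst//. transitivity ((f v)%:E * (fiber_pr v)%:E)%E; first by congr (_ * _)%E; exact: fiber_prE.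
by rewrite -EFinM mulrC.
Qed.

Lemma probability_finite (S : set F) : Pr [set w | S (X w)] = (\sum_(v | `[< S v >]) fiber_pr v)%:E.
Proof.
rewrite -expectation_indic; last exact: measurable_preimage_finite.
rewrite (_ : \1_[set w | S (X w)] = (fun w => (`[< S (X w) >])%:R)); last first.
  by apply/funext => w; rewrite indicE.
rewrite (expectation_finite (fun v => (`[< S v >])%:R)); congr EFin.
rewrite [RHS]big_mkcond; apply: eq_bigr => v _.
by case: ifP; rewrite ?mulr1 ?mulr0.
Qed.

Lemma covariance_finite (f g : F -> R) :
  covariance Pr (fun w => f (X w)) (fun w => g (X w)) =
  (\sum_v fiber_pr v * ((f v - \sum_u fiber_pr u * f u) * (g v - \sum_u fiber_pr u * g u)))%:E.
Proof.
rewrite unlock !expectation_finite /=.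
exact: (expectation_finite (fun v => (f v - _) * (g v - _))).
Qed.

Lemma fiber_pr_sum1 : \sum_v fiber_pr v = 1.
Proof.
have := expectation_finite (fun=> 1); rewrite expectation_cst => -[->].
by apply: eq_bigr => v _; rewrite mulr1.
Qed.

End FinitelyValued.

Section CorrelatedGraphs.
Local Open Scope classical_set_scope.
Context {R : realType} {d : measure_display} {T : measurableType d}.
Context {Pr : probability T R} {n : nat}.
Context {Q1 Q2 Rho : 'M[R]_n} {A B : T -> 'M[R]_n}.
Hypothesis model : corrER Pr Q1 Q2 Rho A B.

(** Pairs that are not increasing carry the constant (false, false), so that they are deterministic
    independent coordinates and the law is a product over all ordered pairs. *)
Definition edge_code (w : T) : {ffun 'I_n * 'I_n -> bool * bool} :=
  [ffun e : 'I_n * 'I_n => if (e.1 < e.2)%N then (A w e.1 e.2 == 1, B w e.1 e.2 == 1) else (false, false)].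

Definition edge_pmf (e : 'I_n * 'I_n) (v : bool * bool) : R :=
  fiber_pr Pr (fun w => edge_code w e) v.

Let bitset (b : bool) : set R := if b then [set 1] else ~` [set 1].

Let measurable_bitset b : measurable (bitset b).
Proof. by case: b; [exact: measurable_set1|apply: measurableC; exact: measurable_set1]. Qed.

Let bitsetE b (x : R) : bitset b x <-> (x == 1) = b.
Proof. by case: b; split => /=; [move=> ->; rewrite eqxx|move/eqP|move/eqP/negbTE|move/negbT/eqP]. Qed.

Let fiberE (e : 'I_n * 'I_n) v : (e.1 < e.2)%N -> [set w | edge_code w e = v] =
  (fun w => (A w e.1 e.2, B w e.1 e.2)) @^-1` (bitset v.1 `*` bitset v.2).
Proof.
move=> ee; apply/seteqP; split=> w /=; rewrite ffunE ee.
  by move=> <-; split=> /=; apply/bitsetE.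
by case: v => a b [/bitsetE /= -> /bitsetE ->].
Qed.

Lemma measurable_code_edge e v : measurable [set w | edge_code w e = v].
Proof.
have [_ [mA _ _ _ _] [mB _ _ _ _] _ _] := model.
have [ee|ee] := boolP (e.1 < e.2)%N.
  rewrite fiberE//.
  have -> : (fun w => (A w e.1 e.2, B w e.1 e.2)) @^-1` (bitset v.1 `*` bitset v.2) =
    ([set: T] `&` (fun w => A w e.1 e.2) @^-1` bitset v.1) `&`
    ([set: T] `&` (fun w => B w e.1 e.2) @^-1` bitset v.2).
    by rewrite !setTI.
  by apply: measurableI; [apply: mA|apply: mB].
have [->|ne] := eqVneq v (false, false).
  rewrite (_ : [set w | _] = setT)//; apply/seteqP; split=> // w _ /=.
  by rewrite ffunE (negPf ee).
rewrite (_ : [set w | _] = set0)//; apply/seteqP; split=> // w /=.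
by rewrite ffunE (negPf ee) => /esym/eqP; rewrite (negPf ne).
Qed.

Let code_fiber o : [set w | edge_code w = o] = \bigcap_(e in [set: 'I_n * 'I_n]) [set w | edge_code w e = o e].
Proof.
apply/seteqP; split=> w /=; first by move=> cw e _ /=; rewrite cw.
by move=> h; apply/ffunP => e; exact: h.
Qed.

Lemma measurable_code o : measurable [set w | edge_code w = o].
Proof.
rewrite code_fiber; apply: fin_bigcap_measurable => [|e _]; first exact: finite_finset.
exact: measurable_code_edge.
Qed.

Lemma edge_pmf_ge0 e v : 0 <= edge_pmf e v.
Proof. exact: fiber_pr_ge0. Qed.

Lemma edge_pmf_sum1 e : \sum_v edge_pmf e v = 1.
Proof. by apply: fiber_pr_sum1 => v; exact: measurable_code_edge. Qed.

Lemma edge_pmf_off (e : 'I_n * 'I_n) v : ~~ (e.1 < e.2)%N -> edge_pmf e v = (v == (false, false))%:R.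
Proof.
move=> ee; rewrite /edge_pmf /fiber_pr.
have [->|ne] := eqVneq v (false, false).
  rewrite (_ : [set w | _] = setT) ?probability_setT//; apply/seteqP; split=> // w _ /=.
  by rewrite ffunE (negPf ee).
rewrite (_ : [set w | _] = set0) ?measure0//; apply/seteqP; split=> // w /=.
by rewrite ffunE (negPf ee) => /esym/eqP; rewrite (negPf ne).
Qed.

(** The assumed independence handles the increasing pairs; at the others the law is a point mass,
    and both sides are 0 when [o] disagrees with it. *)
Lemma fiber_pr_code o : fiber_pr Pr edge_code o = weight edge_pmf o.
Proof.
have [_ _ _ _ indep] := model.
pose D := [set e : 'I_n * 'I_n | (e.1 < e.2)%N]%SET.
rewrite /weight (bigID (mem D))/=.
have [/forallP off|/forallPn[e]] := boolP [forall e, (e \notin D) ==> (o e == (false, false))]; last first.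
  rewrite negb_imply => /andP[eD oe].
  have p0 : edge_pmf e (o e) = 0 by rewrite edge_pmf_off ?(negPf oe)//; rewrite inE in eD.
  rewrite [X in _ * X](bigD1 e)//= p0 mul0r mulr0 /fiber_pr.
  rewrite (_ : [set w | _] = set0) ?measure0//; apply/seteqP; split=> // w /= cw.
  by move: oe; rewrite -cw ffunE; rewrite inE in eD; rewrite (negPf eD) eqxx.
rewrite [X in _ * X]big1 ?mulr1 => [|e eD]; last first.
  by have /implyP/(_ eD)/eqP -> := off e; rewrite edge_pmf_off//; rewrite inE in eD.
have := indep D (fintype.subxx D) (fun e => bitset (o e).1 `*` bitset (o e).2).
have -> : \bigcap_(i in [set` D]) ((fun w => (A w i.1 i.2, B w i.1 i.2)) @^-1`
   (bitset (o i).1 `*` bitset (o i).2)) = [set w | edge_code w = o].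
  rewrite code_fiber; apply/seteqP; split=> w /= h e.
    move=> _; have [eD|eD] := boolP (e \in D).
      have ee : (e.1 < e.2)%N by rewrite inE in eD.
      by have := h e eD; rewrite -(fiberE _ ee).
    have /implyP/(_ eD)/eqP -> := off e; rewrite inE in eD.
    by rewrite /= ffunE (negPf eD).
  move=> eD; have ee : (e.1 < e.2)%N by rewrite /= inE in eD.
  by have := h e I; rewrite -[X in X -> _]/([set w | edge_code w e = o e] w) fiberE.
move=> h; rewrite /fiber_pr h => [|e _]; last exact: measurableX.
rewrite (eq_bigr (fun e => (edge_pmf e (o e))%:E)) => [|e eD].
  by rewrite prodEFin.
rewrite inE in eD; rewrite -fiberE// /edge_pmf fiber_prE// => v; exact: measurable_code_edge.
Qed.

Lemma probability_code (S : set {ffun 'I_n * 'I_n -> bool * bool}) :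
  Pr [set w | S (edge_code w)] = (\sum_(o | `[< S o >]) weight edge_pmf o)%:E.
Proof.
rewrite (probability_finite Pr measurable_code); congr EFin.
by apply: eq_bigr => o _; rewrite fiber_pr_code.
Qed.

Lemma covariance_code f g : covariance Pr (fun w => f (edge_code w)) (fun w => g (edge_code w)) =
  (Ex edge_pmf (fun o => (f o - Ex edge_pmf f) * (g o - Ex edge_pmf g)))%:E.
Proof.
rewrite (covariance_finite Pr measurable_code); congr EFin.
have e h : \sum_u fiber_pr Pr edge_code u * h u = Ex edge_pmf h.
  by apply: eq_bigr => u _; rewrite fiber_pr_code.
by rewrite e !(e f) (e g).
Qed.

Lemma edge_pmf_mean1 (e : 'I_n * 'I_n) : (e.1 < e.2)%N ->
  \sum_v edge_pmf e v * (v.1)%:R = Q1 e.1 e.2.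
Proof.
move=> ee; have [_ [_ _ _ _ pA] _ _ _] := model.
rewrite -(Ex_coord edge_pmf_sum1 (fun v : bool * bool => (v.1)%:R)).
have := pA e.1 e.2 (negbT (ltn_eqF ee)).
rewrite (_ : [set w | A w e.1 e.2 = 1] = [set w | (edge_code w e).1]); last first.
  by apply/seteqP; split=> w /=; rewrite ffunE ee /= => /eqP.
rewrite (probability_code (fun o => (o e).1)) => -[<-].
rewrite [RHS]big_mkcond; apply: eq_bigr => o _; rewrite asboolb.
by case: ((o e).1); rewrite ?mulr1 ?mulr0.
Qed.

Lemma edge_pmf_mean2 (e : 'I_n * 'I_n) : (e.1 < e.2)%N ->
  \sum_v edge_pmf e v * (v.2)%:R = Q2 e.1 e.2.
Proof.
move=> ee; have [_ _ [_ _ _ _ pB] _ _] := model.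
rewrite -(Ex_coord edge_pmf_sum1 (fun v : bool * bool => (v.2)%:R)).
have := pB e.1 e.2 (negbT (ltn_eqF ee)).
rewrite (_ : [set w | B w e.1 e.2 = 1] = [set w | (edge_code w e).2]); last first.
  by apply/seteqP; split=> w /=; rewrite ffunE ee /= => /eqP.
rewrite (probability_code (fun o => (o e).2)) => -[<-].
rewrite [RHS]big_mkcond; apply: eq_bigr => o _; rewrite asboolb.
by case: ((o e).2); rewrite ?mulr1 ?mulr0.
Qed.

End CorrelatedGraphs.

(** * Permuted correlations *)

Section SortedEdge.
Context {n : nat}.

(** Diagonal pairs go to non-increasing coordinates, where [centered] is 0; the resulting matrices
    are symmetric and hollow. *)
Definition sort_edge (i j : 'I_n) : 'I_n * 'I_n := if (i < j)%N then (i, j) else (j, i).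

Lemma sort_edgeC i j : sort_edge i j = sort_edge j i.
Proof. by rewrite /sort_edge; case: ltngtP => // ij; have -> : i = j by exact: val_inj. Qed.

Lemma sort_edge_inj i j k l : sort_edge i j = sort_edge k l -> (i = k /\ j = l) \/ (i = l /\ j = k).
Proof. by rewrite /sort_edge; do 2![case: ifP => _]; case=> -> ->; auto. Qed.

Lemma sort_edge_lt i j : i != j -> ((sort_edge i j).1 < (sort_edge i j).2)%N.
Proof. by rewrite /sort_edge neq_ltn; case: ifP => //= _; case/orP. Qed.

End SortedEdge.

Section CenteredEntries.
Context {R : realType} {n : nat}.
Variables (p : 'I_n * 'I_n -> bool * bool -> R) (sel : bool * bool -> bool) (Q : 'M[R]_n) (r : R).
Hypothesis p_ge0 : forall e v, 0 <= p e v.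
Hypothesis p_sum1 : forall e, \sum_v p e v = 1.
Hypothesis Qr : forall i j, 0 <= Q i j <= r.
Hypothesis r1 : r <= 1.
Hypothesis p_mean : forall e : 'I_n * 'I_n, (e.1 < e.2)%N -> \sum_v p e v * (sel v)%:R = Q e.1 e.2.

Definition centered (e : 'I_n * 'I_n) (v : bool * bool) : R :=
  if (e.1 < e.2)%N then (sel v)%:R - Q e.1 e.2 else 0.

Lemma centered_mean0 e : \sum_v p e v * centered e v = 0.
Proof.
rewrite /centered; case: (boolP (e.1 < e.2)%N) => ee; last by rewrite big1// => v _; rewrite mulr0.
by under eq_bigr do rewrite mulrBr; rewrite sumrB p_mean// -mulr_suml p_sum1 mul1r subrr.
Qed.

Lemma centered_le1 e v : `|centered e v| <= 1.
Proof.
rewrite /centered; case: ifP => _; last by rewrite normr0.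
have /andP[q0 qr] := Qr e.1 e.2.
by rewrite ler_norml; case: (sel v) => /=; apply/andP; split; have := r1; lra.
Qed.

Lemma centered_var e : \sum_v p e v * centered e v ^+ 2 <= r.
Proof.
have r0 : 0 <= r by have /andP[q0 qr] := Qr e.1 e.2; apply: le_trans qr.
rewrite /centered; case: (boolP (e.1 < e.2)%N) => ee; last by rewrite big1// => v _; rewrite expr0n mulr0.
have /andP[q0 qr] := Qr e.1 e.2.
rewrite (eq_bigr (fun v => (1 - 2 * Q e.1 e.2) * (p e v * (sel v)%:R) + p e v * Q e.1 e.2 ^+ 2)) => [|v _].
  rewrite big_split/= -mulr_sumr p_mean// -mulr_suml p_sum1 mul1r.
  by have := sqr_ge0 (Q e.1 e.2); nra.
by case: (sel v) => /=; ring.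
Qed.

End CenteredEntries.

Section PermutedCorrelation.
Context {R : realType} {n : nat}.
Variables (p : 'I_n * 'I_n -> bool * bool -> R) (x y : 'I_n * 'I_n -> bool * bool -> R).
Hypothesis p_ge0 : forall e v, 0 <= p e v.
Hypothesis p_sum1 : forall e, \sum_v p e v = 1.
Hypothesis x1 : forall e v, `|x e v| <= 1.
Hypothesis y1 : forall e v, `|y e v| <= 1.

Let X o := edge_matrix x (@sort_edge n) o.
Let Y o := edge_matrix y (@sort_edge n) o.

Definition perm_gap (s : 'S_n) (o : {ffun 'I_n * 'I_n -> bool * bool}) : R :=
  fdot (X o) (Y o - perm_mx s *m Y o *m (perm_mx s)^T).

Definition moved (s : 'S_n) : {set 'I_n} := [set i | s i != i].

Lemma conj_perm_mxE (s : 'S_n) (M : 'M[R]_n) i j :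
  (perm_mx s *m M *m (perm_mx s)^T) i j = M (s i) (s j).
Proof. by rewrite tr_perm_mx -row_permE -col_permE !mxE. Qed.

Lemma perm_gapE s o : perm_gap s o =
  \sum_i \sum_j X o i j * (Y o i j - Y o (s i) (s j)).
Proof.
rewrite /perm_gap fdotE; apply: eq_bigr => i _; apply: eq_bigr => j _.
by rewrite [X in _ * X = _]mxE [X in _ * (_ + X) = _]mxE conj_perm_mxE.
Qed.

Lemma edge_matrix_upd (z : 'I_n * 'I_n -> bool * bool -> R) o e v i j : sort_edge i j != e ->
  edge_matrix z (@sort_edge n) (upd o e v) i j = edge_matrix z (@sort_edge n) o i j :> R.
Proof. by move=> ije; rewrite !mxE ffunE (negPf ije). Qed.

Lemma sum_edge_fiber_le (g : 'I_n -> 'I_n -> R) e (m : R) :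
  (forall i j, g i j <= m) -> (forall i j, sort_edge i j != e -> g i j = 0) -> 0 <= m ->
  \sum_i \sum_j g i j <= 2 * m.
Proof.
move=> gm g0 m0; rewrite pair_bigA /=.
rewrite (bigID (fun ij : 'I_n * 'I_n => sort_edge ij.1 ij.2 == e))/= [X in _ + X]big1 ?addr0; last first.
  by move=> ij /g0.
rewrite (le_trans (ler_sum _ (fun ij _ => gm ij.1 ij.2)))// sumr_const -[leLHS]mulr_natl ler_wpM2r// ler_nat.
exact: (card_edge_fiber e (@sort_edge_inj n)).
Qed.

(** An edge with both ends fixed contributes X_e (Y_e - Y_e) = 0 and so has no influence. Otherwise
    the change of X costs at most 8, and those of Y and of its permuted copy at most 4 each. *)
Definition gap_diff (s : 'S_n) (e : 'I_n * 'I_n) : R :=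
  if (e.1 \in moved s) || (e.2 \in moved s) then 16 else 0.

Lemma perm_gap_bounded_differences s : bounded_differences (gap_diff s) (perm_gap s).
Proof.
move=> o e v; rewrite /gap_diff; case: ifPn => [_|]; last first.
  rewrite negb_or !inE !negbK => /andP[/eqP s1 /eqP s2].
  rewrite !perm_gapE -sumrB big1 ?normr0// => i _; rewrite -sumrB big1// => j _; apply/eqP; rewrite subr_eq0; apply/eqP.
  have fixe k l : sort_edge k l = e -> s k = k /\ s l = l.
    by rewrite /sort_edge; case: ifP => _ ke; rewrite -ke /= in s1 s2.
  have [ije|ije] := eqVneq (sort_edge i j) e.
    by have [-> ->] := fixe _ _ ije; rewrite !subrr !mulr0.
  rewrite /X /Y !(edge_matrix_upd _ o v ije) edge_matrix_upd//.
  apply: contra ije => /eqP sije; have [si sj] := fixe _ _ sije.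
  by rewrite -sije (perm_inj si) (perm_inj sj).
set o' := upd o e v.
have b1 (z : 'I_n * 'I_n -> bool * bool -> R) : (forall e v, `|z e v| <= 1) -> forall o i j,
    `|edge_matrix z (@sort_edge n) o i j| <= 1 by move=> z1 u i j; rewrite mxE.
have X1 := b1 _ x1; have Y1 := b1 _ y1.
pose g1 i j := `|X o i j - X o' i j| * 2.
pose g2 i j := `|Y o i j - Y o' i j|.
have le2 (a b : R) : `|a| <= 1 -> `|b| <= 1 -> `|a - b| <= 2.
  by move=> a1 b1'; rewrite (le_trans (ler_normB _ _))//; lra.
have s1 : \sum_i \sum_j g1 i j <= 2 * 4.
  apply: (@sum_edge_fiber_le _ e) => // i j.
    by rewrite /g1; have := le2 _ _ (X1 o i j) (X1 o' i j); rewrite -/X; lra.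
  by move=> ije; rewrite /g1 /X edge_matrix_upd// subrr normr0 mul0r.
have s2 : \sum_i \sum_j g2 i j <= 2 * 2.
  apply: (@sum_edge_fiber_le _ e) => // i j; first by rewrite /g2 le2.
  by move=> ije; rewrite /g2 /Y edge_matrix_upd// subrr normr0.
have s3 : \sum_i \sum_j g2 (s i) (s j) = \sum_i \sum_j g2 i j.
  rewrite [RHS](reindex_inj (@perm_inj _ s)); apply: eq_bigr => i _.
  by rewrite [RHS](reindex_inj (@perm_inj _ s)).
apply: (@le_trans _ _ (\sum_i \sum_j (g1 i j + (g2 i j + g2 (s i) (s j))))).
  rewrite !perm_gapE -sumrB (le_trans (ler_norm_sum _ _ _))//; apply: ler_sum => i _.
  rewrite -sumrB (le_trans (ler_norm_sum _ _ _))//; apply: ler_sum => j _.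
  have -> : X o i j * (Y o i j - Y o (s i) (s j)) - X o' i j * (Y o' i j - Y o' (s i) (s j)) =
     (X o i j - X o' i j) * (Y o i j - Y o (s i) (s j)) +
     X o' i j * ((Y o i j - Y o' i j) - (Y o (s i) (s j) - Y o' (s i) (s j))) by ring.
  rewrite (le_trans (ler_normD _ _))// !normrM lerD//.
    by rewrite /g1 ler_wpM2l// le2// Y1.
  rewrite (le_trans (ler_wpM2r (normr_ge0 _) (X1 o' i j)))// mul1r /g2.
  exact: ler_normB.
under eq_bigr do rewrite big_split /= big_split /=.
by rewrite big_split /= big_split /= s3; lra.
Qed.

Lemma sum_gap_diff_le s : \sum_e gap_diff s e ^+ 2 <= 512 * (#|moved s|%:R * n%:R).
Proof.
rewrite -(pair_bigA _ (fun i j => gap_diff s (i, j) ^+ 2))/=.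
apply: (@le_trans _ _ (\sum_i \sum_j (256 * (i \in moved s)%:R + 256 * (j \in moved s)%:R))).
  apply: ler_sum => i _; apply: ler_sum => j _; rewrite /gap_diff /=.
  by case: (i \in _); case: (j \in _); rewrite /= ?expr2; lra.
have e : \sum_(i < n) (i \in moved s)%:R = #|moved s|%:R :> R.
  by rewrite -sum1_card natr_sum [RHS]big_mkcond; apply: eq_bigr => i _; case: ifP.
under eq_bigr do rewrite big_split /= sumr_const card_ord -mulr_sumr e.
rewrite big_split /= sumr_const card_ord sumrMnl -mulr_sumr e -[256 * _ *+ n]mulr_natr.
lra.
Qed.

(** Exponential Markov inequality for falling to half of the mean. Only edges meeting a moved vertex
    count, so the variance term is proportional to the number of moved vertices, as the union bound
    needs. *)
Lemma perm_gap_tail s S l : 0 <= l -> Ex p (perm_gap s) = 2 * S ->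
  \sum_(o | perm_gap s o <= S) weight p o <= expR (1024 * l ^+ 2 * (#|moved s|%:R * n%:R) - l * S).
Proof.
move=> l0 ES.
have c0 e : 0 <= gap_diff s e by rewrite /gap_diff; case: ifP.
have md := mcdiarmid p_ge0 p_sum1 (- l) c0 (perm_gap_bounded_differences s).
apply: le_trans (markov_Ex p_ge0 (f := fun o => expR (- l * (perm_gap s o - Ex p (perm_gap s)))) (expR_gt0 (l * S)) _ _) _.
- by move=> o; exact: expR_ge0.
- move=> o oS; rewrite ler_expR ES; nra.
rewrite expRB ler_wpM2r ?invr_ge0 ?expR_ge0// (le_trans md)// ler_expR sqrrN.
have := ler_wpM2l (sqr_ge0 l) (sum_gap_diff_le s); lra.
Qed.

End PermutedCorrelation.

(* Over all functions instead of permutations, the sum factors as (1 + (n - 1) x)^n. *)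
Lemma sum_perm_moved_le (R : realType) n (x : R) : 0 <= x -> n%:R ^+ 2 * x <= 2^-1 ->
  \sum_(s : 'S_n | s != 1%g) x ^+ #|moved s| <= 2 * (n%:R ^+ 2 * x).
Proof.
move=> x0 nx.
pose G (f : {ffun 'I_n -> 'I_n}) : R := \prod_i (if f i == i then 1 else x).
have Gs (s : 'S_n) : x ^+ #|moved s| = G (pval s).
  rewrite -prodr_const big_mkcond; apply: eq_bigr => i _.
  by rewrite inE -pvalE; case: eqP.
have G0 f : 0 <= G f by apply: prodr_ge0 => i _; case: ifP.
have sumG : \sum_f G f <= expR (n%:R ^+ 2 * x).
  rewrite /G -(bigA_distr_bigA (fun i j => if j == i then 1 else x)).
  rewrite expr2 -mulrA mulrC expRM_natr -[n in _ ^+ n]card_ord -prodr_const.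
  apply: ler_prod => i _; rewrite sumr_ge0 => [|j _]; last by case: ifP.
  rewrite /= (bigD1 i)//= eqxx (le_trans _ (expR_ge1Dx _))// lerD2l.
  rewrite (eq_bigr (fun=> x)) => [|j /negPf ->//].
  rewrite sumr_const -[leLHS]mulr_natl ler_wpM2r// ler_nat -[leqRHS]card_ord; exact: max_card.
have inj : \sum_(s : 'S_n) x ^+ #|moved s| <= \sum_f G f.
  have -> : \sum_(s : 'S_n) x ^+ #|moved s| = \sum_(f : {ffun 'I_n -> 'I_n} | injectiveb f) G f.
    rewrite [RHS](reindex_onto (fun s : 'S_n => pval s) (fun f => insubd (1%g : {perm 'I_n}) f))/=; last first.
      by move=> f fi; rewrite -[pval _]/(val _) insubdK.
    apply: eq_big => [s|s _]; last by rewrite Gs.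
    by rewrite -[pval s]/(val s) valKd eqxx andbT; apply/esym; exact: (valP s).
  by rewrite [leRHS](bigID (fun f : {ffun 'I_n -> 'I_n} => injectiveb f))/= lerDl sumr_ge0.
have split1 : \sum_(s : 'S_n) x ^+ #|moved s| = 1 + \sum_(s : 'S_n | s != 1%g) x ^+ #|moved s|.
  rewrite (bigD1 (1%g : 'S_n))//=; congr (_ + _).
  by rewrite (_ : moved _ = finset.set0) ?cards0//; apply/setP => i; rewrite !inE perm1 eqxx.
have y0 : 0 <= n%:R ^+ 2 * x by rewrite mulr_ge0 ?exprn_ge0.
move: (n%:R ^+ 2 * x) y0 nx sumG => y y0 nx sumG.
suff : expR y <= 1 + 2 * y by rewrite split1 in inj; lra.
have e1 : 1 - y <= expR (- y) by exact: expR_ge1Dx.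
have e2 : 0 < expR y by exact: expR_gt0.
have e3 : expR y * (1 - y) <= 1 by rewrite -[leRHS](expRxMexpNx_1 y) ler_pM2l.
nra.
Qed.

(** * Matching *)

Section Clipping.
Context {R : realType} {n : nat}.
Implicit Types A B Q : 'M[R]_n.

Definition hollow Q : 'M[R]_n := \matrix_(i, j) if i == j then 0 else Q i j.

(** Clipping to [0, 1] brings an entry no further from a target in [0, 1], and both diagonals are
    zero. *)
Lemma fnorm_usvt_le t A Q : (forall i j, 0 <= Q i j <= 1) ->
  fnorm (usvt t A - hollow Q) <= fnorm (usvt_trunc t A - Q).
Proof.
move=> Q01; rewrite ler_wsqrtr// !fsqE; apply: ler_sum => i _; apply: ler_sum => j _.
rewrite [usvt]lock !mxE -lock /usvt mxE.
case: eqP => _; first by rewrite subr0 expr0n sqr_ge0.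
have /andP[q0 q1] := Q01 i j; move: (usvt_trunc t A i j) (Q i j) q0 q1 => x q q0 q1 /=.
case: ltP => x0; first by nra.
case: ltP => x1; last by [].
nra.
Qed.

(** The singular value tail concerns [Q], while the mean of [A] is [hollow Q]; changing one into the
    other costs only r. *)
Lemma opbound_diagonal Q r : (forall i j, 0 <= Q i j <= r) -> opbound r (Q - hollow Q).
Proof.
move=> Qr.
have -> : Q - hollow Q = 1%:M *m diag_mx (\row_i Q i i) *m 1%:M^T.
  rewrite trmx1 mulmx1 mul1mx; apply/matrixP => i j; rewrite !mxE.
  by case: eqP => [->|]; rewrite ?subr0 ?subrr.
apply: opbound_orth_diag; rewrite ?trmx1 ?mul1mx// => i; rewrite mxE.
by have /andP[q0 qr] := Qr i i; rewrite ger0_norm.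
Qed.

Lemma opbound_le m c c' (Z : 'M[R]_(m, n)) : 0 <= c -> c <= c' -> opbound c Z -> opbound c' Z.
Proof.
move=> c0 cc' Zc x; rewrite (le_trans (Zc x))// ler_wpM2r ?fsq_ge0//.
by rewrite lerXn2r ?nnegrE// (le_trans c0).
Qed.

Lemma fnorm_opbound c (Z : 'M[R]_n) : 0 <= c -> opbound c Z -> fnorm Z <= c * Num.sqrt n%:R.
Proof.
move=> c0 Zc; have := opbound_fnorm 1%:M c0 Zc; rewrite mulmx1 {2}/fnorm.
have -> : fsq (1%:M : 'M[R]_n) = n%:R; last by [].
by rewrite /fsq /fdot trmx1 mulmx1 mxtrace1.
Qed.

Definition usvt_constant (K : R) : R := 3 / 2 * (Num.sqrt (2 + 4 * K) + 1) + 2 * Num.sqrt K.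

Lemma usvt_constant_ge0 K : 0 <= usvt_constant K.
Proof. by rewrite addr_ge0 ?mulr_ge0 ?addr_ge0 ?sqrtr_ge0. Qed.

Lemma usvt_error c r t d K A Q : (forall i j, 0 <= Q i j <= r) -> r <= 1 -> 0 <= c -> 0 <= r ->
  opbound c (A - hollow Q) -> c + r <= t / 2 -> 0 < t -> 0 <= d ->
  sv_tail Q d <= K * t ^+ 2 * d ->
  fnorm (hollow Q - usvt t A) <= t * Num.sqrt d * usvt_constant K.
Proof.
move=> Qr r1 c0 r0 Ac crt t0 d0 tail.
rewrite -fnormN opprB (le_trans (fnorm_usvt_le _ _ _))//.
  by move=> i j; have /andP[-> qr] := Qr i j; rewrite (le_trans qr).
apply: usvt_trunc_error => //.
apply: (opbound_le _ crt); first by rewrite addr_ge0.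
have -> : A - Q = (A - hollow Q) + - (Q - hollow Q) by rewrite opprB addrA subrK.
by apply: opboundD => //; apply: opboundN; exact: opbound_diagonal.
Qed.

End Clipping.

Section Matching.
Context {R : realType} {n : nat}.
Implicit Types A B X Y E F : 'M[R]_n.

Lemma frobeniusE A : frobenius A = fnorm A.
Proof. by rewrite /frobenius /fnorm fsqE. Qed.

Lemma perm_mx_orth (s : 'S_n) : (perm_mx s)^T *m perm_mx s = 1%:M :> 'M[R]_n.
Proof. by rewrite tr_perm_mx -perm_mxM mulVg perm_mx1. Qed.

Lemma fsq_conj_perm (s : 'S_n) A : fsq (perm_mx s *m A *m (perm_mx s)^T) = fsq A.
Proof. by rewrite fsq_orthr ?trmxK ?perm_mx_orth// fsq_orth// perm_mx_orth. Qed.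

Lemma mxtrace_perm_mx (s : 'S_n) : \tr (perm_mx s) = n%:R - #|moved s|%:R :> R.
Proof.
have e : (#|moved s| + #|[set i | s i == i]| = n)%N.
  rewrite -[RHS]card_ord -(cardC (mem (moved s))); congr addn; apply: eq_card => i.
  by rewrite !inE negbK.
rewrite -[n in n%:R]e natrD addrAC subrr add0r.
rewrite -sum1_card natr_sum [RHS]big_mkcond; apply: eq_bigr => i _.
by rewrite !mxE inE; case: eqP.
Qed.

(** Comparison with the identity: conjugation preserves |B|, so the squares cancel and a linear
    inequality is left. *)
Lemma fdot_argmin_le0 A B (s : 'S_n) : matching_argmin A B (perm_mx s) ->
  fdot A (B - perm_mx s *m B *m (perm_mx s)^T) <= 0.
Proof.
case=> _ /(_ 1%:M (is_perm_mx1 _ _)); rewrite trmx1 mulmx1 mul1mx !frobeniusE.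
rewrite -ler_sqr ?nnegrE ?fnorm_ge0// !sqr_fnorm !fsqB fsq_conj_perm fdotBr; lra.
Qed.

Lemma argmin_gap_le X Y E F (s : 'S_n) : matching_argmin (X + E) (Y + F) (perm_mx s) ->
  fdot X (Y - perm_mx s *m Y *m (perm_mx s)^T) <=
  2 * (fnorm X * fnorm F + fnorm E * fnorm Y + fnorm E * fnorm F).
Proof.
move=> /fdot_argmin_le0.
pose D (Z : 'M[R]_n) := Z - perm_mx s *m Z *m (perm_mx s)^T.
have Dn Z : fnorm (D Z) <= 2 * fnorm Z.
  by rewrite (le_trans (fnormB _ _))// {2}/fnorm fsq_conj_perm -/(fnorm Z); lra.
have b U Z : - (2 * (fnorm U * fnorm Z)) <= fdot U (D Z).
  have := fdot_le U (D Z); rewrite ler_norml => /andP[+ _]; apply: le_trans.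
  by rewrite lerN2 mulrCA ler_wpM2l ?fnorm_ge0.
have -> : Y + F - perm_mx s *m (Y + F) *m (perm_mx s)^T = D Y + D F.
  by rewrite /D mulmxDr mulmxDl opprD addrACA.
rewrite -/(D Y) fdotDl (fdotDr X (D Y)) (fdotDr E (D Y)).
have := b X F; have := b E Y; have := b E F; lra.
Qed.

End Matching.

(** * The matching bound at a fixed size *)

Section FixedSize.
Local Open Scope classical_set_scope.
Context {R : realType} {d : measure_display} {T : measurableType d}.
Context {Pr : probability T R} {n : nat}.
Context {Q1 Q2 Rho : 'M[R]_n} {A B : T -> 'M[R]_n}.
Hypothesis model : corrER Pr Q1 Q2 Rho A B.

Let p := @edge_pmf R d T Pr n A B.
Let p0 : forall e v, 0 <= p e v. Proof. exact: edge_pmf_ge0. Qed.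
Let p1 : forall e, \sum_v p e v = 1. Proof. by move=> e; exact: (edge_pmf_sum1 model). Qed.
Let c := @edge_code R d T n A B.

Let x := centered (fun v : bool * bool => v.1) Q1.
Let y := centered (fun v : bool * bool => v.2) Q2.
Let X o := edge_matrix x (@sort_edge n) o.
Let Y o := edge_matrix y (@sort_edge n) o.

Let entry_code (Q : 'M[R]_n) (M : T -> 'M[R]_n) (sel : bool * bool -> bool) :
  random_graph Pr Q M -> Q^T = Q ->
  (forall w (e : 'I_n * 'I_n), (e.1 < e.2)%N -> sel (c w e) = (M w e.1 e.2 == 1)) ->
  forall w, M w = edge_matrix (centered sel Q) (@sort_edge n) (c w) + hollow Q.
Proof.
move=> [_ Msym Mdiag M01 _] Qsym selE w; apply/matrixP => i j; rewrite !mxE /centered.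
have [<-|ij] := eqVneq i j; first by rewrite /sort_edge ltnn /= ltnn addr0 Mdiag.
have lt := sort_edge_lt ij; rewrite lt selE//.
have [e1 e2] : M w (sort_edge i j).1 (sort_edge i j).2 = M w i j /\ Q (sort_edge i j).1 (sort_edge i j).2 = Q i j.
  rewrite /sort_edge; case: ifP => //= _; split; first by rewrite -[in LHS](Msym w) mxE.
  by rewrite -[in LHS]Qsym mxE.
rewrite e1 e2 subrK; case: (M01 w i j) => ->; rewrite ?eqxx//.
by rewrite eq_sym oner_eq0.
Qed.

Let AE w : A w = X (c w) + hollow Q1.
Proof.
have [[[Qs _] _ _] gA _ _ _] := model.
by apply: (entry_code gA Qs) => w' e ee; rewrite ffunE ee.
Qed.

Let BE w : B w = Y (c w) + hollow Q2.
Proof.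
have [[_ [Qs _] _] _ gB _ _] := model.
by apply: (entry_code gB Qs) => w' e ee; rewrite ffunE ee.
Qed.

Let EX i j : Ex p (fun o => X o i j) = 0.
Proof.
rewrite (eq_Ex p (g := fun o => x (sort_edge i j) (o (sort_edge i j)))) => [|o]; last by rewrite mxE.
rewrite (Ex_coord p1 (x (sort_edge i j))) (centered_mean0 p1)// => e ee.
exact: (edge_pmf_mean1 model).
Qed.

Let EY i j : Ex p (fun o => Y o i j) = 0.
Proof.
rewrite (eq_Ex p (g := fun o => y (sort_edge i j) (o (sort_edge i j)))) => [|o]; last by rewrite mxE.
rewrite (Ex_coord p1 (y (sort_edge i j))) (centered_mean0 p1)// => e ee.
exact: (edge_pmf_mean2 model).
Qed.

Let covE i j k l : fine (covariance Pr (fun w => A w i j) (fun w => B w k l)) =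
  Ex p (fun o => X o i j * Y o k l).
Proof.
have -> : (fun w => A w i j) = (fun w => (X (c w) + hollow Q1) i j) by apply/funext => w; rewrite AE.
have -> : (fun w => B w k l) = (fun w => (Y (c w) + hollow Q2) k l) by apply/funext => w; rewrite BE.
rewrite (covariance_code model (fun o => (X o + hollow Q1) i j) (fun o => (Y o + hollow Q2) k l)) /= -/p.
have -> : Ex p (fun o => (X o + hollow Q1) i j) = hollow Q1 i j.
  rewrite (eq_Ex p (g := fun o => X o i j + hollow Q1 i j)) => [|o]; last by rewrite mxE.
  by rewrite ExD EX Ex_cst// add0r.
have -> : Ex p (fun o => (Y o + hollow Q2) k l) = hollow Q2 k l.
  rewrite (eq_Ex p (g := fun o => Y o k l + hollow Q2 k l)) => [|o]; last by rewrite mxE.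
  by rewrite ExD EY Ex_cst// add0r.
apply: eq_Ex => o; rewrite [(X o + _) i j]mxE [(Y o + _) k l]mxE; ring.
Qed.

Let calXE s : calX Pr A B (perm_mx s) = 2^-1 * Ex p (perm_gap x y s).
Proof.
rewrite /calX; congr (_ * _).
rewrite (eq_Ex p (perm_gapE x y s)) Ex_sum; apply: eq_bigr => i _.
rewrite Ex_sum; apply: eq_bigr => j _.
have -> : (fun w => (perm_mx s *m B w *m (perm_mx s)^T) i j) = (fun w => B w (s i) (s j)).
  by apply/funext => w; rewrite conj_perm_mxE.
rewrite !covE -[X in _ + X]mulN1r -ExZ -ExD; apply: eq_Ex => o.
by rewrite -/(X o) -/(Y o); ring.
Qed.

Variables (r1 r2 d1 d2 K : R) (k0 : nat).
Let C : R := 6 * expR 98.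
(** Half of the threshold, (C + 1) sqrt (n r), must dominate C sqrt (n r) + r; this holds since r <=
    1 <= sqrt (n r). *)
Let a : R := 2 * (C + 1).
Let G : R := a * usvt_constant K.
Let err : R := (4 * C * G + 2 * G ^+ 2) * (n%:R * Num.sqrt n%:R) *
  ((Num.sqrt r1 + Num.sqrt r2) * (Num.sqrt (r1 * d1) + Num.sqrt (r2 * d2))).

Hypothesis n2 : (2 <= n)%N.
Hypotheses (r1_01 : 0 < r1 <= 1) (r2_01 : 0 < r2 <= 1).
Hypotheses (Q1r : forall i j, Q1 i j <= r1) (Q2r : forall i j, Q2 i j <= r2).
Hypotheses (nr1 : 1 <= n%:R * r1) (nr2 : 1 <= n%:R * r2).
Hypotheses (lnr1 : ln n%:R <= n%:R * r1) (lnr2 : ln n%:R <= n%:R * r2).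
Hypotheses (d1n : 0 <= d1 <= n%:R) (d2n : 0 <= d2 <= n%:R).
Hypotheses (tail1 : sv_tail Q1 d1 <= K * (n%:R * r1 * d1))
           (tail2 : sv_tail Q2 d2 <= K * (n%:R * r2 * d2)).
Hypothesis K_ge0 : 0 <= K.
Hypothesis calX_lb : forall s : 'S_n, s != 1%g ->
  1030 * #|moved s|%:R * (Num.sqrt n%:R * Num.sqrt (ln n%:R)) <= calX Pr A B (perm_mx s).
Hypothesis calX_err : forall s : 'S_n, (k0 < #|moved s|)%N -> err < calX Pr A B (perm_mx s).

Let n_gt0 : 0 < n%:R :> R. Proof. by rewrite ltr0n (leq_trans _ n2). Qed.
Let C_ge1 : 1 <= C.
Proof. by rewrite /C; have := expR_ge1Dx (98 : R); lra. Qed.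
Let a_ge1 : 1 <= a. Proof. by rewrite /a; have := C_ge1; lra. Qed.
Let G_ge0 : 0 <= G. Proof. by rewrite mulr_ge0 ?usvt_constant_ge0// (le_trans _ a_ge1). Qed.

Let Q1b i j : 0 <= Q1 i j <= r1.
Proof. by have [[[_ /(_ i j)/andP[-> _]] _ _] _ _ _ _] := model; rewrite Q1r. Qed.
Let Q2b i j : 0 <= Q2 i j <= r2.
Proof. by have [[_ [_ /(_ i j)/andP[-> _]] _] _ _ _ _] := model; rewrite Q2r. Qed.

Let bad1 := [pred o | ~~ `[< opbound (C * Num.sqrt (n%:R * r1)) (X o) >]].
Let bad2 := [pred o | ~~ `[< opbound (C * Num.sqrt (n%:R * r2)) (Y o) >]].
Let bad3 := [pred o | [exists s : 'S_n, (s != 1%g) && (perm_gap x y s o <= calX Pr A B (perm_mx s))]].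

Let bad1_le : \sum_(o | bad1 o) weight p o <= (n%:R ^+ 3)^-1.
Proof.
have /andP[_ r1_le1] := r1_01.
apply: (opbound_tail (@sort_edgeC n) (@sort_edge_inj n) p0 p1) => //.
- by move=> e; apply: centered_mean0 => // e' ee; exact: (edge_pmf_mean1 model).
- by move=> e v; exact: (centered_le1 _ Q1b).
- by move=> e; apply: (centered_var p1 Q1b) => // e' ee; exact: (edge_pmf_mean1 model).
Qed.

Let bad2_le : \sum_(o | bad2 o) weight p o <= (n%:R ^+ 3)^-1.
Proof.
have /andP[_ r2_le1] := r2_01.
apply: (opbound_tail (@sort_edgeC n) (@sort_edge_inj n) p0 p1) => //.
- by move=> e; apply: centered_mean0 => // e' ee; exact: (edge_pmf_mean2 model).
- by move=> e v; exact: (centered_le1 _ Q2b).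
- by move=> e; apply: (centered_var p1 Q2b) => // e' ee; exact: (edge_pmf_mean2 model).
Qed.

Let sum_pred_exists_le (I : finType) (P : pred I) (S : I -> pred {ffun 'I_n * 'I_n -> bool * bool}) :
  \sum_(o | [exists s, P s && S s o]) weight p o <= \sum_(s | P s) \sum_(o | S s o) weight p o.
Proof.
under [leRHS]eq_bigr do rewrite big_mkcond.
rewrite exchange_big big_mkcond; apply: ler_sum => o _.
have w0 : 0 <= weight p o by exact: weight_ge0.
have t0 s : 0 <= (if S s o then weight p o else 0) by case: ifP.
case: existsP => [[s /andP[Ps So]]|_]; last by rewrite sumr_ge0.
by rewrite (bigD1 s)//= So lerDl sumr_ge0.
Qed.

Let bad3_le : \sum_(o | bad3 o) weight p o <= 2 * (n%:R ^+ 4)^-1.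
Proof.
have /andP[_ r1_le1] := r1_01; have /andP[_ r2_le1] := r2_01.
have x1 e v : `|x e v| <= 1 := centered_le1 _ Q1b r1_le1 e v.
have y1 e v : `|y e v| <= 1 := centered_le1 _ Q2b r2_le1 e v.
pose L : R := ln n%:R.
have L0 : 0 <= L by rewrite ln_ge0// ler1n (leq_trans _ n2).
apply: le_trans (sum_pred_exists_le _ _) _.
apply: (@le_trans _ _ (\sum_(s : 'S_n | s != 1%g) ((n%:R ^+ 6)^-1) ^+ #|moved s|)).
  apply: ler_sum => s s1.
  (* With this [l] the two terms of the exponent are 1024 and 1030 times |moved| ln n; the margin 6
     makes each permutation cost n^(-6 |moved|). *)
  pose l : R := Num.sqrt L / Num.sqrt n%:R.
  have sn : 0 < Num.sqrt n%:R :> R by rewrite sqrtr_gt0.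
  have l0 : 0 <= l by rewrite divr_ge0 ?sqrtr_ge0.
  have ES : Ex p (perm_gap x y s) = 2 * calX Pr A B (perm_mx s) by rewrite calXE; field.
  apply: le_trans (perm_gap_tail p0 p1 x1 y1 l0 ES) _.
  have -> : (n%:R ^+ 6)^-1 ^+ #|moved s| = expR (- (6 * #|moved s|%:R * L)).
    rewrite -exprVn -exprM -[X in X^-1](@lnK R) ?posrE// -/L -expRN -expRM_natr natrM.
    by congr expR; ring.
  rewrite ler_expR.
  have l2 : l ^+ 2 * n%:R = L by rewrite expr_div_n !sqr_sqrtr// mulfVK// gt_eqF.
  have := ler_wpM2l l0 (calX_lb s1).
  have -> : l * (1030 * #|moved s|%:R * (Num.sqrt n%:R * Num.sqrt (ln n%:R))) = 1030 * #|moved s|%:R * L.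
    rewrite -/L -[in RHS](sqr_sqrtr L0) /l; field; exact: lt0r_neq0.
  have -> : 1024 * l ^+ 2 * (#|moved s|%:R * n%:R) = 1024 * #|moved s|%:R * L by rewrite -l2; ring.
  lra.
have n1 : 2 <= n%:R :> R by rewrite ler_nat.
have e : n%:R ^+ 2 * (n%:R ^+ 6)^-1 = (n%:R ^+ 4)^-1 :> R by field; exact: lt0r_neq0.
rewrite -e; apply: sum_perm_moved_le; first by rewrite invr_ge0 exprn_ge0.
rewrite e lef_pV2 ?posrE ?exprn_gt0//.
by rewrite (le_trans n1)// -[leLHS]expr1 ler_weXn2l// (le_trans _ n1)// ler1n.
Qed.

Let fnorm_X (r : R) (Z : 'M[R]_n) : 0 < r -> opbound (C * Num.sqrt (n%:R * r)) Z ->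
  fnorm Z <= C * n%:R * Num.sqrt r.
Proof.
move=> r0 Zc; have C0 : 0 <= C by rewrite (le_trans _ C_ge1).
apply: le_trans (fnorm_opbound _ Zc) _; first by rewrite mulr_ge0 ?sqrtr_ge0.
have e : Num.sqrt n%:R ^+ 2 = n%:R :> R by rewrite sqr_sqrtr ?ltW.
rewrite sqrtrM ?(ltW n_gt0)// -[X in _ <= C * X * _]e.
by rewrite le_eqVlt; apply/orP; left; apply/eqP; ring.
Qed.

Let fnorm_E (r dd : R) (Q M : 'M[R]_n) : 0 < r <= 1 -> (forall i j, 0 <= Q i j <= r) ->
  1 <= n%:R * r -> 0 <= dd -> sv_tail Q dd <= K * (n%:R * r * dd) ->
  opbound (C * Num.sqrt (n%:R * r)) (M - hollow Q) ->
  fnorm (hollow Q - usvt (a * Num.sqrt (n%:R * r)) M) <= G * Num.sqrt n%:R * Num.sqrt (r * dd).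
Proof.
move=> /andP[r0 rle1] Qr nr dd0 tail Mc; have C0 : 0 <= C by rewrite (le_trans _ C_ge1).
have snr : 1 <= Num.sqrt (n%:R * r) by rewrite -[leLHS]sqrtr1 ler_wsqrtr.
have a0 : 0 < a by rewrite (lt_le_trans _ a_ge1).
apply: le_trans (usvt_error (K := K) (d := dd) Qr rle1 _ (ltW r0) Mc _ _ dd0 _) _.
- by rewrite mulr_ge0 ?sqrtr_ge0.
- by rewrite /a; nra.
- by apply: mulr_gt0 => //; rewrite sqrtr_gt0 mulr_gt0.
- rewrite (le_trans tail)// exprMn sqr_sqrtr ?mulr_ge0 ?(ltW r0)//.
  have : 0 <= K * (n%:R * r * dd) by rewrite !mulr_ge0 ?(ltW r0).
  have : 1 <= a ^+ 2 by rewrite exprn_ege1.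
  nra.
rewrite /G !sqrtrM ?(ltW n_gt0) ?(ltW r0)//.
by rewrite le_eqVlt; apply/orP; left; apply/eqP; ring.
Qed.

Lemma matching_probability :
  ((1 - 5 / n%:R ^+ 2)%:E <= Pr [set w |
     let hatA := (A w - usvt (a * Num.sqrt (n%:R * r1)) (A w))%R in
     let hatB := (B w - usvt (a * Num.sqrt (n%:R * r2)) (B w))%R in
     matching_argmin hatA hatB
       `&` \bigcup_(i >= k0.+1) perm_matrices_moving R n i = set0])%E.
Proof.
have /andP[r1_0 r1_1] := r1_01; have /andP[r2_0 r2_1] := r2_01.
have /andP[d1_0 d1_n] := d1n; have /andP[d2_0 d2_n] := d2n.
pose event (o : {ffun 'I_n * 'I_n -> bool * bool}) :=
  let A' := X o + hollow Q1 in let B' := Y o + hollow Q2 in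
  matching_argmin (A' - usvt (a * Num.sqrt (n%:R * r1)) A') (B' - usvt (a * Num.sqrt (n%:R * r2)) B')
    `&` \bigcup_(i >= k0.+1) perm_matrices_moving R n i = set0.
have -> : [set w |
     let hatA := (A w - usvt (a * Num.sqrt (n%:R * r1)) (A w))%R in
     let hatB := (B w - usvt (a * Num.sqrt (n%:R * r2)) (B w))%R in
     matching_argmin hatA hatB
       `&` \bigcup_(i >= k0.+1) perm_matrices_moving R n i = set0] = [set w | event (c w)].
  by apply/funext => w; rewrite /mkset /= AE BE.
rewrite (probability_code model) -/p lee_fin.
have good o : ~~ (bad1 o || bad2 o || bad3 o) -> event o.
  rewrite !negb_or => /andP[/andP[nb1 nb2] /negP nb3].
  move: nb1 nb2; rewrite /= !negbK => /asboolP g1 /asboolP g2.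
  have g3 s : ~~ ((s != 1%g) && (perm_gap x y s o <= calX Pr A B (perm_mx s))).
    by apply/negP => h; apply: nb3; apply/existsP; exists s.
  rewrite /event /=; apply/seteqP; split=> // P [argP [i ki [Pperm trP]]].
  have [s Ps] := is_perm_mxP _ Pperm; subst P.
  have ms : #|moved s| = i.
    move: trP; rewrite mxtrace_perm_mx => /(addrI _)/oppr_inj/eqP.
    by rewrite eqr_nat => /eqP.
  have gap : err < perm_gap x y s o.
    have s1 : s != 1%g.
      apply: contraTneq (leq_ltn_trans (leq0n k0) ki) => s1.
      by rewrite -ms s1 -leqNgt leqn0 cards_eq0; apply/eqP/setP => j; rewrite !inE perm1 eqxx.
    have := g3 s; rewrite s1 /= -ltNge; apply: lt_trans; apply: calX_err.
    by rewrite ms.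
  set hA := usvt _ (X o + _) in argP; set hB := usvt _ (Y o + _) in argP.
  have eA : X o + hollow Q1 - hA = X o + (hollow Q1 - hA) by rewrite addrA.
  have eB : Y o + hollow Q2 - hB = Y o + (hollow Q2 - hB) by rewrite addrA.
  rewrite eA eB in argP; have := argmin_gap_le argP; rewrite -/(perm_gap x y s o) leNgt => /negP; apply.
  apply: le_lt_trans gap.
  have nX := fnorm_X r1_0 g1; have nY := fnorm_X r2_0 g2.
  have nE : fnorm (hollow Q1 - hA) <= G * Num.sqrt n%:R * Num.sqrt (r1 * d1).
    by apply: fnorm_E => //; rewrite addrK.
  have nF : fnorm (hollow Q2 - hB) <= G * Num.sqrt n%:R * Num.sqrt (r2 * d2).
    by apply: fnorm_E => //; rewrite addrK.
  (* The cruder bound from d2 <= n brings the product of the two errors to the same form as the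
     mixed terms. *)
  have nF' : fnorm (hollow Q2 - hB) <= G * n%:R * Num.sqrt r2.
    have e : Num.sqrt n%:R ^+ 2 = n%:R :> R by rewrite sqr_sqrtr ?ltW.
    apply: le_trans nF _; rewrite sqrtrM ?(ltW r2_0)// -[X in _ <= G * X * _]e expr2.
    have : Num.sqrt d2 <= Num.sqrt n%:R by rewrite ler_wsqrtr.
    move=> h; have := ler_wpM2l (mulr_ge0 (mulr_ge0 G_ge0 (sqrtr_ge0 n%:R)) (sqrtr_ge0 r2)) h; lra.
  have h1 := ler_pM (fnorm_ge0 _) (fnorm_ge0 _) nX nF.
  have h2 := ler_pM (fnorm_ge0 _) (fnorm_ge0 _) nE nY.
  have h3 := ler_pM (fnorm_ge0 _) (fnorm_ge0 _) nE nF'.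
  move: h1 h2 h3; rewrite /err.
  move: (fnorm _ * fnorm _) (fnorm _ * fnorm _) (fnorm _ * fnorm _) => u3 u2 u1.
  have := sqrtr_ge0 r1; have := sqrtr_ge0 r2.
  have := sqrtr_ge0 (r1 * d1); have := sqrtr_ge0 (r2 * d2).
  move: (Num.sqrt r1) (Num.sqrt r2) (Num.sqrt (r1 * d1)) (Num.sqrt (r2 * d2)) => a1 a2 b1 b2 b20 b10 a20 a10.
  move=> h1 h2 h3.
  pose N : R := n%:R * Num.sqrt n%:R.
  have N0 : 0 <= N by rewrite mulr_ge0 ?sqrtr_ge0.
  have C0 : 0 <= C by rewrite (le_trans _ C_ge1).
  have CG : 0 <= C * G * N by exact: mulr_ge0 (mulr_ge0 C0 G_ge0) N0.
  have GG : 0 <= G ^+ 2 * N by rewrite mulr_ge0 ?sqr_ge0.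
  have q1 : u1 <= C * G * N * (a1 * b2) by apply: le_trans h1 _; rewrite /N le_eqVlt; apply/orP; left; apply/eqP; ring.
  have q2 : u2 <= C * G * N * (a2 * b1) by apply: le_trans h2 _; rewrite /N le_eqVlt; apply/orP; left; apply/eqP; ring.
  have q3 : u3 <= G ^+ 2 * N * (a2 * b1) by apply: le_trans h3 _; rewrite /N le_eqVlt; apply/orP; left; apply/eqP; ring.
  have p11 : 0 <= a1 * b1 by rewrite mulr_ge0.
  have p12 : 0 <= a1 * b2 by rewrite mulr_ge0.
  have p21 : 0 <= a2 * b1 by rewrite mulr_ge0.
  have p22 : 0 <= a2 * b2 by rewrite mulr_ge0.
  rewrite -/N.
  have -> : (4 * C * G + 2 * G ^+ 2) * N * ((a1 + a2) * (b1 + b2)) =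
    (4 * (C * G * N) + 2 * (G ^+ 2 * N)) * (a1 * b1 + a1 * b2 + a2 * b1 + a2 * b2) by ring.
  move: (C * G * N) (G ^+ 2 * N) CG GG q1 q2 q3 => m1 m2 m10 m20 q1 q2 q3.
  move: (a1 * b1) (a1 * b2) (a2 * b1) (a2 * b2) p11 p12 p21 p22 q1 q2 q3 => z1 z2 z3 z4 *.
  nra.
have total : 1 = \sum_o weight p o :> R.
  by rewrite -[LHS](Ex_cst p1 1); apply: eq_bigr => o _; rewrite mulr1.
have w0 o : 0 <= weight p o by exact: weight_ge0.
have cover : \sum_o weight p o <= \sum_(o | `[< event o >]) weight p o +
   (\sum_(o | bad1 o) weight p o + \sum_(o | bad2 o) weight p o + \sum_(o | bad3 o) weight p o).
  rewrite [X in _ <= X + _]big_mkcond [X in _ <= _ + (X + _ + _)]big_mkcond.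
  rewrite [X in _ <= _ + (_ + X + _)]big_mkcond [X in _ <= _ + (_ + X)]big_mkcond.
  rewrite -!big_split /=; apply: ler_sum => o _.
  have [ev|nev] := boolP `[< event o >].
    by rewrite lerDl !addr_ge0//; case: ifP.
  move/asboolPn: nev => nev.
  have : bad1 o || bad2 o || bad3 o by apply: contra_notT nev; exact: good.
  have if0 (b : bool) : 0 <= (if b then weight p o else 0) by case: b.
  move=> /orP[/orP[|]|] /= ->; have := if0 (bad1 o); have := if0 (bad2 o); have := if0 (bad3 o); rewrite /=; lra.
have n1 : 2 <= n%:R :> R by rewrite ler_nat.
have i2 : 0 < (n%:R ^+ 2)^-1 :> R by rewrite invr_gt0 exprn_gt0.
have i3 : (n%:R ^+ 3)^-1 <= (n%:R ^+ 2)^-1 :> R.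
  by rewrite lef_pV2 ?posrE ?exprn_gt0// ler_weXn2l//; lra.
have i4 : (n%:R ^+ 4)^-1 <= (n%:R ^+ 2)^-1 :> R.
  by rewrite lef_pV2 ?posrE ?exprn_gt0// ler_weXn2l//; lra.
have := bad1_le; have := bad2_le; have := bad3_le; lra.
Qed.

End FixedSize.

(** * From fixed size to the asymptotic statement *)

Local Open Scope classical_set_scope.

Lemma little_omega_near (R : realType) (f g : nat -> R) (e : R) : little_omega f g -> 0 < e ->
  \forall n \near \oo, `|g n| <= e * `|f n|.
Proof. by move=> /eqoP h e0; exact: h. Qed.

(** This turns the degree condition into ln n <= n r, the form in which the tail bound uses it. *)
Lemma min_row_sum_le (R : realType) n (Q : 'M[R]_n) (r : R) : (0 < n)%N ->
  (forall i j, 0 <= Q i j <= r) -> 0 <= min_row_sum Q <= n%:R * r.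
Proof.
move=> n0 Qr; have lb : lbound [set \sum_l Q j l | j in [set: 'I_n]] 0.
  by move=> _ [j _ <-]; apply: sumr_ge0 => l _; have /andP[] := Qr j l.
have j0 : 'I_n := Ordinal n0.
apply/andP; split.
  by apply: lb_le_inf => //; exists (\sum_l Q j0 l); exists j0.
apply: le_trans (ge_inf _ _ : _ <= \sum_l Q j0 l) _; first by exists 0.
  by exists j0.
rewrite -[n in leRHS]card_ord mulr_natl -sumr_const; apply: ler_sum => l _.
by have /andP[] := Qr j0 l.
Qed.

Unset Implicit Arguments.

Theorem theorem9 (R : realType)
    (disp : nat -> measure_display) (T : forall n, measurableType (disp n))
    (Pr : forall n, probability (T n) R)
    (Q1 Q2 Rho : forall n, 'M[R]_n)
    (A B : forall n, T n -> 'M[R]_n)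
    (r1 r2 d1 d2 delta : nat -> R)
    (model : forall n, corrER (Pr n) (Q1 n) (Q2 n) (Rho n) (A n) (B n))
    (r1_01 : forall n, 0 <= r1 n <= 1)
    (r2_01 : forall n, 0 <= r2 n <= 1)
    (Q1_le : forall n (u v : 'I_n), Q1 n u v <= r1 n)
    (Q2_le : forall n (u v : 'I_n), Q2 n u v <= r2 n)
    (deg1 : little_omega (fun n => min_row_sum (Q1 n)) (fun n => ln n%:R))
    (deg2 : little_omega (fun n => min_row_sum (Q2 n)) (fun n => ln n%:R))
    (d1_ge0 : forall n, 0 <= d1 n)
    (d2_ge0 : forall n, 0 <= d2 n)
    (d1_o : (d1 : nat -> R^o) =o_\oo (fun n => n%:R : R^o))
    (d2_o : (d2 : nat -> R^o) =o_\oo (fun n => n%:R : R^o))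
    (tail1 : (fun n => sv_tail (Q1 n) (d1 n) : R^o)
               =O_\oo (fun n => n%:R * r1 n * d1 n : R^o))
    (tail2 : (fun n => sv_tail (Q2 n) (d2 n) : R^o)
               =O_\oo (fun n => n%:R * r2 n * d2 n : R^o))
    (delta_ge0 : forall n, 0 <= delta n)
    (calX_omega : forall e : R, 0 < e ->
       \forall n \near \oo, forall k : nat, (1 <= k <= n)%N ->
         forall P : 'M[R]_n, perm_matrices_moving R n k P ->
           n%:R `^ (2^-1 + delta n) * Num.sqrt (ln n%:R)
             <= e * (calX (Pr n) (A n) (B n) P / k%:R)) :
  exists a1 a2 : R, [/\ 0 < a1, 0 < a2 &
    forall k0 : nat -> nat, (forall n, (0 < k0 n)%N) ->
      little_omega (fun n => (k0 n)%:R)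
        (fun n => n%:R `^ (1 - delta n) / Num.sqrt (ln n%:R)
                  * (Num.sqrt (r1 n) + Num.sqrt (r2 n))
                  * (Num.sqrt (r1 n * d1 n) + Num.sqrt (r2 n * d2 n))) ->
      \forall n \near \oo,
        ((1 - 5 / n%:R ^+ 2)%:E <= Pr n [set w |
           let hatA := (A n w - usvt (a1 * Num.sqrt (n%:R * r1 n)) (A n w))%R in
           let hatB := (B n w - usvt (a2 * Num.sqrt (n%:R * r2 n)) (B n w))%R in
           matching_argmin hatA hatB
             `&` \bigcup_(i >= (k0 n).+1) perm_matrices_moving R n i = set0])%E].
Proof.
have Qr (Q : forall n, 'M[R]_n) (r : nat -> R) : (forall n, edge_prob_matrix (Q n)) ->
    (forall n (u v : 'I_n), Q n u v <= r n) -> forall n i j, 0 <= Q n i j <= r n.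
  by move=> Qp Qle n i j; have [_ /(_ i j)/andP[-> _]] := Qp n; rewrite Qle.
have Q1r : forall n i j, 0 <= Q1 n i j <= r1 n by apply: Qr => // n; have [[]] := model n.
have Q2r : forall n i j, 0 <= Q2 n i j <= r2 n by apply: Qr => // n; have [[]] := model n.
have /eqO_exP[K1 K1_gt0 near_tail1] := tail1.
have /eqO_exP[K2 K2_gt0 near_tail2] := tail2.
pose K := K1 + K2; have K_ge0 : 0 <= K by rewrite addr_ge0 ?ltW.
pose C : R := 6 * expR 98; pose a : R := 2 * (C + 1).
have C0 : 0 < C by rewrite mulr_gt0 ?expR_gt0.
have a0 : 0 < a by rewrite mulr_gt0 ?addr_gt0.
exists a, a; split=> // k0 k0_gt0 k0_omega.
pose G := a * usvt_constant K.
pose W := 4 * C * G + 2 * G ^+ 2.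
have G0 : 0 <= G by rewrite mulr_ge0 ?usvt_constant_ge0// ltW.
have W0 : 0 <= W.
  by apply: addr_ge0; [exact: mulr_ge0 (mulr_ge0 _ (ltW C0)) G0|rewrite mulr_ge0 ?sqr_ge0].
have W1 : 0 < W + 1 by rewrite ltr_wpDl.
have near_n : \forall n \near \oo, expR 1 <= n%:R :> R by exact: nbhs_infty_ger.
have near_d (dd : nat -> R) : (dd : nat -> R^o) =o_\oo (fun n => n%:R : R^o) ->
    \forall n \near \oo, `|dd n| <= 1 * `|n%:R : R|.
  by move=> /eqoP h; exact: h.
have near_d1 := near_d _ d1_o; have near_d2 := near_d _ d2_o.
have near_deg1 := little_omega_near deg1 ltr01.
have near_deg2 := little_omega_near deg2 ltr01.
have c1030 : 0 < 1030 :> R by rewrite ltr0n.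
have c0 : 0 < 1030^-1 :> R by rewrite invr_gt0.
(* 1030 is the constant of the union bound at fixed size. *)
have near_calX := calX_omega 1030^-1 c0.
have Wi : 0 < (W + 1)^-1 by rewrite invr_gt0.
have near_k0 := little_omega_near k0_omega Wi.
near=> n.
have ne : expR 1 <= n%:R :> R by near: n.
have n2R : 2 <= n%:R :> R by apply: le_trans ne; have := expR_ge1Dx (1 : R); lra.
have n2 : (2 <= n)%N by rewrite ler_nat in n2R.
have n0 : 0 < n%:R :> R by lra.
have L1 : 1 <= ln n%:R :> R by rewrite -[leLHS](@expRK R) ler_ln ?posrE ?expR_gt0.
have nr (Q : 'M[R]_n) (r : R) : (forall i j, 0 <= Q i j <= r) ->
    `|ln n%:R| <= 1 * `|min_row_sum Q| -> ln n%:R <= n%:R * r.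
  move=> Qb; have /andP[m0 mle] := min_row_sum_le (ltnW n2) Qb.
  by rewrite mul1r ger0_norm ?(le_trans _ L1)// ger0_norm// => h; exact: le_trans h mle.
have lnr1 : ln n%:R <= n%:R * r1 n by apply: nr (Q1r n) _; near: n.
have lnr2 : ln n%:R <= n%:R * r2 n by apply: nr (Q2r n) _; near: n.
have r1_gt0 : 0 < r1 n by rewrite -(pmulr_rgt0 _ n0) (lt_le_trans _ lnr1)// (lt_le_trans _ L1).
have r2_gt0 : 0 < r2 n by rewrite -(pmulr_rgt0 _ n0) (lt_le_trans _ lnr2)// (lt_le_trans _ L1).
have d1n : 0 <= d1 n <= n%:R.
  rewrite d1_ge0 /=; have : `|d1 n| <= 1 * `|n%:R : R| by near: n.
  by rewrite mul1r ger0_norm// ger0_norm.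
have d2n : 0 <= d2 n <= n%:R.
  rewrite d2_ge0 /=; have : `|d2 n| <= 1 * `|n%:R : R| by near: n.
  by rewrite mul1r ger0_norm// ger0_norm.
have tail1n : sv_tail (Q1 n) (d1 n) <= K * (n%:R * r1 n * d1 n).
  have nrd : 0 <= n%:R * r1 n * d1 n by rewrite !mulr_ge0// ltW.
  have : `|sv_tail (Q1 n) (d1 n)| <= K1 * `|n%:R * r1 n * d1 n| by near: n.
  rewrite [X in _ * X]ger0_norm// => h; rewrite (le_trans (ler_norm _))// (le_trans h)//.
  by rewrite ler_wpM2r// lerDl ltW.
have tail2n : sv_tail (Q2 n) (d2 n) <= K * (n%:R * r2 n * d2 n).
  have nrd : 0 <= n%:R * r2 n * d2 n by rewrite !mulr_ge0// ltW.
  have : `|sv_tail (Q2 n) (d2 n)| <= K2 * `|n%:R * r2 n * d2 n| by near: n.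
  rewrite [X in _ * X]ger0_norm// => h; rewrite (le_trans (ler_norm _))// (le_trans h)//.
  by rewrite ler_wpM2r// lerDr ltW.
pose g : R := n%:R `^ (2^-1 + delta n) * Num.sqrt (ln n%:R).
have calXn (s : 'S_n) : s != 1%g -> 1030 * #|moved s|%:R * g <= calX (Pr n) (A n) (B n) (perm_mx s).
  move=> s1.
  have ms : (0 < #|moved s|)%N.
    rewrite card_gt0; apply: contra s1 => /eqP m0; apply/eqP/permP => i; rewrite perm1.
    by have /setP/(_ i) := m0; rewrite !inE => /negbFE/eqP.
  have h : forall k : nat, (1 <= k <= n)%N ->
         forall P : 'M[R]_n, perm_matrices_moving R n k P ->
           n%:R `^ (2^-1 + delta n) * Num.sqrt (ln n%:R)
             <= 1030^-1 * (calX (Pr n) (A n) (B n) P / k%:R) by near: n.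
  have mn : (1 <= #|moved s| <= n)%N by rewrite ms -[leqRHS]card_ord max_card.
  have := h _ mn (perm_mx s) (conj (perm_mx_is_perm _ s) (mxtrace_perm_mx s)).
  rewrite -/g (ler_pdivlMl _ _ c1030) ler_pdivlMr ?ltr0n//.
  by rewrite [1030 * g * _]mulrAC.
have gn : Num.sqrt n%:R * Num.sqrt (ln n%:R) <= g.
  rewrite /g ler_wpM2r ?sqrtr_ge0// -(powR12_sqrt (ltW n0)); apply: ler_powR; rewrite ?lerDl//; lra.
have g0 : 0 < g by rewrite mulr_gt0 ?powR_gt0 ?sqrtr_gt0// (lt_le_trans _ L1).
pose H := (Num.sqrt (r1 n) + Num.sqrt (r2 n)) * (Num.sqrt (r1 n * d1 n) + Num.sqrt (r2 n * d2 n)).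
have H0 : 0 <= H by rewrite mulr_ge0 ?addr_ge0 ?sqrtr_ge0.
have k0n : (W + 1) * (n%:R `^ (1 - delta n) / Num.sqrt (ln n%:R) * H) <= (k0 n)%:R.
  have : `|n%:R `^ (1 - delta n) / Num.sqrt (ln n%:R)
                  * (Num.sqrt (r1 n) + Num.sqrt (r2 n))
                  * (Num.sqrt (r1 n * d1 n) + Num.sqrt (r2 n * d2 n))| <= (W + 1)^-1 * `|(k0 n)%:R : R|.
    by near: n.
  rewrite -mulrA -/H normr_nat ler_pdivlMl// => h; apply: le_trans h.
  by rewrite ler_wpM2l ?(ltW W1)// ler_norm.
apply: (matching_probability (model n) (d1 := d1 n) (d2 := d2 n) (K := K)) => //.
- by rewrite r1_gt0; have /andP[] := r1_01 n.
- by rewrite r2_gt0; have /andP[] := r2_01 n.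
- exact: le_trans L1 lnr1.
- exact: le_trans L1 lnr2.
- move=> s s1; apply: le_trans (calXn s s1).
  exact: ler_wpM2l (mulr_ge0 (ltW c1030) (ler0n _ _)) _ _ gn.
- move=> s ks.
  have s1 : s != 1%g.
    apply: contraTneq (leq_ltn_trans (leq0n _) ks) => ->.
    by rewrite -leqNgt leqn0 cards_eq0; apply/eqP/setP => j; rewrite !inE perm1 eqxx.
  apply: lt_le_trans (calXn s s1).
  have kg : (k0 n)%:R * g < 1030 * #|moved s|%:R * g.
    rewrite ltr_pM2r//; have : (k0 n)%:R < #|moved s|%:R :> R by rewrite ltr_nat.
    have : 0 <= #|moved s|%:R :> R by []. lra.
  apply: le_lt_trans kg; have := ler_wpM2r (ltW g0) k0n; apply: le_trans.
  (* The powers n^(1 - delta) and n^(1/2 + delta) combine to n^(3/2), the scale of the error term,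
     and the logarithms cancel. *)
  have -> : (W + 1) * (n%:R `^ (1 - delta n) / Num.sqrt (ln n%:R) * H) * g =
    (W + 1) * (n%:R * Num.sqrt n%:R) * H.
    have sl : Num.sqrt (ln n%:R) != 0 :> R by rewrite sqrtr_eq0 -ltNge (lt_le_trans _ L1).
    have e : n%:R `^ (1 - delta n) * n%:R `^ (2^-1 + delta n) = n%:R * Num.sqrt n%:R :> R.
      rewrite -powRD; last by rewrite (gt_eqF n0) implybT.
      have -> : 1 - delta n + (2^-1 + delta n) = 1 + 2^-1 by ring.
      by rewrite powRD ?(gt_eqF n0) ?implybT// powRr1 ?ltW// powR12_sqrt ?ltW.
    by rewrite -e /g; field.
  rewrite -/C -/a -/G -/W -mulrA -[leRHS]mulrA ler_wpM2r ?lerDl// mulr_ge0// mulr_ge0 ?sqrtr_ge0// ltW.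
Unshelve. all: by end_near.
Qed.
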